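(* Let $J,K$ be Hopf algebras over a field $k$ with bijective antipode, let $V\in{}^{J}_{J}\mathcal{YD}$, $W\in{}^{K}_{K}\mathcal{YD}$, let $R$ be a pre-Nichols algebra of $V$ in ${}^{J}_{J}\mathcal{YD}$, and let $S$ be a pre-Nichols algebra of $W$ in ${}^{K}_{K}\mathcal{YD}$. Suppose that a skew pairing $\tau:J\otimes K\to k$ is given. Let $\lambda:W\otimes V\to k$ be a linear map such that $$\lambda(x\rightharpoonup w,v)=\tau(v_{-1},\mathcal{S}(x))\,\lambda(w,v_0),\qquad \lambda(w,a\rightharpoonup v)=\tau(a,w_{-1})\,\lambda(w_0,v)$$ for all $a\in J$, $x\in K$, $v\in V$, $w\in W$. Then $\tau$ extends uniquely to a skew pairing $$\tau:(R\# J)\otimes(S\# K)\to k$$ such that $$\tau(a,w)=0=\tau(v,x),\qquad \tau(v,w)=-\lambda(w,v)$$ for all $a\in J$, $x\in K$, $v\in V$, $w\in W$. By the $2$-cocycle corresponding to this skew pairing, the product on $(R\# J)\otimes(S\# K)$ is deformed so that \begin{align*} x\cdot a&=\tau(a_1,x_1)\,a_2\otimes x_2\,\tau(\mathcal{S}(a_3),x_3),\\ x\cdot v&=\tau(v_{-1},x_1)\,v_0\otimes x_2,\\ w\cdot a&=\tau(a_1,w_{-1})\,a_2\otimes w_0,\\ w\cdot v&=\tau(v_{-1},w_{-1})\,v_0\otimes w_0-\lambda(w,v)+w_{-1}\cdot v_{-1}\,\lambda(w_0,v_0), \end{align*} for all $a\in J$, $x\in K$, $v\in V$, $w\in W$.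
   Context: Conventions. $\otimes=\otimes_k$. Sigma notation: $\Delta(h)=h_1\otimes h_2$, left coactions $v\mapsto v_{-1}\otimes v_0$; $\rightharpoonup$ denotes a left action; $\mathcal{S}$ is the antipode and $\varepsilon$ the counit. For a Hopf algebra $H$ with bijective antipode, ${}^{H}_{H}\mathcal{YD}$ is the braided tensor category of left Yetter-Drinfeld modules: left $H$-modules and left $H$-comodules $V$ such that $h\rightharpoonup v$ has coaction $h_1v_{-1}\mathcal{S}(h_3)\otimes(h_2\rightharpoonup v_0)$, with braiding $c_{V,W}(v\otimes w)=(v_{-1}\rightharpoonup w)\otimes v_0$. A pre-Nichols algebra of $V\in{}^{H}_{H}\mathcal{YD}$ is a graded braided bialgebra $R=\bigoplus_{n\ge0}R(n)$ in ${}^{H}_{H}\mathcal{YD}$ with $R(0)=k$ (the unit object), $R(1)=V$ as objects, and $R$ generated by $R(1)$ (it is automatically a braided Hopf algebra). Its bosonization $R\# H$ is the Hopf algebra on $R\otimes H$ with product $(a\otimes h)(b\otimes l)=a(h_1\rightharpoonup b)\otimes h_2l$ and coproduct $\Delta(a\otimes h)=(a_1\otimes(a_2)_{-1}h_1)\otimes((a_2)_0\otimes h_2)$. One regards $V\subset R\subset R\# J$, $J\subset R\# J$, $W\subset S\subset S\# K$, $K\subset S\# K$. A skew pairing of Hopf algebras $J,K$ is a linear map $\tau:J\otimes K\to k$ with $\tau(ab,x)=\tau(a,x_1)\tau(b,x_2)$, $\tau(a,xy)=\tau(a_1,y)\tau(a_2,x)$, $\tau(1,x)=\varepsilon(x)$,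 $\tau(a,1)=\varepsilon(a)$ for $a,b\in J$, $x,y\in K$. It gives a $2$-cocycle $\sigma$ on the tensor-product Hopf algebra $J\otimes K$ by $\sigma(a\otimes x,b\otimes y)=\varepsilon(a)\tau(b,x)\varepsilon(y)$; this is the corresponding $2$-cocycle. (A $2$-cocycle on a Hopf algebra $L$ is a convolution-invertible linear map $\sigma:L\otimes L\to k$ with $\sigma(g_1,h_1)\sigma(g_2h_2,l)=\sigma(h_1,l_1)\sigma(g,h_2l_2)$ and $\sigma(h,1)=\varepsilon(h)=\sigma(1,h)$.) The product deformed by $\sigma$ is $g\cdot h=\sigma(g_1,h_1)g_2h_2\sigma^{-1}(g_3,h_3)$; it makes the coalgebra $L$ into a Hopf algebra $L^\sigma$, the cocycle deformation. In the claim this is applied to the tensor-product Hopf algebra $L=(R\# J)\otimes(S\# K)$ and the extended $\tau$; elements of $R\# J$ and of $S\# K$ are identified with their images $a\otimes1$ and $1\otimes x$ in $L$, and $\cdot$ denotes the deformed product. *)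

(* Defs.v *)
From HB Require Import structures.
From mathcomp Require Import all_boot all_order all_algebra.
From mathcomp Require Import boolp.

Set Implicit Arguments.
Unset Strict Implicit.
Unset Printing Implicit Defensive.

Import GRing.Theory.
Local Open Scope ring_scope.
Local Open Scope quotient_scope.

Reserved Notation "A \otimes B" (at level 40, left associativity).
Reserved Notation "a \ox b" (at level 40, left associativity).
Reserved Notation "\sw_ ( a , b <- t ) F"
  (at level 41, F at level 41, a name, b name,
   format "'[' \sw_ ( a ,  b  <-  t ) '/  '  F ']'").

(* Formal sums of pairs, modulo the pairs of sums that no bilinear map
   separates: this is the universal property of the tensor product. *)
Section Tensor.
Variables (k : fieldType) (A B : lmodType k).

Definition bilin (U : lmodType k) (f : A -> B -> U) : Prop :=
  (forall b, linear (f^~ b)) /\ (forall a, linear (f a)).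

Definition tens_eval (U : lmodType k) (s : seq (A * B)) (f : A -> B -> U) : U :=
  \sum_(p <- s) f p.1 p.2.

Definition tens_rel (s t : seq (A * B)) : bool :=
  `[< forall (U : lmodType k) (f : A -> B -> U),
        bilin f -> tens_eval s f = tens_eval t f >].

Lemma tens_rel_equiv : equiv_class_of tens_rel.
Proof.
split.
- by move=> s; apply/asboolP.
- by move=> s t; apply/idP/idP => /asboolP H; apply/asboolP => U f bf;
    rewrite H.
- move=> s t u /asboolP H1 /asboolP H2; apply/asboolP => U f bf.
  by rewrite H1 // H2.
Qed.

Canonical tens_equiv := EquivRelPack tens_rel_equiv.

Definition tensor := {eq_quot tens_rel}.

HB.instance Definition _ := Choice.on tensor.
HB.instance Definition _ := EqQuotient.on tensor.

(* The sum of F a b over the terms a (x) b of a representative of t; it does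
   not depend on the representative when F is bilinear (sweedler_pure and
   sweedler_linear), which is the only case in which it is used. *)
Definition sweedler (U : lmodType k) (t : tensor) (F : A -> B -> U) : U :=
  \sum_(p <- repr t) F p.1 p.2.

Definition pure (a : A) (b : B) : tensor := \pi_tensor [:: (a, b)].

Lemma sweedler_pi (U : lmodType k) (s : seq (A * B)) (F : A -> B -> U) :
  bilin F -> sweedler (\pi_tensor s) F = tens_eval s F.
Proof.
move=> bF; have /eqmodP/asboolP : repr (\pi_tensor s) = s %[mod tensor].
  by rewrite reprK.
exact.
Qed.

Lemma tensorP (s t : tensor) :
  (forall (U : lmodType k) (f : A -> B -> U),
    bilin f -> sweedler s f = sweedler t f) -> s = t.
Proof.
move=> H; rewrite -[s]reprK -[t]reprK; apply/eqmodP/asboolP => U f bf.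
exact: H.
Qed.

Definition tens_zero : tensor := \pi_tensor [::].
Definition tens_add (s t : tensor) : tensor := \pi_tensor (repr s ++ repr t).
Definition tens_scale (c : k) (t : tensor) : tensor :=
  \pi_tensor [seq (c *: p.1, p.2) | p <- repr t].
Definition tens_opp (t : tensor) : tensor := tens_scale (-1) t.

Lemma sweedler_0 (U : lmodType k) (f : A -> B -> U) :
  bilin f -> sweedler tens_zero f = 0.
Proof. by move=> bf; rewrite sweedler_pi // /tens_eval big_nil. Qed.

Lemma sweedler_add (U : lmodType k) (f : A -> B -> U) s t :
  bilin f -> sweedler (tens_add s t) f = sweedler s f + sweedler t f.
Proof. by move=> bf; rewrite sweedler_pi // /tens_eval big_cat. Qed.

Lemma sweedler_scale (U : lmodType k) (f : A -> B -> U) c t :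
  bilin f -> sweedler (tens_scale c t) f = c *: sweedler t f.
Proof.
move=> bf; rewrite sweedler_pi // /tens_eval big_map scaler_sumr.
by apply: eq_bigr => p _ /=; exact: (scalable_linear (bf.1 p.2)).
Qed.

Let swE := (sweedler_0, sweedler_add, sweedler_scale).

Lemma tens_addA : associative tens_add.
Proof. by move=> x y z; apply: tensorP => U f bf; rewrite !swE // addrA. Qed.
Lemma tens_addC : commutative tens_add.
Proof. by move=> x y; apply: tensorP => U f bf; rewrite !swE // addrC. Qed.
Lemma tens_add0 : left_id tens_zero tens_add.
Proof. by move=> x; apply: tensorP => U f bf; rewrite !swE // add0r. Qed.
Lemma tens_addN : left_inverse tens_zero tens_opp tens_add.
Proof.
by move=> x; apply: tensorP => U f bf; rewrite !swE // scaleN1r addNr.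
Qed.

HB.instance Definition _ :=
  GRing.isZmodule.Build tensor tens_addA tens_addC tens_add0 tens_addN.

Lemma tens_scaleA a b v : tens_scale a (tens_scale b v) = tens_scale (a * b) v.
Proof. by apply: tensorP => U f bf; rewrite !swE // scalerA. Qed.
Lemma tens_scale1 : left_id 1 tens_scale.
Proof. by move=> x; apply: tensorP => U f bf; rewrite !swE // scale1r. Qed.
Lemma tens_scaleDr : right_distributive tens_scale +%R.
Proof.
by move=> c x y; apply: tensorP => U f bf; rewrite !swE // scalerDr.
Qed.
Lemma tens_scaleDl v : {morph tens_scale^~ v : a b / a + b}.
Proof.
by move=> a b /=; apply: tensorP => U f bf; rewrite !swE // scalerDl.
Qed.

HB.instance Definition _ :=
  GRing.Zmodule_isLmodule.Build k tensor
    tens_scaleA tens_scale1 tens_scaleDr tens_scaleDl.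

Lemma sweedler_linear (U : lmodType k) (f : A -> B -> U) :
  bilin f -> linear (fun t => sweedler t f).
Proof. by move=> bf c x y; rewrite /= !swE. Qed.

Lemma sweedler_pure (U : lmodType k) (f : A -> B -> U) a b :
  bilin f -> sweedler (pure a b) f = f a b.
Proof. by move=> bf; rewrite sweedler_pi // /tens_eval big_seq1. Qed.

Lemma pure_linl b : linear (fun a => pure a b).
Proof.
move=> c x y; apply: tensorP => U f bf /=.
by rewrite sweedler_linear // !sweedler_pure // bf.1.
Qed.

Lemma pure_linr a : linear (pure a).
Proof.
move=> c x y; apply: tensorP => U f bf /=.
by rewrite sweedler_linear // !sweedler_pure // bf.2.
Qed.

Lemma sweedler_id (t : tensor) : sweedler t pure = t.
Proof.
suff -> : sweedler t pure = \pi_tensor (repr t) by rewrite reprK.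
rewrite /sweedler; elim: (repr t) => [|[a b] s IH]; first by rewrite big_nil.
rewrite big_cons IH /=; apply: tensorP => V g bg.
by rewrite sweedler_add // sweedler_pure // !sweedler_pi // /tens_eval big_cons.
Qed.

Lemma tensor_ext (U : lmodType k) (f g : tensor -> U) :
  linear f -> linear g -> (forall a b, f (pure a b) = g (pure a b)) -> f =1 g.
Proof.
move=> lf lg H t; rewrite -(sweedler_id t) /sweedler.
have lin0 (h : tensor -> U) : linear h -> h 0 = 0.
  by move=> lh; have := lh (-1) 0 0; rewrite !scaleN1r !addNr.
elim: (repr t) => [|p s IH]; first by rewrite !big_nil !lin0.
by rewrite !big_cons -[pure _ _]scale1r lf lg H IH.
Qed.

End Tensor.

Notation "A \otimes B" := (tensor A B).
Notation "a \ox b" := (pure a b) : ring_scope.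
Notation "\sw_ ( a , b <- t ) F" := (sweedler t (fun a b => F)) : ring_scope.

(* Sums of scalars are taken in k^o, the field seen as a space over itself. *)

(* t is a sum of pure tensors a (x) b with P a b. *)
Definition in_span (k : fieldType) (A B : lmodType k) (P : A -> B -> Prop)
    (t : A \otimes B) : Prop :=
  exists2 s : seq (A * B),
    t = \sum_(p <- s) p.1 \ox p.2 & (forall p, p \in s -> P p.1 p.2).

Section Multilinearity.
Variable k : fieldType.
Implicit Types U V W X Y : lmodType k.

Lemma lin_id V : linear (fun x : V => x).
Proof. by []. Qed.

Lemma lin_comp V W X (g : W -> X) (f : V -> W) :
  linear g -> linear f -> linear (fun x => g (f x)).
Proof. by move=> lg lf c x y; rewrite lf lg. Qed.

Lemma lin_linear V W (g : {linear V -> W}) : linear g.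
Proof. exact: linearP. Qed.

Lemma lin_sweedlerl V W X U (g : V -> W \otimes X) (F : W -> X -> U) :
  linear g -> (forall b, linear (F^~ b)) -> (forall a, linear (F a)) ->
  linear (fun x => sweedler (g x) F).
Proof. by move=> lg l1 l2 c x y; rewrite lg sweedler_linear. Qed.

Lemma lin_sweedlerr V W X U (t : W \otimes X) (F : V -> W -> X -> U) :
  (forall a b, linear (fun v => F v a b)) -> linear (fun v => sweedler t (F v)).
Proof.
move=> lF c x y; rewrite /sweedler scaler_sumr -big_split /=.
by apply: eq_bigr => p _; rewrite lF.
Qed.

Lemma lin_purel V W X (f : V -> W) (b : X) :
  linear f -> linear (fun x => f x \ox b).
Proof. by move=> lf c x y; rewrite lf pure_linl. Qed.

Lemma lin_purer V W X (f : V -> X) (a : W) :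
  linear f -> linear (fun x => a \ox f x).
Proof. by move=> lf c x y; rewrite lf pure_linr. Qed.

Lemma lin_scalel V W (f : V -> k) (w : W) :
  linear (f : V -> k^o) -> linear (fun x => f x *: w).
Proof. by move=> lf c x y; rewrite lf scalerDl scalerA. Qed.

Lemma lin_scaler V W (f : V -> W) (c : k) :
  linear f -> linear (fun x => c *: f x).
Proof.
by move=> lf d x y; rewrite lf scalerDr !scalerA [c * d]mulrC.
Qed.

Lemma lin_mull V (A : algType k) (f : V -> A) (b : A) :
  linear f -> linear (fun x => f x * b).
Proof. by move=> lf c x y; rewrite lf mulrDl scalerAl. Qed.

Lemma lin_mulr V (A : algType k) (f : V -> A) (b : A) :
  linear f -> linear (fun x => b * f x).
Proof. by move=> lf c x y; rewrite lf mulrDr scalerAr. Qed.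

Lemma lin_mulkl V (f : V -> k) (b : k) :
  linear (f : V -> k^o) -> linear ((fun x => f x * b) : V -> k^o).
Proof. by move=> lf c x y; rewrite lf mulrDl scalerAl. Qed.

Lemma lin_mulkr V (f : V -> k) (b : k) :
  linear (f : V -> k^o) -> linear ((fun x => b * f x) : V -> k^o).
Proof. by move=> lf c x y; rewrite lf mulrDr scalerAr. Qed.

Lemma lin_scalar V (g : {scalar V}) : linear (g : V -> k^o).
Proof. exact: linearP. Qed.

Lemma lin_bill V W X Y (m : {bilinear V -> W -> X}) (f : Y -> V) (b : W) :
  linear f -> linear (fun x => m (f x) b).
Proof. by move=> lf c x y; rewrite lf linearPl. Qed.

Lemma lin_bilr V W X Y (m : {bilinear V -> W -> X}) (f : Y -> W) (a : V) :
  linear f -> linear (fun x => m a (f x)).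
Proof. by move=> lf c x y; rewrite lf linearPr. Qed.

End Multilinearity.

(* Proves that an expression is linear in one variable. *)
Ltac multilin :=
  first
    [ exact: lin_id | exact: lin_linear | exact: lin_scalar
    | (apply: lin_sweedlerl; [multilin | move=> ?; multilin | move=> ?; multilin])
    | (apply: lin_sweedlerr => ? ?; multilin)
    | (apply: lin_purel; multilin) | (apply: lin_purer; multilin)
    | (apply: lin_mull; multilin) | (apply: lin_mulr; multilin)
    | (apply: lin_mulkl; multilin) | (apply: lin_mulkr; multilin)
    | (apply: lin_scalel; multilin) | (apply: lin_scaler; multilin)
    | (apply: lin_bill; multilin) | (apply: lin_bilr; multilin)
    | (apply: lin_comp; [exact: lin_linear | multilin])
    | (apply: lin_comp; [exact: lin_scalar | multilin]) ].

HB.mixin Record isCoalgebra (k : fieldType) C of GRing.Lmodule k C := {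
  comul : {linear C -> C \otimes C};
  counit : {scalar C};
  comulA : forall c : C,
    \sw_(c1, c2 <- comul c) \sw_(c11, c12 <- comul c1) (c11 \ox (c12 \ox c2))
    = \sw_(c1, c2 <- comul c) (c1 \ox comul c2);
  counitl : forall c : C, \sw_(c1, c2 <- comul c) (counit c1 *: c2) = c;
  counitr : forall c : C, \sw_(c1, c2 <- comul c) (counit c2 *: c1) = c
}.

#[short(type="coalgType")]
HB.structure Definition Coalgebra (k : fieldType) :=
  {C of isCoalgebra k C & GRing.Lmodule k C}.

(* Only the join of the two structures, with no compatibility condition: the
   one of a Hopf algebra and the one of a braided bialgebra differ. *)
#[short(type="algCoalgType")]
HB.structure Definition AlgCoalgebra (k : fieldType) :=
  {A of GRing.Algebra k A & Coalgebra k A}.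

HB.mixin Record isHopf (k : fieldType) H
    of AlgCoalgebra k H := {
  antipode : {linear H -> H};
  comulM : forall g h : H,
    comul (g * h) = \sw_(g1, g2 <- comul g) \sw_(h1, h2 <- comul h)
                      ((g1 * h1) \ox (g2 * h2));
  comul1 : comul (1 : H) = 1 \ox 1;
  counitM : forall g h : H, counit (g * h) = counit g * counit h;
  counit1 : counit (1 : H) = 1;
  antipodel : forall h : H,
    \sw_(h1, h2 <- comul h) (antipode h1 * h2) = (counit h)%:A;
  antipoder : forall h : H,
    \sw_(h1, h2 <- comul h) (h1 * antipode h2) = (counit h)%:A
}.

#[short(type="hopfAlgType")]
HB.structure Definition HopfAlgebra (k : fieldType) :=
  {H of isHopf k H & AlgCoalgebra k H}.

HB.mixin Record isYetterDrinfeld (k : fieldType) (H : hopfAlgType k) V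
    of GRing.Lmodule k V := {
  ydact : {bilinear H -> V -> V};
  ydcoact : {linear V -> H \otimes V};
  ydact1 : forall v : V, ydact 1 v = v;
  ydactM : forall (g h : H) (v : V), ydact (g * h) v = ydact g (ydact h v);
  ydcoactA : forall v : V,
    \sw_(h, u <- ydcoact v) \sw_(h1, h2 <- comul h) (h1 \ox (h2 \ox u))
    = \sw_(h, u <- ydcoact v) (h \ox ydcoact u);
  ydcoact1 : forall v : V, \sw_(h, u <- ydcoact v) (counit h *: u) = v;
  yd_compat : forall (h : H) (v : V),
    ydcoact (ydact h v) =
      \sw_(h1, hr <- comul h) \sw_(h2, h3 <- comul hr)
      \sw_(g, u <- ydcoact v) ((h1 * g * antipode h3) \ox ydact h2 u)
}.

#[short(type="ydModType")]
HB.structure Definition YetterDrinfeld (k : fieldType) (H : hopfAlgType k) :=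
  {V of isYetterDrinfeld k H V & GRing.Lmodule k V}.

(* Algebra and coalgebra in the braided category of Yetter-Drinfeld modules:
   the structure maps are morphisms, and the comultiplication is
   multiplicative for the product of R (x) R twisted by the braiding. *)
HB.mixin Record isBraidedBialgebra (k : fieldType) (H : hopfAlgType k) R
    of AlgCoalgebra k R & YetterDrinfeld k H R := {
  ydactMr : forall (h : H) (a b : R),
    ydact h (a * b) = \sw_(h1, h2 <- comul h) (ydact h1 a * ydact h2 b);
  ydact_one : forall h : H, ydact h (1 : R) = (counit h)%:A;
  ydcoactM : forall a b : R,
    ydcoact (a * b) =
      \sw_(g, a0 <- ydcoact a) \sw_(h, b0 <- ydcoact b)
        ((g * h : H) \ox (a0 * b0));
  ydcoact_one : ydcoact (1 : R) = (1 : H) \ox 1;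
  comul_ydact : forall (h : H) (a : R),
    comul (ydact h a) =
      \sw_(h1, h2 <- comul h) \sw_(a1, a2 <- comul a)
        (ydact h1 a1 \ox ydact h2 a2);
  counit_ydact : forall (h : H) (a : R),
    counit (ydact h a) = counit h * counit a;
  comul_ydcoact : forall a : R,
    \sw_(g, a0 <- ydcoact a) ((g : H) \ox comul a0) =
      \sw_(a1, a2 <- comul a) \sw_(g, b1 <- ydcoact a1)
      \sw_(h, b2 <- ydcoact a2) ((g * h : H) \ox (b1 \ox b2));
  counit_ydcoact : forall a : R,
    \sw_(g, a0 <- ydcoact a) (counit a0 *: (g : H)) = (counit a)%:A;
  braided_comulM : forall a b : R,
    comul (a * b) =
      \sw_(a1, a2 <- comul a) \sw_(b1, b2 <- comul b)
      \sw_(g, c <- ydcoact a2) ((a1 * ydact (g : H) b1) \ox (c * b2));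
  braided_comul1 : comul (1 : R) = 1 \ox 1;
  braided_counitM : forall a b : R, counit (a * b) = counit a * counit b;
  braided_counit1 : counit (1 : R) = 1
}.

#[short(type="braidedBialgType")]
HB.structure Definition BraidedBialgebra (k : fieldType) (H : hopfAlgType k) :=
  {R of isBraidedBialgebra k H R & AlgCoalgebra k R & YetterDrinfeld k H R}.

Record is_pre_nichols (k : fieldType) (H : hopfAlgType k) (V : ydModType H)
    (R : braidedBialgType H) (gr : nat -> {pred R}) (iota : {linear V -> R})
    : Prop := IsPreNichols {
  gr_submod : forall n, submod_closed (gr n);
  gr_ydact : forall n (h : H) (r : R), r \in gr n -> ydact h r \in gr n;
  gr_ydcoact : forall n (r : R), r \in gr n ->
    in_span (fun (h : H) s => s \in gr n) (ydcoact r);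
  gr_total : forall r : R, exists n (f : nat -> R),
    (forall i, f i \in gr i) /\ r = \sum_(i < n) f i;
  gr_direct : forall n (f : nat -> R), (forall i, f i \in gr i) ->
    \sum_(i < n) f i = 0 -> forall i, (i < n)%N -> f i = 0;
  gr_mul : forall m n (r s : R),
    r \in gr m -> s \in gr n -> r * s \in gr (m + n)%N;
  gr_comul : forall n (r : R), r \in gr n ->
    in_span (fun a b => exists i j, [/\ (i + j = n)%N, a \in gr i & b \in gr j])
      (comul r);
  gr_counit : forall n (r : R), (0 < n)%N -> r \in gr n -> counit r = 0;
  gr_zero : forall r : R, r \in gr 0%N <-> exists c : k, r = c%:A;
  gr_one : forall r : R, r \in gr 1%N <-> exists v : V, r = iota v;
  iota_inj : injective iota;
  iota_ydact : forall (h : H) (v : V), iota (ydact h v) = ydact h (iota v);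
  iota_ydcoact : forall v : V,
    ydcoact (iota v) = \sw_(h, u <- ydcoact v) ((h : H) \ox iota u);
  gr_gen : forall P : {pred R}, subalg_closed P ->
    {subset gr 1%N <= P} -> forall r, r \in P
}.

Record preNichols (k : fieldType) (H : hopfAlgType k) (V : ydModType H) :=
  PreNichols {
    pn_alg :> braidedBialgType H;
    pn_gr : nat -> {pred pn_alg};
    pn_in : {linear V -> pn_alg};
    pn_spec : is_pre_nichols pn_gr pn_in
  }.

(* The structure maps of a bialgebra on a given space, without the axioms:
   skew pairings, cocycles and deformed products only involve these maps. *)
Record bialgOps (k : fieldType) (A : lmodType k) := BialgOps {
  op_mul : {bilinear A -> A -> A};
  op_one : A;
  op_comul : {linear A -> A \otimes A};
  op_counit : {scalar A}
}.

Section HopfOps.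
Variables (k : fieldType) (H : hopfAlgType k).

Definition hopf_mul (a b : H) : H := a * b.

Lemma hopf_mul_bilin : bilinear_for *:%R *:%R hopf_mul.
Proof. by split=> ?; rewrite /hopf_mul; multilin. Qed.
HB.instance Definition _ :=
  bilinear_isBilinear.Build k H H H *:%R *:%R hopf_mul hopf_mul_bilin.

Definition hopf_ops : bialgOps H := BialgOps hopf_mul 1 comul counit.
End HopfOps.

Section Bosonization.
Variables (k : fieldType) (H : hopfAlgType k) (R : braidedBialgType H).
Local Notation RH := (R \otimes H).

Definition boson_mul (s t : RH) : RH :=
  \sw_(a, h <- s) \sw_(b, l <- t) \sw_(h1, h2 <- comul h)
    ((a * ydact h1 b) \ox (h2 * l)).

Definition boson_comul (t : RH) : RH \otimes RH :=
  \sw_(a, h <- t) \sw_(a1, a2 <- comul a) \sw_(h1, h2 <- comul h)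
  \sw_(g, c <- ydcoact a2) ((a1 \ox (g * h1 : H)) \ox (c \ox h2)).

Definition boson_counit (t : RH) : k :=
  \sw_(a, h <- t) (counit a * counit h : k^o).

Lemma boson_mul_bilin : bilinear_for *:%R *:%R boson_mul.
Proof. by split=> ?; rewrite /boson_mul; multilin. Qed.
HB.instance Definition _ :=
  bilinear_isBilinear.Build k RH RH RH *:%R *:%R boson_mul boson_mul_bilin.

Lemma boson_comul_linear : linear boson_comul.
Proof. by rewrite /boson_comul; multilin. Qed.
HB.instance Definition _ :=
  GRing.isLinear.Build k RH (RH \otimes RH) *:%R boson_comul boson_comul_linear.

Lemma boson_counit_linear : linear (boson_counit : _ -> k^o).
Proof. by rewrite /boson_counit; multilin. Qed.
HB.instance Definition _ :=
  GRing.isLinear.Build k RH k *%R boson_counit boson_counit_linear.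

Definition boson : bialgOps RH :=
  BialgOps boson_mul (1 \ox 1) boson_comul boson_counit.
End Bosonization.

Section TensorOps.
Variables (k : fieldType) (A B : lmodType k).
Variables (oA : bialgOps A) (oB : bialgOps B).
Local Notation AB := (A \otimes B).

Definition tens_mul (s t : AB) : AB :=
  \sw_(a, x <- s) \sw_(b, y <- t) (op_mul oA a b \ox op_mul oB x y).

Definition tens_comul (t : AB) : AB \otimes AB :=
  \sw_(a, x <- t) \sw_(a1, a2 <- op_comul oA a) \sw_(x1, x2 <- op_comul oB x)
    ((a1 \ox x1) \ox (a2 \ox x2)).

Definition tens_counit (t : AB) : k :=
  \sw_(a, x <- t) (op_counit oA a * op_counit oB x : k^o).

Lemma tens_mul_bilin : bilinear_for *:%R *:%R tens_mul.
Proof. by split=> ?; rewrite /tens_mul; multilin. Qed.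
HB.instance Definition _ :=
  bilinear_isBilinear.Build k AB AB AB *:%R *:%R tens_mul tens_mul_bilin.

Lemma tens_comul_linear : linear tens_comul.
Proof. by rewrite /tens_comul; multilin. Qed.
HB.instance Definition _ :=
  GRing.isLinear.Build k AB (AB \otimes AB) *:%R tens_comul tens_comul_linear.

Lemma tens_counit_linear : linear (tens_counit : _ -> k^o).
Proof. by rewrite /tens_counit; multilin. Qed.
HB.instance Definition _ :=
  GRing.isLinear.Build k AB k *%R tens_counit tens_counit_linear.

Definition tens_ops : bialgOps AB :=
  BialgOps tens_mul (op_one oA \ox op_one oB) tens_comul tens_counit.

Record skew_pairing (tau : {scalar AB}) : Prop := SkewPairing {
  skew_mull : forall a b x, tau (op_mul oA a b \ox x) =
    \sw_(x1, x2 <- op_comul oB x) (tau (a \ox x1) * tau (b \ox x2) : k^o);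
  skew_mulr : forall a x y, tau (a \ox op_mul oB x y) =
    \sw_(a1, a2 <- op_comul oA a) (tau (a1 \ox y) * tau (a2 \ox x) : k^o);
  skew_onel : forall x, tau (op_one oA \ox x) = op_counit oB x;
  skew_oner : forall a, tau (a \ox op_one oB) = op_counit oA a
}.

Variable tau : {scalar AB}.

Definition skew_cocycle_fun (t : AB \otimes AB) : k :=
  \sw_(g, h <- t) \sw_(a, x <- g) \sw_(b, y <- h)
    (op_counit oA a * tau (b \ox x) * op_counit oB y : k^o).

Lemma skew_cocycle_linear : linear (skew_cocycle_fun : _ -> k^o).
Proof. by rewrite /skew_cocycle_fun; multilin. Qed.
HB.instance Definition _ :=
  GRing.isLinear.Build k (AB \otimes AB) k *%R skew_cocycle_fun
    skew_cocycle_linear.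

Definition skew_cocycle : {scalar AB \otimes AB} := skew_cocycle_fun.
End TensorOps.

Section Cocycles.
Variables (k : fieldType) (L : lmodType k) (o : bialgOps L).
Local Notation "g ** h" := (op_mul o g h) (at level 40, left associativity).
Local Notation Delta := (op_comul o).
Local Notation eps := (op_counit o).

Definition conv_inverse (s s' : {scalar L \otimes L}) : Prop :=
  forall g h : L,
    \sw_(g1, g2 <- Delta g) \sw_(h1, h2 <- Delta h)
      (s (g1 \ox h1) * s' (g2 \ox h2) : k^o) = eps g * eps h /\
    \sw_(g1, g2 <- Delta g) \sw_(h1, h2 <- Delta h)
      (s' (g1 \ox h1) * s (g2 \ox h2) : k^o) = eps g * eps h.

Record two_cocycle (s : {scalar L \otimes L}) : Prop := TwoCocycle {
  cocycle_inv : exists s', conv_inverse s s';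
  cocycle_eq : forall g h l : L,
    \sw_(g1, g2 <- Delta g) \sw_(h1, h2 <- Delta h)
      (s (g1 \ox h1) * s ((g2 ** h2) \ox l) : k^o) =
    \sw_(h1, h2 <- Delta h) \sw_(l1, l2 <- Delta l)
      (s (h1 \ox l1) * s (g \ox (h2 ** l2)) : k^o);
  cocycle_oner : forall h, s (h \ox op_one o) = eps h;
  cocycle_onel : forall h, s (op_one o \ox h) = eps h
}.

(* s' stands for the convolution inverse of s. *)
Definition deformed_mul (s s' : {scalar L \otimes L}) (g h : L) : L :=
  \sw_(g1, gr <- Delta g) \sw_(g2, g3 <- Delta gr)
  \sw_(h1, hr <- Delta h) \sw_(h2, h3 <- Delta hr)
    ((s (g1 \ox h1) * s' (g3 \ox h3)) *: (g2 ** h2)).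
End Cocycles.

Section Embeddings.
Variables (k : fieldType) (H : hopfAlgType k) (V : ydModType H).
Variable R : preNichols V.

Definition in_hopf (a : H) : R \otimes H := 1 \ox a.
Definition in_mod (v : V) : R \otimes H := pn_in R v \ox 1.
End Embeddings.

Section Extension.
Variables (k : fieldType) (J K : hopfAlgType k).
Variables (V : ydModType J) (W : ydModType K).
Variables (R : preNichols V) (S : preNichols W).
Variables (tau : {scalar J \otimes K}) (lambda : {scalar W \otimes V}).

Record skew_extension (T : {scalar (R \otimes J) \otimes (S \otimes K)})
    : Prop := SkewExtension {
  ext_skew : skew_pairing (boson R) (boson S) T;
  ext_tau : forall a x, T (in_hopf R a \ox in_hopf S x) = tau (a \ox x);
  ext_hopf_mod : forall a w, T (in_hopf R a \ox in_mod S w) = 0;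
  ext_mod_hopf : forall v x, T (in_mod R v \ox in_hopf S x) = 0;
  ext_mod_mod : forall v w, T (in_mod R v \ox in_mod S w) = - lambda (w \ox v)
}.
End Extension.

(* Main.v *)
Require Import Defs.
From HB Require Import structures.
From mathcomp Require Import all_boot all_order all_algebra ring.
From mathcomp Require Import boolp.

(** Write A = R # J and B = S # K. The subspaces C = J + V of A and D = K + W
    of B are subcoalgebras which generate A and B, and tau, - lambda and zero
    give a pairing p of C and D. For d in D the functional p (-, d) extends to
    phi_d on A with phi_d (a b) = phi_d1 (a) phi_d2 (b), through the projection
    of R onto its part of degree one; likewise p (c, -) extends to psi_c on B
    with psi_c (x y) = psi_c1 (y) psi_c2 (x). The value of the pairing at
    c_1 ... c_m and d_1 ... d_n can be computed either from the coproduct of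
    c_1 ... c_m in A and the phi's, or from the coproduct of d_1 ... d_n in B
    and the psi's. The first expression depends only on the element of A, the
    second only on the element of B, and they agree on words; hence the pairing
    descends to A and B, and each expression gives one half of the axioms of a
    skew pairing.

    The same argument for the opposite algebras, starting from tau (S -, -) and
    tau (S v_{-1}, w_{-1}) lambda (w_0, v_0), yields the convolution inverse T'
    of the extension T, without constructing the antipode of A. Finally the
    deformed product of 1 (x) b and a (x) 1 is
    T (a_1, b_1) a_2 (x) b_2 T' (a_3, b_3), which is evaluated on generators. *)

Set Implicit Arguments.
Unset Strict Implicit.
Unset Printing Implicit Defensive.

Import GRing.Theory.
Local Open Scope ring_scope.

(** * Sweedler sums *)

Section Lin.
Variable k : fieldType.
Implicit Types U V W X Y : lmodType k.

Lemma lin0 V W (f : V -> W) : linear f -> f 0 = 0.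
Proof. by move=> lf; have := lf (-1) 0 0; rewrite !scaleN1r !addNr. Qed.

Lemma linD V W (f : V -> W) : linear f -> {morph f : x y / x + y}.
Proof. by move=> lf x y; rewrite -[x]scale1r lf !scale1r. Qed.

Lemma linZ V W (f : V -> W) : linear f -> forall c, {morph f : x / c *: x}.
Proof. by move=> lf c x; rewrite -[c *: x]addr0 lf (lin0 lf) addr0. Qed.

Lemma lin_sum V W (f : V -> W) : linear f -> forall (I : Type) (r : seq I) (F : I -> V),
  f (\sum_(i <- r) F i) = \sum_(i <- r) f (F i).
Proof.
move=> lf I r F; elim: r => [|i r IH]; first by rewrite !big_nil lin0.
by rewrite !big_cons (linD lf) IH.
Qed.

Lemma lin_add V W (f g : V -> W) : linear f -> linear g -> linear (fun x => f x + g x).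
Proof. by move=> lf lg c x y; rewrite lf lg scalerDr addrACA. Qed.

Lemma lin_opp V W (f : V -> W) : linear f -> linear (fun x => - f x).
Proof. by move=> lf c x y; rewrite lf opprD scalerN. Qed.

Lemma lin_bigsum V W (I : Type) (r : seq I) (f : I -> V -> W) :
  (forall i, linear (f i)) -> linear (fun x => \sum_(i <- r) f i x).
Proof.
move=> lf c x y; rewrite scaler_sumr -big_split /=.
by apply: eq_bigr => i _; rewrite lf.
Qed.
End Lin.

Section Sw.
Variable k : fieldType.
Variables (A B U : lmodType k).
Implicit Types (t : A \otimes B) (F G : A -> B -> U).

Lemma eq_sw t F G : (forall a b, F a b = G a b) -> sweedler t F = sweedler t G.
Proof. by move=> FG; apply: eq_bigr => p _. Qed.

Lemma sw_lin (W : lmodType k) (g : U -> W) t F : linear g ->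
  g (sweedler t F) = sweedler t (fun a b => g (F a b)).
Proof. by move=> lg; rewrite /sweedler (lin_sum lg). Qed.

Lemma sw_exch (C D : lmodType k) t (s : C \otimes D) (F : A -> B -> C -> D -> U) :
  sweedler t (fun a b => sweedler s (F a b)) =
  sweedler s (fun c d => sweedler t (fun a b => F a b c d)).
Proof. exact: exchange_big. Qed.

Lemma sw_exch2 (C D E G : lmodType k) (s : C \otimes D) (r : C -> D -> E \otimes G) t
    (F : C -> D -> E -> G -> A -> B -> U) :
  sweedler s (fun c d => sweedler (r c d) (fun e g => sweedler t (F c d e g))) =
  sweedler t (fun a b => sweedler s (fun c d => sweedler (r c d) (fun e g => F c d e g a b))).
Proof.
rewrite /sweedler; under eq_bigr => p _ do rewrite exchange_big.
by rewrite exchange_big.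
Qed.

Lemma sw_sw (C D : lmodType k) (s : C \otimes D) (G : C -> D -> A \otimes B) F :
  bilin F ->
  sweedler (sweedler s G) F = sweedler s (fun c d => sweedler (G c d) F).
Proof. by move=> bF; rewrite [sweedler s G]/sweedler (lin_sum (sweedler_linear bF)). Qed.

Lemma sw_add t t' F : bilin F -> sweedler (t + t') F = sweedler t F + sweedler t' F.
Proof. by move=> bF; rewrite (linD (sweedler_linear bF)). Qed.

Lemma sw_bigsum (I : Type) (r : seq I) (h : I -> A \otimes B) F : bilin F ->
   sweedler (\sum_(i <- r) h i) F = \sum_(i <- r) sweedler (h i) F.
Proof. by move=> bF; rewrite (lin_sum (sweedler_linear bF)). Qed.

Lemma sw_split t F G :
  sweedler t (fun a b => F a b + G a b) = sweedler t F + sweedler t G.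
Proof. exact: big_split. Qed.

Lemma sw_scaler c t F :
  sweedler t (fun a b => c *: F a b) = c *: sweedler t F.
Proof. by rewrite /sweedler scaler_sumr. Qed.

Lemma sw_0 t : sweedler t (fun _ _ => 0 : U) = 0.
Proof. exact: big1. Qed.
End Sw.

Section Swk.
Variables (k : fieldType) (A B : lmodType k).
Implicit Types (t : A \otimes B) (F G : A -> B -> k^o).

(* [eq_sw] at type [k]: unification does not find the module structure of
   [k^o] there. *)
Lemma eq_swk t F G : (forall a b, F a b = G a b :> k) -> sweedler t F = sweedler t G :> k.
Proof. by move=> FG; rewrite (eq_sw (G := G) t FG). Qed.

Lemma sw_mull t F c : sweedler t F * c = sweedler t (fun a b => F a b * c : k^o).
Proof. exact: mulr_suml. Qed.

Lemma sw_mulr t F c : c * sweedler t F = sweedler t (fun a b => c * F a b : k^o).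
Proof. exact: mulr_sumr. Qed.

Lemma sw_purel (U W : lmodType k) t (F : A -> B -> U) (w : W) :
  (sweedler t F) \ox w = sweedler t (fun a b => F a b \ox w).
Proof. by rewrite (sw_lin (g := fun u => u \ox w)) //; apply: pure_linl. Qed.

Lemma sw_purer (U W : lmodType k) t (F : A -> B -> U) (w : W) :
  w \ox (sweedler t F) = sweedler t (fun a b => w \ox F a b).
Proof. by rewrite sw_lin //; apply: pure_linr. Qed.
End Swk.

(* Much faster than [multilin]: the head of the expression selects the lemma. *)
Ltac mlin :=
  lazymatch goal with
  | |- GRing.linear_for _ (fun x => x) => exact: lin_id
  | |- GRing.linear_for _ (fun x => sweedler _ _) =>
      first [apply: lin_sweedlerr => ? ?; mlin
        | apply: lin_sweedlerl; [mlin | move=> ?; mlin | move=> ?; mlin]]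
  | |- GRing.linear_for _ (fun x => pure _ _) =>
      first [apply: lin_purel; mlin | apply: lin_purer; mlin]
  | |- GRing.linear_for _ (pure ?a) => apply: pure_linr
  | |- GRing.linear_for _ (fun x => GRing.mul _ _) =>
      first [apply: lin_mull; mlin | apply: lin_mulr; mlin | apply: lin_mulkl; mlin | apply:
        lin_mulkr; mlin]
  | |- GRing.linear_for _ (fun x => GRing.scale _ _) =>
      first [apply: lin_scaler; mlin | apply: lin_scalel; mlin]
  | |- GRing.linear_for _ (GRing.mul ?a) => first [exact: (lin_mulr a (@lin_id _ _)) | exact:
    (lin_mulkr a (@lin_id _ _))]
  | |- GRing.linear_for _ (GRing.scale ?a) => exact: (lin_scaler a (@lin_id _ _))
  | |- GRing.linear_for _ (Bilinear.sort ?m ?a) => exact: (lin_bilr m a (@lin_id _ _))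
  | |- GRing.linear_for _ (fun x => GRing.add _ _) => apply: lin_add; mlin
  | |- GRing.linear_for _ (fun x => GRing.opp _) => apply: lin_opp; mlin
  | |- GRing.linear_for _ (fun x => Bilinear.sort _ _ _) =>
      first [apply: lin_bill; mlin | apply: lin_bilr; mlin]
  | |- GRing.linear_for _ (fun x => GRing.Linear.sort _ _) =>
      first [apply: (lin_comp (lin_linear _)); mlin | apply: (lin_comp (lin_scalar _)); mlin]
  | |- _ => first [assumption | exact: lin_id | exact: lin_linear | exact: lin_scalar
       | match goal with H : _ |- _ => apply: (lin_comp (H _)); mlin end
       | match goal with H : _ |- _ => apply: (lin_comp (H _ _)); mlin end
       | match goal with H : _ |- _ => exact: H end ]
  end.

Ltac bil := split=> ?; cbv beta; mlin.
Tactic Notation "sweq" ident(a) ident(b) := (first [apply: eq_swk | apply: eq_sw]) => a b.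
Ltac swp := rewrite sweedler_pure; last bil.

Section CoalgF.
Variables (k : fieldType) (C : lmodType k) (Dl : {linear C -> C \otimes C}).
Hypothesis DlA : forall c : C,
    \sw_(c1, c2 <- Dl c) \sw_(c11, c12 <- Dl c1) (c11 \ox (c12 \ox c2))
    = \sw_(c1, c2 <- Dl c) (c1 \ox Dl c2).

Lemma sw_coA (U : lmodType k) (F : C -> C -> C -> U) c :
  (forall y z, linear (fun x => F x y z)) -> (forall x z, linear (fun y => F x y z)) ->
  (forall x y, linear (F x y)) ->
  \sw_(x, y <- Dl c) \sw_(x1, x2 <- Dl x) F x1 x2 y =
  \sw_(x, y <- Dl c) \sw_(y1, y2 <- Dl y) F x y1 y2.
Proof.
move=> F1 F2 F3.
have bF x : bilin (F x) by split.
have := congr1 (fun t => \sw_(x, yz <- t) \sw_(y, z <- yz) F x y z) (DlA c).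
have b2 : bilin (fun x yz => \sw_(y, z <- yz) F x y z).
  split=> [b|x]; first by apply: lin_sweedlerr => ? ?.
  exact: sweedler_linear.
rewrite /= !sw_sw //.
under eq_sw => a b do rewrite sw_sw //.
under eq_sw => a b do (under eq_sw => a' b' do rewrite sweedler_pure // sweedler_pure //).
by under [RHS]eq_sw => a b do rewrite sweedler_pure //.
Qed.
End CoalgF.

Lemma ex_scalar (k : fieldType) (V : lmodType k) (f : V -> k^o) : linear f ->
  exists T : {scalar V}, T =1 f.
Proof.
move=> lf.
pose T : {scalar V} := HB.pack f (GRing.isLinear.Build k V k *%R f lf).
by exists T.
Qed.

Lemma ex_linear (k : fieldType) (V W : lmodType k) (f : V -> W) : linear f ->
  exists T : {linear V -> W}, T =1 f.
Proof.
move=> lf.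
pose T : {linear V -> W} := HB.pack f (GRing.isLinear.Build k V W *:%R f lf).
by exists T.
Qed.

Lemma ex_pairing (k : fieldType) (A B : lmodType k) (f : A -> B -> k^o) : bilin f ->
  exists T : {scalar A \otimes B}, forall a b, T (a \ox b) = f a b.
Proof.
move=> bf; have [T TE] := ex_scalar (sweedler_linear bf).
by exists T => a b; rewrite TE sweedler_pure.
Qed.

(** * Bialgebras, and words in generators *)

Record is_bialgebra (k : fieldType) (A : lmodType k) (o : bialgOps A) : Prop := IsBialgebra {
  ops_mulA : associative (op_mul o);
  ops_mul1l : left_id (op_one o) (op_mul o);
  ops_mul1r : right_id (op_one o) (op_mul o);
  ops_comulA : forall c : A,
    \sw_(c1, c2 <- op_comul o c) \sw_(c11, c12 <- op_comul o c1) (c11 \ox (c12 \ox c2))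
    = \sw_(c1, c2 <- op_comul o c) (c1 \ox op_comul o c2);
  ops_counitl : forall c, \sw_(c1, c2 <- op_comul o c) (op_counit o c1 *: c2) = c;
  ops_counitr : forall c, \sw_(c1, c2 <- op_comul o c) (op_counit o c2 *: c1) = c;
  ops_comulM : forall g h : A,
    op_comul o (op_mul o g h) = \sw_(g1, g2 <- op_comul o g) \sw_(h1, h2 <- op_comul o h)
                      ((op_mul o g1 h1) \ox (op_mul o g2 h2));
  ops_comul1 : op_comul o (op_one o) = op_one o \ox op_one o;
  ops_counitM : forall g h, op_counit o (op_mul o g h) = op_counit o g * op_counit o h;
  ops_counit1 : op_counit o (op_one o) = 1 }.

Section BialgTheory.
Variables (k : fieldType) (A : lmodType k) (o : bialgOps A).
Hypothesis bo : is_bialgebra o.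
Local Notation "g ** h" := (op_mul o g h) (at level 40, left associativity).
Local Notation D := (op_comul o).
Local Notation e := (op_counit o).

Lemma sw_opA (U : lmodType k) (F : A -> A -> A -> U) c :
  (forall y z, linear (fun x => F x y z)) -> (forall x z, linear (fun y => F x y z)) ->
  (forall x y, linear (F x y)) ->
  \sw_(x, y <- D c) \sw_(x1, x2 <- D x) F x1 x2 y =
  \sw_(x, y <- D c) \sw_(y1, y2 <- D y) F x y1 y2.
Proof. exact/sw_coA/ops_comulA. Qed.

Lemma sw_opl (U : lmodType k) (F : A -> U) c : linear F ->
  \sw_(x, y <- D c) (e x *: F y) = F c.
Proof.
move=> lF; rewrite -[in RHS](ops_counitl bo c) (sw_lin _ _ lF).
by apply: eq_sw => a b; rewrite (linZ lF).
Qed.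

Lemma sw_opr (U : lmodType k) (F : A -> U) c : linear F ->
  \sw_(x, y <- D c) (e y *: F x) = F c.
Proof.
move=> lF; rewrite -[in RHS](ops_counitr bo c) (sw_lin _ _ lF).
by apply: eq_sw => a b; rewrite (linZ lF).
Qed.

Lemma sw_oplk (F : A -> k^o) c : linear F ->
  \sw_(x, y <- D c) (e x * F y : k^o) = F c.
Proof. exact: sw_opl. Qed.

Lemma sw_oprk (F : A -> k^o) c : linear F ->
  \sw_(x, y <- D c) (e y * F x : k^o) = F c.
Proof. exact: sw_opr. Qed.

Lemma sw_opM (U : lmodType k) (F : A -> A -> U) a b : bilin F ->
  \sw_(x, y <- D (a ** b)) F x y =
  \sw_(a1, a2 <- D a) \sw_(b1, b2 <- D b) F (a1 ** b1) (a2 ** b2).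
Proof.
move=> bF; rewrite (ops_comulM bo) sw_sw //; apply: eq_sw => a1 a2.
by rewrite sw_sw //; apply: eq_sw => b1 b2; rewrite sweedler_pure.
Qed.

End BialgTheory.

Section Words.
Variables (k : fieldType) (A : lmodType k) (o : bialgOps A).
Hypothesis bo : is_bialgebra o.
Variables (C : Type) (g : C -> A) (cop : C -> seq (C * C)).

Definition generates := forall P : A -> Prop, P 0 -> P (op_one o) ->
  (forall c, P (g c)) -> (forall a b, P a -> P b -> P (a + b)) ->
  (forall a b, P a -> P b -> P (op_mul o a b)) -> forall a, P a.

Definition word_val (u : seq C) : A := foldr (fun c a => op_mul o (g c) a) (op_one o) u.

Lemma word_val_cat u v : word_val (u ++ v) = op_mul o (word_val u) (word_val v).
Proof.
elim: u => [|c u IH] /=; first by rewrite (ops_mul1l bo).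
by rewrite IH (ops_mulA bo).
Qed.

Lemma word_span : generates -> forall a, exists s, a = \sum_(u <- s) word_val u.
Proof.
apply=> [||c|a b [s ->] [t ->]|a b [s ->] [t ->]].
- by exists [::]; rewrite big_nil.
- by exists [:: [::]]; rewrite big_seq1.
- by exists [:: [:: c]]; rewrite big_seq1 /= (ops_mul1r bo).
- by exists (s ++ t); rewrite big_cat.
- exists [seq u ++ v | u <- s, v <- t]; rewrite big_allpairs_dep linear_sumlz /=.
  apply: eq_bigr => u _; rewrite linear_sum /=.
  by apply: eq_bigr => v _; rewrite word_val_cat.
Qed.

Fixpoint word_cop (u : seq C) : seq (seq C * seq C) :=
  if u is c :: u' then [seq (p.1 :: q.1, p.2 :: q.2) | p <- cop c, q <- word_cop u']
  else [:: ([::], [::])].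

Definition is_cop := forall c, op_comul o (g c) = \sum_(p <- cop c) (g p.1 \ox g p.2).
Hypothesis copP : is_cop.

Lemma sw_gen (U : lmodType k) (F : A -> A -> U) c : bilin F ->
  sweedler (op_comul o (g c)) F = \sum_(p <- cop c) F (g p.1) (g p.2).
Proof.
by move=> bF; rewrite copP sw_bigsum //; apply: eq_bigr => p _; rewrite sweedler_pure.
Qed.

Lemma sw_word (U : lmodType k) (F : A -> A -> U) u : bilin F ->
  sweedler (op_comul o (word_val u)) F = \sum_(p <- word_cop u) F (word_val p.1) (word_val p.2).
Proof.
elim: u F => [|c u IH] F bF /=; first by rewrite (ops_comul1 bo) sweedler_pure // big_seq1.
rewrite (sw_opM bo) // big_allpairs_dep sw_gen; last first.
  by case: bF => ? ?; bil.
by apply: eq_bigr => p _; rewrite IH //; case: bF => ? ?; bil.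
Qed.
End Words.

(** * Extending a pairing from generating subcoalgebras *)

Section Extend.
Variables (k : fieldType) (A B : lmodType k) (oA : bialgOps A) (oB : bialgOps B).
Hypotheses (bA : is_bialgebra oA) (bB : is_bialgebra oB).
Variables (C D : Type) (gC : C -> A) (gD : D -> B).
Variables (cC : C -> seq (C * C)) (cD : D -> seq (D * D)).
Hypotheses (copC : is_cop oA gC cC) (copD : is_cop oB gD cD).
Hypotheses (genC : generates oA gC) (genD : generates oB gD).
Variables (phi : D -> {scalar A}) (psi : C -> {scalar B}).
Hypothesis phiM : forall d a b,
  phi d (op_mul oA a b) = \sum_(q <- cD d) phi q.1 a * phi q.2 b.
Hypothesis psiM : forall c x y,
  psi c (op_mul oB x y) = \sum_(p <- cC c) psi p.1 y * psi p.2 x.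
Hypothesis phi1 : forall d, phi d (op_one oA) = op_counit oB (gD d).
Hypothesis psi1 : forall c, psi c (op_one oB) = op_counit oA (gC c).
Hypothesis phi_psi : forall c d, phi d (gC c) = psi c (gD d).

Local Notation valC := (word_val oA gC).
Local Notation valD := (word_val oB gD).

Fixpoint pair_wordl (u : seq C) (b : B) : k^o :=
  if u is c :: u' then \sw_(b1, b2 <- op_comul oB b) (psi c b1 * pair_wordl u' b2 : k^o)
  else op_counit oB b.

Fixpoint pair_wordr (v : seq D) (a : A) : k^o :=
  if v is d :: v' then \sw_(a1, a2 <- op_comul oA a) (pair_wordr v' a1 * phi d a2 : k^o)
  else op_counit oA a.

Lemma pair_wordl_lin u : linear (pair_wordl u).
Proof. by elim: u => [|c u IH] /=; mlin. Qed.

Lemma pair_wordr_lin v : linear (pair_wordr v).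
Proof. by elim: v => [|d v IH] /=; mlin. Qed.

Lemma pair_wordl_one u : pair_wordl u (op_one oB) = op_counit oA (valC u).
Proof.
elim: u => [|c u IH] /=; first by rewrite (ops_counit1 bB) (ops_counit1 bA).
have lu := pair_wordl_lin u.
rewrite (ops_comul1 bB) sweedler_pure; last bil.
by rewrite IH psi1 (ops_counitM bA).
Qed.

Lemma pair_wordl_gen u d b : pair_wordl u (op_mul oB (gD d) b) =
  \sum_(p <- word_cop cC u) pair_wordl p.1 b * phi d (valC p.2).
Proof.
elim: u d b => [|c u IH] d b /=.
  by rewrite big_seq1 /= (ops_counitM bB) phi1 mulrC.
have lu := pair_wordl_lin.
rewrite (sw_opM bB); last bil.
rewrite (sw_gen copD); last bil.
rewrite big_allpairs_dep /= /sweedler.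
transitivity (\sum_(q <- cD d) \sum_(b12 <- repr (op_comul oB b)) \sum_(p <- cC c)
    \sum_(r <- word_cop cC u) (psi p.1 b12.1 * pair_wordl r.1 b12.2) *
      (phi q.1 (gC p.2) * phi q.2 (valC r.2)) : k^o).
  apply: eq_bigr => q _; apply: eq_bigr => b12 _.
  rewrite psiM IH big_distrlr /=; apply: eq_bigr => p _; apply: eq_bigr => r _.
  by rewrite phi_psi mulrACA.
rewrite exchange_big; under eq_bigr => b12 _ do rewrite exchange_big.
rewrite exchange_big; apply: eq_bigr => p _ /=.
under eq_bigr => b12 _ do rewrite exchange_big.
rewrite exchange_big; apply: eq_bigr => r _ /=.
by rewrite phiM big_distrlr.
Qed.

(* The left-hand side depends only on the value of [v] in [B], the right-hand
   side only on the value of [u] in [A]. *)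
Lemma pair_wordlr u v : pair_wordl u (valD v) = pair_wordr v (valC u).
Proof.
elim: v u => [|d v IH] u /=; first exact: pair_wordl_one.
have lv := pair_wordr_lin v.
rewrite pair_wordl_gen (sw_word bA copC); last bil.
by apply: eq_bigr => p _; rewrite IH.
Qed.

Lemma pair_wordl_cat u v b : pair_wordl (u ++ v) b =
  \sw_(b1, b2 <- op_comul oB b) (pair_wordl u b1 * pair_wordl v b2 : k^o).
Proof.
have lw := pair_wordl_lin.
elim: u b => [|c u IH] b /=; first by rewrite -[LHS](sw_opl bB) //; mlin.
under eq_sw => b1 b2 do rewrite IH sw_mulr.
under [RHS]eq_sw => b1 b2 do rewrite sw_mull.
rewrite (sw_opA bB); [|move=> ? ?; mlin..].
by apply: eq_sw => x y; apply: eq_sw => y1 y2; rewrite mulrA.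
Qed.

Lemma pair_wordr_cat u v a : pair_wordr (u ++ v) a =
  \sw_(a1, a2 <- op_comul oA a) (pair_wordr v a1 * pair_wordr u a2 : k^o).
Proof.
have lw := pair_wordr_lin.
elim: u a => [|d u IH] a /=.
  rewrite -[LHS](sw_opr bA) //; apply: eq_sw => x y; exact: mulrC.
under eq_sw => a1 a2 do rewrite IH sw_mull.
under [RHS]eq_sw => a1 a2 do rewrite sw_mulr.
rewrite (sw_opA bA); [|move=> ? ?; mlin..].
by apply: eq_sw => x y; apply: eq_sw => y1 y2; rewrite mulrA.
Qed.

Lemma extend_pairing : exists T : {scalar A \otimes B},
  [/\ skew_pairing oA oB T, forall c b, T (gC c \ox b) = psi c b &
      forall a d, T (a \ox gD d) = phi d a].
Proof.
have lwl := pair_wordl_lin; have lwr := pair_wordr_lin.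
have [wa waP] := choice (word_span bA genC).
have [wb wbP] := choice (word_span bB genD).
pose T0 a b : k^o := \sum_(u <- wa a) pair_wordl u b.
have T0r a b t : b = \sum_(v <- t) valD v -> T0 a b = \sum_(v <- t) pair_wordr v a.
  move=> ->; rewrite /T0 [in RHS](waP a).
  under eq_bigr => u _ do rewrite (lin_sum (lwl u)).
  under [RHS]eq_bigr => v _ do rewrite (lin_sum (lwr v)).
  rewrite exchange_big; apply: eq_bigr => v _; apply: eq_bigr => u _.
  exact: pair_wordlr.
have T0l a b s : a = \sum_(u <- s) valC u -> T0 a b = \sum_(u <- s) pair_wordl u b.
  move=> ->; rewrite (T0r _ _ _ (wbP b)) [in RHS](wbP b).
  under eq_bigr => v _ do rewrite (lin_sum (lwr v)).
  under [RHS]eq_bigr => u _ do rewrite (lin_sum (lwl u)).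
  rewrite exchange_big; apply: eq_bigr => u _; apply: eq_bigr => v _.
  exact/esym/pair_wordlr.
have lT0r a : linear (T0 a) by rewrite /T0; apply: lin_bigsum.
have lT0l b : linear (T0^~ b).
  move=> c x y; rewrite !(T0r _ _ _ (wbP b)).
  exact: (lin_bigsum _ lwr).
have [//|T TE] := ex_pairing (f := T0).
exists T; split=> [|c b|a d]; last first.
- rewrite TE (T0r _ _ [:: [:: d]]) big_seq1 /= ?(ops_mul1r bB) //.
  by apply: (sw_opl bA (F := (phi d : A -> k^o))); mlin.
- rewrite TE (T0l _ _ [:: [:: c]]) big_seq1 /= ?(ops_mul1r bA) //.
  under eq_sw => b1 b2 do rewrite mulrC.
  by apply: (sw_opr bB (F := (psi c : B -> k^o))); mlin.
split=> [a a' x|a x y|x|a].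
- rewrite TE (T0l _ _ [seq u ++ v | u <- wa a, v <- wa a']); last first.
    rewrite big_allpairs_dep [in LHS](waP a) [in LHS](waP a') linear_sumlz.
    apply: eq_bigr => u _; rewrite linear_sumr; apply: eq_bigr => v _ /=.
    by rewrite (word_val_cat bA).
  rewrite big_allpairs_dep /=; under [RHS]eq_sw => b1 b2 do rewrite !TE /T0 big_distrlr.
  rewrite [RHS]exchange_big; apply: eq_bigr => u _ /=.
  rewrite [RHS]exchange_big; apply: eq_bigr => v _ /=.
  exact: pair_wordl_cat.
- rewrite TE (T0r _ _ [seq u ++ v | u <- wb x, v <- wb y]); last first.
    rewrite big_allpairs_dep [in LHS](wbP x) [in LHS](wbP y) linear_sumlz.
    apply: eq_bigr => u _; rewrite linear_sumr; apply: eq_bigr => v _ /=.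
    by rewrite (word_val_cat bB).
  rewrite big_allpairs_dep /=.
  under [RHS]eq_sw => a1 a2 do
    rewrite !TE (T0r _ _ _ (wbP x)) (T0r _ _ _ (wbP y)) mulrC big_distrlr.
  rewrite [RHS]exchange_big; apply: eq_bigr => u _ /=.
  rewrite [RHS]exchange_big; apply: eq_bigr => v _ /=.
  by rewrite pair_wordr_cat; apply: eq_bigr => p _; rewrite mulrC.
- by rewrite TE (T0l _ _ [:: [::]]) big_seq1.
- by rewrite TE (T0r _ _ [:: [::]]) big_seq1.
Qed.
End Extend.

(** * Convolution inverses of skew pairings *)

Section Opposite.
Variables (k : fieldType) (A : lmodType k) (o : bialgOps A).

Definition opp_mul (a b : A) : A := op_mul o b a.
Lemma opp_mul_bilin : bilinear_for *:%R *:%R opp_mul.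
Proof. by split=> ?; rewrite /opp_mul; mlin. Qed.
HB.instance Definition _ :=
  bilinear_isBilinear.Build k A A A *:%R *:%R opp_mul opp_mul_bilin.

Definition opp_ops : bialgOps A :=
  BialgOps opp_mul (op_one o) (op_comul o) (op_counit o).

Lemma opp_bialgebra : is_bialgebra o -> is_bialgebra opp_ops.
Proof.
move=> bo; split; try by case: bo.
- by move=> a b c; rewrite /= /opp_mul (ops_mulA bo).
- by move=> g h; rewrite /= /opp_mul (ops_comulM bo) sw_exch.
- by move=> g h; rewrite /= /opp_mul (ops_counitM bo) mulrC.
Qed.

Lemma opp_generates (C : Type) (g : C -> A) : generates o g -> generates opp_ops g.
Proof. by move=> gen P P0 P1 Pg PD PM; apply: gen => // a b Pa Pb; apply: PM. Qed.
End Opposite.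

Lemma opp_opp_skew (k : fieldType) (A B : lmodType k) (oA : bialgOps A) (oB : bialgOps B)
  (T : {scalar A \otimes B}) :
  skew_pairing oA oB T -> skew_pairing (opp_ops (opp_ops oA)) (opp_ops (opp_ops oB)) T.
Proof. by case=> *; split. Qed.

Definition pair_conv (k : fieldType) (A B : lmodType k) (oA : bialgOps A) (oB : bialgOps B)
  (P Q : {scalar A \otimes B}) a b : k^o :=
  \sw_(a1, a2 <- op_comul oA a) \sw_(b1, b2 <- op_comul oB b)
    (P (a1 \ox b1) * Q (a2 \ox b2) : k^o).

Section PairConv.
Variables (k : fieldType) (A B : lmodType k) (oA : bialgOps A) (oB : bialgOps B).
Hypotheses (bA : is_bialgebra oA) (bB : is_bialgebra oB).
Variables (C D : Type) (gC : C -> A) (gD : D -> B).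
Variables (cC : C -> seq (C * C)).
Hypotheses (copC : is_cop oA gC cC).
Hypotheses (genC : generates oA gC) (genD : generates oB gD).

Lemma skew_0l (T : {scalar A \otimes B}) b : T (0 \ox b) = 0.
Proof. by rewrite (lin0 (pure_linl b)) linear0. Qed.

Lemma skew_0r (T : {scalar A \otimes B}) a : T (a \ox 0) = 0.
Proof. by rewrite (lin0 (pure_linr a)) linear0. Qed.

Lemma skew_Dl (T : {scalar A \otimes B}) a a' b : T ((a + a') \ox b) = T (a \ox b) + T (a' \ox b).
Proof. by rewrite (linD (pure_linl b)) linearD. Qed.

Lemma skew_Dr (T : {scalar A \otimes B}) a b b' : T (a \ox (b + b')) = T (a \ox b) + T (a \ox b').
Proof. by rewrite (linD (pure_linr a)) linearD. Qed.

Lemma skew_eq_gen (T T' : {scalar A \otimes B}) :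
  skew_pairing oA oB T -> skew_pairing oA oB T' ->
  (forall c d, T (gC c \ox gD d) = T' (gC c \ox gD d)) -> T =1 T'.
Proof.
move=> sT sT' TT'.
have gT c b : T (gC c \ox b) = T' (gC c \ox b).
  move: b c; apply: genD => [c|c|d c|b b' Hb Hb' c|b b' Hb Hb' c] //.
  - by rewrite !skew_0r.
  - by rewrite (skew_oner sT) (skew_oner sT').
  - by rewrite !skew_Dr Hb Hb'.
  - rewrite (skew_mulr sT) (skew_mulr sT') !(sw_gen copC); [|bil|bil].
    by apply: eq_bigr => p _; rewrite Hb Hb'.
have aT a b : T (a \ox b) = T' (a \ox b).
  move: a b; apply: genC => [b|b|c b|a a' Ha Ha' b|a a' Ha Ha' b] //.
  - by rewrite !skew_0l.
  - by rewrite (skew_onel sT) (skew_onel sT').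
  - by rewrite !skew_Dl Ha Ha'.
  - rewrite (skew_mull sT) (skew_mull sT').
    by sweq b1 b2; rewrite Ha Ha'.
by apply: (tensor_ext (U := k^o)) => //; mlin.
Qed.

Lemma pair_conv_linl P Q b : linear (fun a => pair_conv oA oB P Q a b).
Proof. by rewrite /pair_conv; mlin. Qed.

Lemma pair_conv_linr P Q a : linear (fun b => pair_conv oA oB P Q a b).
Proof. by rewrite /pair_conv; mlin. Qed.

Variables (T T' : {scalar A \otimes B}).
Hypotheses (sT : skew_pairing oA oB T) (sT' : skew_pairing (opp_ops oA) (opp_ops oB) T').
Local Notation conv := (pair_conv oA oB T T').
Local Notation eA := (op_counit oA).
Local Notation eB := (op_counit oB).

Lemma pair_conv_mull a c b :
  (forall b, conv a b = eA a * eB b) -> (forall b, conv c b = eA c * eB b) ->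
  conv (op_mul oA a c) b = eA (op_mul oA a c) * eB b.
Proof.
move=> Ha Hc; rewrite (ops_counitM bA) mulrAC -Ha /pair_conv (sw_opM bA); last bil.
rewrite sw_mull; apply: eq_sw => a1 a2.
have M' x y z : T' (op_mul oA x y \ox z) =
    \sw_(z1, z2 <- op_comul oB z) (T' (y \ox z1) * T' (x \ox z2) : k^o).
  exact: (skew_mull sT').
transitivity (\sw_(c1, c2 <- op_comul oA c) \sw_(x1, b' <- op_comul oB b)
   \sw_(z, y2 <- op_comul oB b') \sw_(x2, y1 <- op_comul oB z)
    (T (a1 \ox x1) * (T (c1 \ox x2) * T' (c2 \ox y1)) * T' (a2 \ox y2) : k^o)).
  apply: eq_sw => c1 c2.
  under eq_sw => b1 b2.
    rewrite (skew_mull sT) M' sw_mull.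
    under eq_sw => x1 x2 do rewrite sw_mulr.
  over.
  rewrite (sw_opA bB); [|move=> ? ?; mlin..].
  apply: eq_sw => x1 b'; rewrite -(sw_opA bB); [|move=> ? ?; mlin..].
  apply: eq_sw => z y2; apply: eq_sw => x2 y1.
  by rewrite !mulrA.
rewrite sw_exch sw_mull; apply: eq_sw => x1 b'.
rewrite sw_exch.
under eq_sw => z y2.
  rewrite (_ : sweedler _ _ = eB z *: (T (a1 \ox x1) * eA c * T' (a2 \ox y2)  : k^o)).
over.
  transitivity (T (a1 \ox x1) * conv c z * T' (a2 \ox y2) : k^o).
    rewrite /pair_conv sw_mulr sw_mull; apply: eq_sw => c1 c2.
    by rewrite sw_mulr sw_mull.
  by rewrite Hc -[X in _ = X]mulrCA !mulrA.
by rewrite (sw_opl bB (F := fun y => _ : k^o)) 1?mulrAC //; mlin.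
Qed.

Lemma pair_conv_gen_mulr b b' :
  (forall c, conv (gC c) b = eA (gC c) * eB b) ->
  (forall c, conv (gC c) b' = eA (gC c) * eB b') ->
  forall c, conv (gC c) (op_mul oB b b') = eA (gC c) * eB (op_mul oB b b').
Proof.
move=> Hb Hb' c; rewrite (ops_counitM bB) mulrCA -Hb' /pair_conv.
have M' x y z : T' (z \ox op_mul oB x y) =
    \sw_(z1, z2 <- op_comul oA z) (T' (z1 \ox x) * T' (z2 \ox y) : k^o).
  exact: (skew_mulr sT').
under eq_sw => c1 c2 do (rewrite (sw_opM bB); last bil).
rewrite sw_exch.
under eq_sw => b1 b2 do rewrite sw_exch.
rewrite sw_exch [in RHS]sw_exch sw_mulr; sweq b1' b2'.
transitivity (\sw_(x1, c' <- op_comul oA (gC c))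
   \sw_(z, y2 <- op_comul oA c')
    (T (x1 \ox b1') * conv z b * T' (y2 \ox b2') : k^o)).
  transitivity (\sw_(b1, b2 <- op_comul oB b) \sw_(x1, c' <- op_comul oA (gC c))
     \sw_(z, y2 <- op_comul oA c') \sw_(x2, y1 <- op_comul oA z)
      (T (x1 \ox b1') * (T (x2 \ox b1) * T' (y1 \ox b2)) * T' (y2 \ox b2') : k^o)).
    sweq b1 b2.
    under eq_sw => c1 c2.
      rewrite (skew_mulr sT) M' sw_mull.
      under eq_sw => x1 x2 do rewrite sw_mulr.
    over.
    rewrite (sw_opA bA); [|move=> ? ?; mlin..].
    sweq x1 c'; rewrite -(sw_opA bA); [|move=> ? ?; mlin..].
    sweq z y2; sweq x2 y1.
    by rewrite !mulrA.
  rewrite sw_exch; sweq x1 c'; rewrite sw_exch; sweq z y2.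
  rewrite sw_exch /pair_conv sw_mulr sw_mull; sweq c1 c2.
  by rewrite sw_mulr sw_mull.
rewrite (sw_gen copC); last by rewrite /pair_conv; bil.
under eq_bigr => p _.
  rewrite (sw_gen copC); last by rewrite /pair_conv; bil.
  under eq_bigr => q _ do rewrite Hb.
  rewrite -(sw_gen copC (F := fun z y2 => T (gC p.1 \ox b1') * (eA z * eB b) * T' (y2 \ox b2')
    : k^o)); last bil.
  over.
rewrite -(sw_gen copC (F := fun x1 c' => \sw_(z, y2 <- op_comul oA c')
  (T (x1 \ox b1') * (eA z * eB b) * T' (y2 \ox b2') : k^o))); last bil.
rewrite sw_mulr; sweq x1 c'.
under eq_sw => z y2 do rewrite (mulrCA _ (eA z)) -mulrA.
by rewrite (sw_opl bA (F := fun y => (_ : k^o))) ?mulrA 1?[_ * eB b]mulrC ?mulrA //; mlin.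
Qed.

Lemma pair_conv_gen :
  (forall c d, conv (gC c) (gD d) = eA (gC c) * eB (gD d)) ->
  forall a b, conv a b = eA a * eB b.
Proof.
move=> CD.
have gT : forall b c, conv (gC c) b = eA (gC c) * eB b.
  apply: genD => [c|c|d c|b b' Hb Hb' c|b b' Hb Hb' c] //.
  - by rewrite (lin0 (pair_conv_linr _ _ _)) linear0 mulr0.
  - rewrite (ops_counit1 bB) mulr1 /pair_conv.
    under eq_sw => c1 c2.
      rewrite (ops_comul1 bB) sweedler_pure; last bil.
      rewrite (skew_oner sT) (skew_oner sT' : forall a, T' (a \ox op_one oB) = eA a).
    over.
    by rewrite (sw_opl bA (F := (eA : A -> k^o))) //; mlin.
  - by rewrite (linD (pair_conv_linr _ _ _)) linearD mulrDr Hb Hb'.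
  - exact: pair_conv_gen_mulr.
apply: genC => [b|b|c b|a a' Ha Ha' b|a a' Ha Ha' b] //.
- by rewrite (lin0 (pair_conv_linl _ _ _)) linear0 mul0r.
- rewrite (ops_counit1 bA) mul1r /pair_conv.
  rewrite (ops_comul1 bA) sweedler_pure; last bil.
  under eq_sw => b1 b2.
    rewrite (skew_onel sT) (skew_onel sT' : forall a, T' (op_one oA \ox a) = eB a).
  over.
  by rewrite (sw_opl bB (F := (eB : B -> k^o))) //; mlin.
- by rewrite (linD (pair_conv_linl _ _ _)) linearD mulrDl Ha Ha'.
- exact: pair_conv_mull.
Qed.
End PairConv.

(** * The cocycle of a skew pairing and the deformed product *)

Section SkewCocycle.
Variables (k : fieldType) (A B : lmodType k) (oA : bialgOps A) (oB : bialgOps B).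
Hypotheses (bA : is_bialgebra oA) (bB : is_bialgebra oB).
Local Notation L := (tens_ops oA oB).
Local Notation eA := (op_counit oA).
Local Notation eB := (op_counit oB).
Local Notation iA a := (a \ox op_one oB).
Local Notation iB b := (op_one oA \ox b).

Lemma tens_mulE a x b y :
  op_mul L (a \ox x) (b \ox y) = op_mul oA a b \ox op_mul oB x y.
Proof. by rewrite /= /tens_mul sweedler_pure; [rewrite sweedler_pure //; bil|bil]. Qed.

Lemma tens_counitE a x : op_counit L (a \ox x) = eA a * eB x.
Proof. by rewrite /= /tens_counit sweedler_pure //; bil. Qed.

Lemma sw_tens_comul (U : lmodType k) (F : A \otimes B -> A \otimes B -> U) a x : bilin F ->
  sweedler (op_comul L (a \ox x)) F =
  \sw_(a1, a2 <- op_comul oA a) \sw_(x1, x2 <- op_comul oB x) F (a1 \ox x1) (a2 \ox x2).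
Proof.
move=> bF; rewrite /= /tens_comul sweedler_pure; last bil.
rewrite sw_sw //; apply: eq_sw => a1 a2; rewrite sw_sw //; apply: eq_sw => x1 x2.
by rewrite sweedler_pure.
Qed.

Lemma sw_tens_comull (U : lmodType k) (F : A \otimes B -> A \otimes B -> U) a : bilin F ->
  sweedler (op_comul L (iA a)) F = \sw_(a1, a2 <- op_comul oA a) F (iA a1) (iA a2).
Proof.
move=> bF; have [bF1 bF2] := bF; rewrite sw_tens_comul //; apply: eq_sw => a1 a2.
by rewrite (ops_comul1 bB) sweedler_pure //; bil.
Qed.

Lemma sw_tens_comulr (U : lmodType k) (F : A \otimes B -> A \otimes B -> U) b : bilin F ->
  sweedler (op_comul L (iB b)) F = \sw_(b1, b2 <- op_comul oB b) F (iB b1) (iB b2).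
Proof.
move=> bF; have [bF1 bF2] := bF; rewrite sw_tens_comul //.
by rewrite (ops_comul1 bA) sweedler_pure //; bil.
Qed.

Lemma skew_cocycleE (T : {scalar A \otimes B}) a x b y :
  skew_cocycle oA oB T ((a \ox x) \ox (b \ox y)) = eA a * T (b \ox x) * eB y.
Proof.
by rewrite /= /skew_cocycle_fun !(sweedler_pure, sweedler_pure) //; bil.
Qed.

Section Inverse.
Variables (T T' : {scalar A \otimes B}).

Lemma skew_cocycle_conv :
  (forall a b, pair_conv oA oB T T' a b = eA a * eB b) ->
  forall g h : A \otimes B,
  \sw_(g1, g2 <- op_comul L g) \sw_(h1, h2 <- op_comul L h)
    (skew_cocycle oA oB T (g1 \ox h1) * skew_cocycle oA oB T' (g2 \ox h2) : k^o)
  = op_counit L g * op_counit L h.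
Proof.
move=> TT' g h; move: g; apply: (tensor_ext (U := k^o)); [mlin|mlin|move=> a x].
move: h; apply: (tensor_ext (U := k^o)); [mlin|mlin|move=> b y].
rewrite !tens_counitE sw_tens_comul; last bil.
transitivity (\sw_(a1, a2 <- op_comul oA a) (eA a1 *: (eA a2 * (eB x * eA b) * eB y : k^o) :
  k^o)).
  apply: eq_sw => a1 a2.
  transitivity (eA a1 *: (eA a2 * pair_conv oA oB T T' b x * eB y : k^o) : k^o); last first.
    by rewrite TT' [eB x * _]mulrC.
  rewrite /pair_conv [in RHS]sw_exch sw_mulr sw_mull -sw_scaler; sweq x1 x2.
  rewrite sw_tens_comul; last bil.
  rewrite sw_mulr sw_mull -sw_scaler; sweq b1 b2.
  rewrite -[eB y](sw_opl bB (F := (eB : B -> k^o))); last by mlin.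
  rewrite sw_mulr -sw_scaler; sweq y1 y2.
  by rewrite !skew_cocycleE /GRing.scale /=; ring.
by rewrite (sw_opl bA (F := (fun a => eA a * _ * _ : k^o))) ?mulrA //; mlin.
Qed.
End Inverse.

Lemma skew_cocycle_two_cocycle (T T' : {scalar A \otimes B}) : skew_pairing oA oB T ->
  (forall a b, pair_conv oA oB T T' a b = eA a * eB b) ->
  (forall a b, pair_conv oA oB T' T a b = eA a * eB b) ->
  two_cocycle L (skew_cocycle oA oB T).
Proof.
move=> sT TT' T'T; split.
- by exists (skew_cocycle oA oB T') => g h; split; apply: skew_cocycle_conv.
- move=> g h l; move: g; apply: (tensor_ext (U := k^o)); [mlin|mlin|move=> a x].
  move: h; apply: (tensor_ext (U := k^o)); [mlin|mlin|move=> b y].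
  move: l; apply: (tensor_ext (U := k^o)); [mlin|mlin|move=> c z].
  transitivity (\sw_(x1, x2 <- op_comul oB x) \sw_(c1, c2 <- op_comul oA c)
     (eA a * (T (b \ox x1) * T (c1 \ox y) * T (c2 \ox x2)) * eB z : k^o)).
    rewrite sw_tens_comul; last bil.
    transitivity (\sw_(a1, a2 <- op_comul oA a) (eA a1 * (eA a2 *
      (\sw_(x1, x2 <- op_comul oB x) \sw_(b1, b2 <- op_comul oA b) (eA b2 *
       (\sw_(y1, y2 <- op_comul oB y) (eB y1 * (T (b1 \ox x1) * T (c \ox op_mul oB x2 y2) * eB
         z) : k^o)) : k^o))) : k^o)).
      sweq a1 a2; rewrite !sw_mulr; sweq x1 x2; rewrite sw_tens_comul; last bil.
      rewrite !sw_mulr; sweq b1 b2; rewrite !sw_mulr; sweq y1 y2.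
      by rewrite tens_mulE !skew_cocycleE (ops_counitM bA) /=; ring.
    rewrite (sw_oplk bA (F := fun a => (eA a * _ : k^o))); last by mlin.
    rewrite sw_mulr; sweq x1 x2.
    rewrite (sw_oprk bA (F := fun b => \sw_(y1, y2 <- op_comul oB y)
        (eB y1 * (T (b \ox x1) * T (c \ox op_mul oB x2 y2) * eB z) : k^o))); last by mlin.
    rewrite (sw_oplk bB (F := fun y => (T (b \ox x1) * T (c \ox op_mul oB x2 y) * eB z) :
      k^o)); last by mlin.
    by rewrite (skew_mulr sT) !(sw_mulr, sw_mull); sweq c1 c2; rewrite !mulrA.
  rewrite sw_exch; apply/esym.
  rewrite sw_tens_comul; last bil.
  transitivity (\sw_(b1, b2 <- op_comul oA b) (eA b1 *
      (\sw_(y1, y2 <- op_comul oB y) (eB y2 * (\sw_(c1, c2 <- op_comul oA c)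
       (\sw_(z1, z2 <- op_comul oB z) (eB z1 * (eB z2 * (T (c1 \ox y1) * eA a * T (op_mul oA b2
         c2 \ox x))) : k^o) : k^o)) : k^o)) : k^o)).
    sweq b1 b2; rewrite !sw_mulr; sweq y1 y2; rewrite sw_tens_comul; last bil.
    rewrite !sw_mulr; sweq c1 c2; rewrite !sw_mulr; sweq z1 z2.
    by rewrite tens_mulE !skew_cocycleE (ops_counitM bB) /=; ring.
  rewrite (sw_oplk bA (F := fun b2 => \sw_(y1, y2 <- op_comul oB y) (eB y2 * (\sw_(c1, c2 <-
    op_comul oA c)
       (\sw_(z1, z2 <- op_comul oB z) (eB z1 * (eB z2 * (T (c1 \ox y1) * eA a * T (op_mul oA b2
         c2 \ox x))) : k^o) : k^o)) : k^o))); last by mlin.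
  rewrite (sw_oprk bB (F := fun y1 => \sw_(c1, c2 <- op_comul oA c)
       (\sw_(z1, z2 <- op_comul oB z) (eB z1 * (eB z2 * (T (c1 \ox y1) * eA a * T (op_mul oA b
         c2 \ox x))) : k^o) : k^o))); last by mlin.
  sweq c1 c2.
  rewrite (sw_oplk bB (F := fun z => (eB z * _ : k^o))); last by mlin.
  rewrite (skew_mull sT) !sw_mulr; sweq x1 x2; ring.
- apply: (tensor_ext (U := k^o)); [mlin|mlin|move=> b y].
  by rewrite skew_cocycleE (skew_onel sT) tens_counitE (ops_counit1 bB) mulr1.
- apply: (tensor_ext (U := k^o)); [mlin|mlin|move=> b y].
  by rewrite skew_cocycleE (skew_oner sT) tens_counitE (ops_counit1 bA) mul1r.
Qed.

Section Dot.
Variables (T T' : {scalar A \otimes B}).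
Hypothesis T'T : forall a b, pair_conv oA oB T' T a b = eA a * eB b.
Variable s' : {scalar (A \otimes B) \otimes (A \otimes B)}.
Hypothesis s'P : conv_inverse L (skew_cocycle oA oB T) s'.

Lemma skew_cocycle_inv a b : s' (iB b \ox iA a) = T' (a \ox b).
Proof.
have cTs b1 a1 : \sw_(x1, x2 <- op_comul oA a1) \sw_(y1, y2 <- op_comul oB b1)
    (T (x1 \ox y1) * s' (iB y2 \ox iA x2) : k^o) = eA a1 * eB b1.
  have [+ _] := s'P (iB b1) (iA a1).
  rewrite !tens_counitE (ops_counit1 bA) (ops_counit1 bB) mul1r mulr1 mulrC => <-.
  rewrite sw_tens_comulr; last bil.
  rewrite sw_exch; sweq y1 y2; rewrite sw_tens_comull; last bil.
  by sweq x1 x2; rewrite skew_cocycleE (ops_counit1 bA) (ops_counit1 bB) mul1r mulr1.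
transitivity (\sw_(x1, x2 <- op_comul oA a) \sw_(y1, y2 <- op_comul oB b)
  \sw_(x11, x12 <- op_comul oA x1) \sw_(y11, y12 <- op_comul oB y1)
  (T' (x11 \ox y11) * T (x12 \ox y12) * s' (iB y2 \ox iA x2) : k^o)).
  transitivity (\sw_(x1, x2 <- op_comul oA a) (eA x1 * (\sw_(y1, y2 <- op_comul oB b)
     (eB y1 * s' (iB y2 \ox iA x2) : k^o)) : k^o)).
    rewrite (sw_oplk bA (F := fun x2 => \sw_(y1, y2 <- op_comul oB b)
     (eB y1 * s' (iB y2 \ox iA x2) : k^o))); last by mlin.
    by rewrite (sw_oplk bB (F := fun y2 => s' (iB y2 \ox iA a) : k^o)) //; mlin.
  sweq x1 x2; rewrite sw_mulr; sweq y1 y2.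
  rewrite mulrA -T'T /pair_conv sw_mull; sweq x11 x12; rewrite sw_mull; sweq y11 y12.
  by [].
under eq_sw => x1 x2 do rewrite sw_exch.
rewrite (sw_opA bA (F := fun x11 x12 x2 => \sw_(y1, y2 <- op_comul oB b) \sw_(y11, y12 <-
  op_comul oB y1)
  (T' (x11 \ox y11) * T (x12 \ox y12) * s' (iB y2 \ox iA x2) : k^o))); [|move=> ? ?; mlin..].
transitivity (\sw_(x1, x2 <- op_comul oA a) (eA x2 * (\sw_(y1, y2 <- op_comul oB b)
     (eB y2 * T' (x1 \ox y1) : k^o)) : k^o)).
  sweq x1 x2.
  under eq_sw => u v.
    rewrite (sw_opA bB (F := fun y11 y12 y2 => (T' (x1 \ox y11) * T (u \ox y12) * s' (iB y2 \ox
      iA v) : k^o)));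
      [over|move=> ? ?; mlin..].
  rewrite sw_exch sw_mulr; sweq y1 y2; rewrite mulrA -cTs sw_mull; sweq u v.
  by rewrite sw_mull; sweq z1 z2; rewrite -mulrA mulrC.
rewrite (sw_oprk bA (F := fun x1 => \sw_(y1, y2 <- op_comul oB b)
     (eB y2 * T' (x1 \ox y1) : k^o))); last by mlin.
by rewrite (sw_oprk bB (F := fun y1 => T' (a \ox y1) : k^o)) //; mlin.
Qed.

Lemma deformed_mulE b a :
  deformed_mul L (skew_cocycle oA oB T) s' (iB b) (iA a) =
  \sw_(a1, ar <- op_comul oA a) \sw_(a2, a3 <- op_comul oA ar)
  \sw_(b1, br <- op_comul oB b) \sw_(b2, b3 <- op_comul oB br)
    ((T (a1 \ox b1) * T' (a3 \ox b3)) *: (a2 \ox b2)).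
Proof.
rewrite /deformed_mul sw_tens_comulr; last bil.
under eq_sw => b1 br.
  rewrite sw_tens_comulr; last bil.
  under eq_sw => b2 b3.
    rewrite sw_tens_comull; last bil.
    under eq_sw => a1 ar.
      rewrite sw_tens_comull; last bil.
      under eq_sw => a2 a3.
        rewrite skew_cocycleE skew_cocycle_inv tens_mulE.
        rewrite (ops_counit1 bA) (ops_counit1 bB) (ops_mul1l bA) (ops_mul1r bB) mul1r mulr1.
      over.
    over.
  over.
over.
under eq_sw => b1 br do rewrite sw_exch.
rewrite sw_exch; apply: eq_sw => a1 ar.
under eq_sw => b1 br do rewrite sw_exch.
by rewrite sw_exch.
Qed.
End Dot.
End SkewCocycle.

(** * Bosonization *)

(* The axioms of Defs.v over bare operations: the computations in R # H then
   take place in plain modules instead of packed structures. *)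
Record is_yd_module (k : fieldType) (H V : lmodType k) (oH : bialgOps H)
    (S : {linear H -> H}) (act : {bilinear H -> V -> V}) (coact : {linear V -> H \otimes V})
    : Prop := IsYDModule {
  yd_act1 : forall v, act (op_one oH) v = v;
  yd_actM : forall g h v, act (op_mul oH g h) v = act g (act h v);
  yd_coactA : forall v,
    \sw_(h, u <- coact v) \sw_(h1, h2 <- op_comul oH h) (h1 \ox (h2 \ox u))
    = \sw_(h, u <- coact v) (h \ox coact u);
  yd_coact1 : forall v, \sw_(h, u <- coact v) (op_counit oH h *: u) = v;
  yd_coact_act : forall h v,
    coact (act h v) =
      \sw_(h1, hr <- op_comul oH h) \sw_(h2, h3 <- op_comul oH hr)
      \sw_(g, u <- coact v) (op_mul oH (op_mul oH h1 g) (S h3) \ox act h2 u)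
}.

Section YDTheory.
Variables (k : fieldType) (H V : lmodType k) (oH : bialgOps H) (S : {linear H -> H})
  (act : {bilinear H -> V -> V}) (coact : {linear V -> H \otimes V}).
Hypothesis bH : is_bialgebra oH.
Hypothesis Sl : forall h, \sw_(h1, h2 <- op_comul oH h) op_mul oH (S h1) h2 = op_counit oH h *:
  op_one oH.
Hypothesis ydV : is_yd_module oH S act coact.
Local Notation "g ** h" := (op_mul oH g h) (at level 40, left associativity).
Local Notation "h |> a" := (act h a) (at level 35, right associativity).
Local Notation DH := (op_comul oH).
Local Notation eH := (op_counit oH).
Variable U : lmodType k.

Lemma sw_coactA (F : H -> H -> V -> U) v :
  (forall y z, linear (fun x => F x y z)) -> (forall x z, linear (fun y => F x y z)) ->
  (forall x y, linear (F x y)) ->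
  \sw_(h, u <- coact v) \sw_(h1, h2 <- DH h) F h1 h2 u =
  \sw_(h, u <- coact v) \sw_(g, w <- coact u) F h g w.
Proof.
move=> F1 F2 F3.
have := congr1 (fun t => \sw_(x, yz <- t) \sw_(y, z <- yz) F x y z) (yd_coactA ydV v).
rewrite /= !sw_sw; [|bil..].
under eq_sw => a b do (rewrite sw_sw; last bil).
under eq_sw => a b do (under eq_sw => a' b' do (swp; swp)).
by under [RHS]eq_sw => a b do swp.
Qed.

Lemma sw_coact1 (F : V -> U) v : linear F -> \sw_(h, u <- coact v) (eH h *: F u) = F v.
Proof.
move=> lF; rewrite -[in RHS](yd_coact1 ydV v) (sw_lin _ _ lF).
by apply: eq_sw => a b; rewrite (linZ lF).
Qed.

Lemma sw_yd (F : H -> V -> U) h v : bilin F ->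
  \sw_(g, u <- coact (h |> v)) F g u =
  \sw_(h1, hr <- DH h) \sw_(h2, h3 <- DH hr) \sw_(g, u <- coact v) F (h1 ** g ** S h3) (h2 |> u).
Proof.
move=> bF; rewrite (yd_coact_act ydV) sw_sw //; apply: eq_sw => ? ?.
rewrite sw_sw //; apply: eq_sw => ? ?; rewrite sw_sw //; apply: eq_sw => ? ?.
by rewrite sweedler_pure.
Qed.

(* The Yetter-Drinfeld condition in its antipode-free form. *)
Lemma sw_yd_mul (F : H -> V -> U) h v : bilin F ->
  \sw_(h1, h2 <- DH h) \sw_(g, u <- coact (h1 |> v)) F (g ** h2) u =
  \sw_(h1, h2 <- DH h) \sw_(g, u <- coact v) F (h1 ** g) (h2 |> u).
Proof.
move=> [F1 F2].
under eq_sw => h1 h2 do (rewrite sw_yd; last bil).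
rewrite (sw_opA bH (F := fun a b c => \sw_(h2, h3 <- DH b) \sw_(g, u <- coact v) F (a ** g ** S
  h3 ** c) (h2 |> u)));
  [|move=> ? ?; mlin..].
apply: eq_sw => h1 h'.
rewrite (sw_opA bH (F := fun a b c => \sw_(g, u <- coact v) F (h1 ** g ** S b ** c) (a |> u)));
  [|move=> ? ?; mlin..].
transitivity (\sw_(h2, y <- DH h') (eH y *: (\sw_(g, u <- coact v) F (h1 ** g) (h2 |> u)))).
  apply: eq_sw => h2 y; rewrite sw_exch -sw_scaler; apply: eq_sw => g u.
  under eq_sw => y1 y2 do rewrite -(ops_mulA bH).
  rewrite -(sw_lin (g := fun z => F (h1 ** g ** z) (h2 |> u))); last by mlin.
  by rewrite Sl linearZr (linZ (F1 _)) (ops_mul1r bH).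
by rewrite (sw_opr bH (F := fun h2 => \sw_(g, u <- coact v) F (h1 ** g) (h2 |> u))) //; mlin.
Qed.

End YDTheory.

Record is_braided_bialgebra (k : fieldType) (H R : lmodType k)
    (oH : bialgOps H) (S : {linear H -> H}) (oR : bialgOps R)
    (act : {bilinear H -> R -> R}) (coact : {linear R -> H \otimes R}) : Prop :=
  IsBraidedBialgebra {
  bb_mulA : associative (op_mul oR);
  bb_mul1l : left_id (op_one oR) (op_mul oR);
  bb_mul1r : right_id (op_one oR) (op_mul oR);
  bb_comulA : forall c : R,
    \sw_(c1, c2 <- op_comul oR c) \sw_(c11, c12 <- op_comul oR c1) (c11 \ox (c12 \ox c2))
    = \sw_(c1, c2 <- op_comul oR c) (c1 \ox op_comul oR c2);
  bb_counitl : forall c, \sw_(c1, c2 <- op_comul oR c) (op_counit oR c1 *: c2) = c;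
  bb_counitr : forall c, \sw_(c1, c2 <- op_comul oR c) (op_counit oR c2 *: c1) = c;
  bb_yd : is_yd_module oH S act coact;
  bb_actMr : forall h a b,
    act h (op_mul oR a b) = \sw_(h1, h2 <- op_comul oH h) op_mul oR (act h1 a) (act h2 b);
  bb_act_one : forall h, act h (op_one oR) = op_counit oH h *: op_one oR;
  bb_coactM : forall a b,
    coact (op_mul oR a b) =
      \sw_(g, a0 <- coact a) \sw_(h, b0 <- coact b) (op_mul oH g h \ox op_mul oR a0 b0);
  bb_coact_one : coact (op_one oR) = op_one oH \ox op_one oR;
  bb_comul_act : forall h a,
    op_comul oR (act h a) =
      \sw_(h1, h2 <- op_comul oH h) \sw_(a1, a2 <- op_comul oR a) (act h1 a1 \ox act h2 a2);
  bb_counit_act : forall h a, op_counit oR (act h a) = op_counit oH h * op_counit oR a;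
  bb_comul_coact : forall a,
    \sw_(g, a0 <- coact a) (g \ox op_comul oR a0) =
      \sw_(a1, a2 <- op_comul oR a) \sw_(g, b1 <- coact a1)
      \sw_(h, b2 <- coact a2) (op_mul oH g h \ox (b1 \ox b2));
  bb_counit_coact : forall a,
    \sw_(g, a0 <- coact a) (op_counit oR a0 *: g) = op_counit oR a *: op_one oH;
  bb_comulM : forall a b,
    op_comul oR (op_mul oR a b) =
      \sw_(a1, a2 <- op_comul oR a) \sw_(b1, b2 <- op_comul oR b)
      \sw_(g, c <- coact a2) (op_mul oR a1 (act g b1) \ox op_mul oR c b2);
  bb_comul1 : op_comul oR (op_one oR) = op_one oR \ox op_one oR;
  bb_counitM : forall a b, op_counit oR (op_mul oR a b) = op_counit oR a * op_counit oR b;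
  bb_counit1 : op_counit oR (op_one oR) = 1
}.

Section Smash.
Variables (k : fieldType) (H R : lmodType k) (oH : bialgOps H) (S : {linear H -> H})
  (oR : bialgOps R) (act : {bilinear H -> R -> R}) (coact : {linear R -> H \otimes R}).
Hypothesis bH : is_bialgebra oH.
Hypothesis Sl : forall h, \sw_(h1, h2 <- op_comul oH h) op_mul oH (S h1) h2 = op_counit oH h *:
  op_one oH.
Hypothesis bR : is_braided_bialgebra oH S oR act coact.
Let ydR := bb_yd bR.
Local Notation "g ** h" := (op_mul oH g h) (at level 40, left associativity).
Local Notation "a *' b" := (op_mul oR a b) (at level 40, left associativity).
Local Notation "h |> a" := (act h a) (at level 35, right associativity).
Local Notation DH := (op_comul oH).
Local Notation DR := (op_comul oR).
Local Notation eH := (op_counit oH).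
Local Notation eR := (op_counit oR).
Local Notation oneH := (op_one oH).
Local Notation oneR := (op_one oR).

Section Rules.
Variable U : lmodType k.

Lemma sw_DRA (F : R -> R -> R -> U) c :
  (forall y z, linear (fun x => F x y z)) -> (forall x z, linear (fun y => F x y z)) ->
  (forall x y, linear (F x y)) ->
  \sw_(x, y <- DR c) \sw_(x1, x2 <- DR x) F x1 x2 y =
  \sw_(x, y <- DR c) \sw_(y1, y2 <- DR y) F x y1 y2.
Proof. exact/sw_coA/(bb_comulA bR). Qed.

Lemma sw_coactM (F : H -> R -> U) a b : bilin F ->
  \sw_(g, u <- coact (a *' b)) F g u =
  \sw_(g, a0 <- coact a) \sw_(h, b0 <- coact b) F (g ** h) (a0 *' b0).
Proof.
move=> bF; rewrite (bb_coactM bR) sw_sw //; apply: eq_sw => ? ?.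
by rewrite sw_sw //; apply: eq_sw => ? ?; rewrite sweedler_pure.
Qed.

Lemma sw_comul_act (F : R -> R -> U) h a : bilin F ->
  \sw_(x, y <- DR (h |> a)) F x y =
  \sw_(h1, h2 <- DH h) \sw_(a1, a2 <- DR a) F (h1 |> a1) (h2 |> a2).
Proof.
move=> bF; rewrite (bb_comul_act bR) sw_sw //; apply: eq_sw => ? ?.
by rewrite sw_sw //; apply: eq_sw => ? ?; rewrite sweedler_pure.
Qed.

Lemma sw_comul_coact (F : H -> R -> R -> U) a :
  (forall y z, linear (fun x => F x y z)) -> (forall x z, linear (fun y => F x y z)) ->
  (forall x y, linear (F x y)) ->
  \sw_(g, a0 <- coact a) \sw_(b1, b2 <- DR a0) F g b1 b2 =
  \sw_(a1, a2 <- DR a) \sw_(g, b1 <- coact a1) \sw_(h, b2 <- coact a2) F (g ** h) b1 b2.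
Proof.
move=> F1 F2 F3.
have := congr1 (fun t => \sw_(x, yz <- t) \sw_(y, z <- yz) F x y z) (bb_comul_coact bR a).
rewrite /= !sw_sw; [|bil..].
under eq_sw => ? ? do swp.
move=> ->; apply: eq_sw => ? ?; rewrite sw_sw; last bil.
by apply: eq_sw => ? ?; rewrite sw_sw; [apply: eq_sw => ? ?; swp; swp|bil].
Qed.

Lemma sw_braided (F : R -> R -> U) a b : bilin F ->
  \sw_(x, y <- DR (a *' b)) F x y =
  \sw_(a1, a2 <- DR a) \sw_(b1, b2 <- DR b) \sw_(g, c <- coact a2)
     F (a1 *' (g |> b1)) (c *' b2).
Proof.
move=> bF; rewrite (bb_comulM bR) sw_sw //; apply: eq_sw => ? ?.
rewrite sw_sw //; apply: eq_sw => ? ?; rewrite sw_sw //; apply: eq_sw => ? ?.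
by rewrite sweedler_pure.
Qed.

End Rules.

Local Notation RH := (R \otimes H).

Definition smash_mul (s t : RH) : RH :=
  \sw_(a, h <- s) \sw_(b, l <- t) \sw_(h1, h2 <- DH h)
    ((a *' (h1 |> b)) \ox (h2 ** l)).

Definition smash_comul (t : RH) : RH \otimes RH :=
  \sw_(a, h <- t) \sw_(a1, a2 <- DR a) \sw_(h1, h2 <- DH h)
  \sw_(g, c <- coact a2) ((a1 \ox (g ** h1)) \ox (c \ox h2)).

Definition smash_counit (t : RH) : k := \sw_(a, h <- t) (eR a * eH h : k^o).

Lemma smash_mul_bilin : bilinear_for *:%R *:%R smash_mul.
Proof. by split=> ?; rewrite /smash_mul; mlin. Qed.
HB.instance Definition _ :=
  bilinear_isBilinear.Build k RH RH RH *:%R *:%R smash_mul smash_mul_bilin.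

Lemma smash_comul_linear : linear smash_comul.
Proof. by rewrite /smash_comul; mlin. Qed.
HB.instance Definition _ :=
  GRing.isLinear.Build k RH (RH \otimes RH) *:%R smash_comul smash_comul_linear.

Lemma smash_counit_linear : linear (smash_counit : _ -> k^o).
Proof. by rewrite /smash_counit; mlin. Qed.
HB.instance Definition _ :=
  GRing.isLinear.Build k RH k *%R smash_counit smash_counit_linear.

Definition smash : bialgOps RH :=
  BialgOps smash_mul (oneR \ox oneH) smash_comul smash_counit.

Lemma smash_mulE a h b l : op_mul smash (a \ox h) (b \ox l) =
  \sw_(h1, h2 <- DH h) ((a *' (h1 |> b)) \ox (h2 ** l)).
Proof. by rewrite /= /smash_mul sweedler_pure; [rewrite sweedler_pure //; bil|bil]. Qed.

Lemma smash_counitE a h : op_counit smash (a \ox h) = eR a * eH h.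
Proof. by rewrite /= /smash_counit sweedler_pure //; bil. Qed.

Lemma smash_comulE a h : op_comul smash (a \ox h) =
  \sw_(a1, a2 <- DR a) \sw_(h1, h2 <- DH h) \sw_(g, c <- coact a2)
    ((a1 \ox (g ** h1)) \ox (c \ox h2)).
Proof. by rewrite /= /smash_comul sweedler_pure //; bil. Qed.

Lemma sw_smash_comul (U : lmodType k) (F : RH -> RH -> U) a h : bilin F ->
  sweedler (op_comul smash (a \ox h)) F =
  \sw_(a1, a2 <- DR a) \sw_(h1, h2 <- DH h) \sw_(g, c <- coact a2)
    F (a1 \ox (g ** h1)) (c \ox h2).
Proof.
move=> bF; rewrite smash_comulE sw_sw //; apply: eq_sw => ? ?; rewrite sw_sw //.
by apply: eq_sw => ? ?; rewrite sw_sw //; apply: eq_sw => ? ?; rewrite sweedler_pure.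
Qed.

Lemma smash_mulA : associative (op_mul smash).
Proof.
move=> x y z; move: x; apply: tensor_ext; [mlin|mlin|move=> a h].
move: y; apply: tensor_ext; [mlin|mlin|move=> b l].
move: z; apply: tensor_ext; [mlin|mlin|move=> c m].
rewrite !smash_mulE linear_sumr [in RHS]linear_sumlz /=.
transitivity (\sw_(h1, h' <- DH h) \sw_(h2, h3 <- DH h') \sw_(l1, l2 <- DH l)
  ((a *' (h1 |> b) *' (h2 |> l1 |> c)) \ox (h3 ** l2 ** m))).
  rewrite -[LHS]/(\sw_(l1, l2 <- DH l) op_mul smash (a \ox h) ((b *' (l1 |> c)) \ox (l2 ** m))).
  rewrite -(sw_opA bH (F := fun h1 h2 h3 => \sw_(l1, l2 <- DH l)
    ((a *' (h1 |> b) *' (h2 |> l1 |> c)) \ox (h3 ** l2 ** m)))); [|move=> ? ?; mlin..].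
  transitivity (\sw_(l1, l2 <- DH l) \sw_(h', h3 <- DH h) \sw_(h1, h2 <- DH h')
  ((a *' (h1 |> b) *' (h2 |> l1 |> c)) \ox (h3 ** l2 ** m))).
    apply: eq_sw => l1 l2; rewrite smash_mulE; apply: eq_sw => h' h3.
    rewrite (bb_actMr bR) linear_sumr (lin_sum (pure_linl _)); apply: eq_bigr => p _ /=.
    by rewrite (bb_mulA bR) (ops_mulA bH).
  by rewrite sw_exch; apply: eq_sw => h' h3; rewrite sw_exch.
apply: eq_bigr => p _ /=; rewrite smash_mulE (sw_opM bH); last bil.
apply: eq_sw => h2 h3; apply: eq_sw => l1 l2.
by rewrite (yd_actM ydR).
Qed.

Lemma smash_comulM : forall s t,
  op_comul smash (op_mul smash s t) =
  \sw_(s1, s2 <- op_comul smash s) \sw_(t1, t2 <- op_comul smash t)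
     (op_mul smash s1 t1 \ox op_mul smash s2 t2).
Proof.
move=> s t; move: s; apply: tensor_ext; [mlin|mlin|move=> a h].
move: t; apply: tensor_ext; [mlin|mlin|move=> b l].
transitivity (\sw_(a1, a2 <- DR a) \sw_(b1, b2 <- DR b) \sw_(l1, l2 <- DH l)
  \sw_(y, c <- coact a2) \sw_(g1, g2 <- DH y) \sw_(g', d <- coact b2)
  \sw_(h1, h' <- DH h) \sw_(p, h'' <- DH h') \sw_(p2, h3 <- DH h'')
    (((a1 *' (g1 |> h1 |> b1)) \ox (g2 ** (p ** (g' ** l1)))) \ox
     ((c *' (p2 |> d)) \ox (h3 ** l2)))).
  rewrite smash_mulE (sw_lin _ _ (lin_linear _)).
  transitivity (\sw_(h1, h' <- DH h) \sw_(l1, l2 <- DH l)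
    \sw_(a1, a2 <- DR a) \sw_(b1, b2 <- DR b)
    \sw_(y, c <- coact a2) \sw_(g1, g2 <- DH y)
    \sw_(q, h22 <- DH h') \sw_(h12, h21 <- DH q) \sw_(g', d <- coact (h12 |> b2))
    (((a1 *' (g1 |> h1 |> b1)) \ox (g2 ** ((g' ** h21) ** l1))) \ox
     ((c *' d) \ox (h22 ** l2)))).
    transitivity (\sw_(h1, h2 <- DH h) \sw_(h11, h12 <- DH h1) \sw_(h21, h22 <- DH h2)
      \sw_(l1, l2 <- DH l) \sw_(a1, a2 <- DR a) \sw_(b1, b2 <- DR b)
      \sw_(y, c <- coact a2) \sw_(g1, g2 <- DH y) \sw_(g', d <- coact (h12 |> b2))
      (((a1 *' (g1 |> h11 |> b1)) \ox (g2 ** ((g' ** h21) ** l1))) \ox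
       ((c *' d) \ox (h22 ** l2)))).
      apply: eq_sw => h1 h2; rewrite smash_comulE sw_braided; last bil.
      under [RHS]eq_sw => h11 h12 do rewrite sw_exch2.
      rewrite [RHS]sw_exch; apply: eq_sw => a1 a2.
      rewrite sw_comul_act; last bil.
      apply: eq_sw => h11 h12; rewrite [RHS]sw_exch2; apply: eq_sw => b1 b2.
      transitivity (\sw_(y, c <- coact a2) \sw_(h21, h22 <- DH h2) \sw_(l1, l2 <- DH l)
        \sw_(g2, c' <- coact c) \sw_(g', d <- coact (h12 |> b2))
          (((a1 *' (y |> h11 |> b1)) \ox (g2 ** ((g' ** h21) ** l1))) \ox
       ((c' *' d) \ox (h22 ** l2)))).
        apply: eq_sw => y c; rewrite (sw_opM bH); last bil.
        apply: eq_sw => h21 h22; apply: eq_sw => l1 l2; rewrite sw_coactM; last bil.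
        by apply: eq_sw => g2 c'; apply: eq_sw => g' d; rewrite !(ops_mulA bH).
      rewrite sw_exch; apply: eq_sw => h21 h22.
      rewrite sw_exch; apply: eq_sw => l1 l2.
      by rewrite -(sw_coactA ydR (F := fun y g2 c' => \sw_(g', d <- coact (h12 |> b2))
          (((a1 *' (y |> h11 |> b1)) \ox (g2 ** ((g' ** h21) ** l1))) \ox
       ((c' *' d) \ox (h22 ** l2))))) //; move=> ? ?; mlin.
    rewrite (sw_opA bH (F := fun h11 h12 h2 => \sw_(h21, h22 <- DH h2)
      \sw_(l1, l2 <- DH l) \sw_(a1, a2 <- DR a) \sw_(b1, b2 <- DR b)
      \sw_(y, c <- coact a2) \sw_(g1, g2 <- DH y) \sw_(g', d <- coact (h12 |> b2))
      (((a1 *' (g1 |> h11 |> b1)) \ox (g2 ** ((g' ** h21) ** l1))) \ox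
       ((c *' d) \ox (h22 ** l2))))); [|move=> ? ?; mlin..].
    apply: eq_sw => h1 h'.
    rewrite -(sw_opA bH (F := fun h12 h21 h22 =>
      \sw_(l1, l2 <- DH l) \sw_(a1, a2 <- DR a) \sw_(b1, b2 <- DR b)
      \sw_(y, c <- coact a2) \sw_(g1, g2 <- DH y) \sw_(g', d <- coact (h12 |> b2))
      (((a1 *' (g1 |> h1 |> b1)) \ox (g2 ** ((g' ** h21) ** l1))) \ox
       ((c *' d) \ox (h22 ** l2))))); [|move=> ? ?; mlin..].
    by do 5! (rewrite sw_exch2; apply: eq_sw => ? ?).
  transitivity (\sw_(h1, h' <- DH h) \sw_(l1, l2 <- DH l)
    \sw_(a1, a2 <- DR a) \sw_(b1, b2 <- DR b)
    \sw_(y, c <- coact a2) \sw_(g1, g2 <- DH y) \sw_(g', d <- coact b2)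
    \sw_(p, h'' <- DH h') \sw_(p2, h3 <- DH h'')
    (((a1 *' (g1 |> h1 |> b1)) \ox (g2 ** (p ** (g' ** l1)))) \ox
     ((c *' (p2 |> d)) \ox (h3 ** l2)))).
    apply: eq_sw => h1 h'; apply: eq_sw => l1 l2; apply: eq_sw => a1 a2; apply: eq_sw => b1 b2.
    apply: eq_sw => y c; apply: eq_sw => g1 g2.
    transitivity (\sw_(q, h22 <- DH h') \sw_(p, p2 <- DH q) \sw_(g', d <- coact b2)
      (((a1 *' (g1 |> h1 |> b1)) \ox (g2 ** ((p ** g') ** l1))) \ox
       ((c *' (p2 |> d)) \ox (h22 ** l2)))).
      apply: eq_sw => q h22.
      rewrite (sw_yd_mul bH Sl ydR (F := fun x d => ((a1 *' (g1 |> h1 |> b1)) \ox (g2 ** (x **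
        l1))) \ox
       ((c *' d) \ox (h22 ** l2)))) //; bil.
    rewrite sw_exch2; apply: eq_sw => g' d.
    rewrite (sw_opA bH (F := fun p p2 h22 => ((a1 *' (g1 |> h1 |> b1)) \ox (g2 ** ((p ** g') **
      l1))) \ox
       ((c *' (p2 |> d)) \ox (h22 ** l2)))); [|move=> ? ?; mlin..].
    by apply: eq_sw => p h''; apply: eq_sw => p2 h3; rewrite -!(ops_mulA bH).
  rewrite sw_exch2; apply: eq_sw => a1 a2.
  rewrite sw_exch2; apply: eq_sw => b1 b2.
  by do 4! (rewrite sw_exch; apply: eq_sw => ? ?).
rewrite sw_smash_comul; last bil.
apply: eq_sw => a1 a2.
transitivity (\sw_(h1, h2 <- DH h) \sw_(y, c <- coact a2) \sw_(b1, b2 <- DR b)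
  \sw_(l1, l2 <- DH l) \sw_(g', d <- coact b2) \sw_(g1, g2 <- DH y)
  \sw_(h11, h12 <- DH h1) \sw_(v1, v2 <- DH h2)
    (((a1 *' (g1 |> h11 |> b1)) \ox (g2 ** (h12 ** (g' ** l1)))) \ox
     ((c *' (v1 |> d)) \ox (v2 ** l2)))); last first.
  apply: eq_sw => h1 h2; apply: eq_sw => y c; rewrite sw_smash_comul; last bil.
  apply: eq_sw => b1 b2; apply: eq_sw => l1 l2; apply: eq_sw => g' d.
  rewrite !smash_mulE sw_purel (sw_opM bH); last bil.
  apply: eq_sw => g1 g2; apply: eq_sw => h11 h12; rewrite sw_purer; apply: eq_sw => v1 v2.
  by rewrite (yd_actM ydR) !(ops_mulA bH).
under [RHS]eq_sw => h1 h2 do rewrite sw_exch.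
rewrite [RHS]sw_exch; apply: eq_sw => b1 b2.
under [RHS]eq_sw => h1 h2 do rewrite sw_exch.
rewrite [RHS]sw_exch; apply: eq_sw => l1 l2.
rewrite [RHS]sw_exch; apply: eq_sw => y c.
under [RHS]eq_sw => h1 h2 do rewrite sw_exch.
rewrite [RHS]sw_exch; apply: eq_sw => g1 g2.
rewrite [RHS]sw_exch; apply: eq_sw => g' d.
by rewrite (sw_opA bH (F := fun h11 h12 h2 => \sw_(v1, v2 <- DH h2)
 (((a1 *' (g1 |> h11 |> b1)) \ox (g2 ** (h12 ** (g' ** l1)))) \ox
     ((c *' (v1 |> d)) \ox (v2 ** l2))))) //; move=> ? ?; mlin.
Qed.

Lemma smash_comulA : forall c : RH,
  \sw_(c1, c2 <- op_comul smash c) \sw_(c11, c12 <- op_comul smash c1) (c11 \ox (c12 \ox c2))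
    = \sw_(c1, c2 <- op_comul smash c) (c1 \ox op_comul smash c2).
Proof.
apply: tensor_ext; [mlin|mlin|move=> a h].
transitivity (\sw_(a1, a' <- DR a) \sw_(a21, a22 <- DR a') \sw_(g', c' <- coact a21)
   \sw_(g, c <- coact a22) \sw_(g1, g2 <- DH g) \sw_(h1, h' <- DH h) \sw_(h2, h3 <- DH h')
   ((a1 \ox (g' ** (g1 ** h1))) \ox ((c' \ox (g2 ** h2)) \ox (c \ox h3)))).
  rewrite sw_smash_comul; last bil.
  rewrite -(sw_DRA (F := fun a1 a21 a22 => \sw_(g', c' <- coact a21)
   \sw_(g, c <- coact a22) \sw_(g1, g2 <- DH g) \sw_(h1, h' <- DH h) \sw_(h2, h3 <- DH h')
   ((a1 \ox (g' ** (g1 ** h1))) \ox ((c' \ox (g2 ** h2)) \ox (c \ox h3))))); [|move=> ? ?;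
     mlin..].
  apply: eq_sw => a1 a2.
  transitivity (\sw_(h1, h2 <- DH h) \sw_(g, c <- coact a2)  \sw_(a11, a12 <- DR a1)
    \sw_(g1, g2 <- DH g) \sw_(h11, h12 <- DH h1) \sw_(g', c' <- coact a12)
    ((a11 \ox (g' ** (g1 ** h11))) \ox ((c' \ox (g2 ** h12)) \ox (c \ox h2)))).
    apply: eq_sw => h1 h2; apply: eq_sw => g c; rewrite sw_smash_comul; last bil.
    by apply: eq_sw => a11 a12; rewrite (sw_opM bH) //; bil.
  rewrite sw_exch2; apply: eq_sw => a11 a12.
  under eq_sw => h1 h2 do (under eq_sw => g c do rewrite sw_exch2).
  rewrite sw_exch2; apply: eq_sw => g' c'.
  rewrite sw_exch; apply: eq_sw => g c.
  rewrite sw_exch; apply: eq_sw => g1 g2.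
  by rewrite (sw_opA bH (F := fun h1 h2 h3 => (a11 \ox (g' ** (g1 ** h1))) \ox ((c' \ox (g2 **
    h2)) \ox (c \ox h3)))) //;
    move=> ? ?; mlin.
rewrite sw_smash_comul; last bil.
apply: eq_sw => a1 a2.
transitivity (\sw_(h1, h' <- DH h) \sw_(g, c <- coact a2) \sw_(c1, c2 <- DR c) \sw_(h2, h3 <-
  DH h')
  \sw_(y, d <- coact c2) ((a1 \ox (g ** h1)) \ox ((c1 \ox (y ** h2)) \ox (d \ox h3)))); last
    first.
  apply: eq_sw => h1 h'; apply: eq_sw => g c; rewrite smash_comulE sw_purer; apply: eq_sw => c1
    c2.
  by rewrite sw_purer; apply: eq_sw => h2 h3; rewrite sw_purer.
under [RHS]eq_sw => h1 h'.
  rewrite (sw_comul_coact (F := fun g c1 c2 => \sw_(h2, h3 <- DH h')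
  \sw_(y, d <- coact c2) ((a1 \ox (g ** h1)) \ox ((c1 \ox (y ** h2)) \ox (d \ox h3)))));
    [|move=> ? ?; mlin..].
over.
rewrite [RHS]sw_exch; apply: eq_sw => a21 a22.
rewrite [RHS]sw_exch; apply: eq_sw => g' c'.
rewrite (sw_coactA ydR (F := fun g1 g2 c =>  \sw_(h1, h' <- DH h) \sw_(h2, h3 <- DH h')
   ((a1 \ox (g' ** (g1 ** h1))) \ox ((c' \ox (g2 ** h2)) \ox (c \ox h3))))); [|move=> ? ?;
     mlin..].
rewrite [RHS]sw_exch; apply: eq_sw => g c.
under [RHS]eq_sw => h1 h' do rewrite sw_exch.
rewrite [RHS]sw_exch; apply: eq_sw => g2 d; apply: eq_sw => h1 h'; apply: eq_sw => h2 h3.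
by rewrite (ops_mulA bH).
Qed.

Lemma smash_bialgebra : is_bialgebra smash.
Proof.
split; first exact: smash_mulA.
- apply: tensor_ext; [mlin|mlin|move=> a h].
  rewrite smash_mulE (ops_comul1 bH) sweedler_pure; last bil.
  by rewrite (yd_act1 ydR) (bb_mul1l bR) (ops_mul1l bH).
- apply: tensor_ext; [mlin|mlin|move=> a h].
  rewrite smash_mulE; under eq_sw => h1 h2.
    rewrite (bb_act_one bR) linearZr (bb_mul1r bR) (ops_mul1r bH) (linZ (pure_linl _)).
  over.
  by rewrite (sw_opl bH (F := fun h => a \ox h)) //; mlin.
- exact: smash_comulA.
- apply: tensor_ext; [mlin|mlin|move=> a h].
  rewrite sw_smash_comul; last bil.
  transitivity (\sw_(a1, a2 <- DR a) (eR a1 *: (\sw_(h1, h2 <- DH h) (eH h1 *: (\sw_(g, c <-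
    coact a2)
    (eH g *: (c \ox h2))))))).
    apply: eq_sw => a1 a2; rewrite -sw_scaler; apply: eq_sw => h1 h2.
    rewrite -!sw_scaler; apply: eq_sw => g c.
    by rewrite smash_counitE (ops_counitM bH) !scalerA; congr (_ *: _); ring.
  under eq_sw => a1 a2.
    rewrite (sw_opl bH (F := fun h => \sw_(g, c <- coact a2) (eH g *: (c \ox h)))); last by mlin.
    rewrite (sw_coact1 ydR (F := fun c => c \ox h)); last by mlin.
  over.
  under eq_sw => a1 a2 do rewrite -(linZ (pure_linl _)).
  by rewrite -sw_purel (bb_counitl bR).
- apply: tensor_ext; [mlin|mlin|move=> a h].
  rewrite sw_smash_comul; last bil.
  transitivity (\sw_(a1, a2 <- DR a) \sw_(h1, h2 <- DH h) (eH h2 *: (a1 \ox ((\sw_(g, c <-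
    coact a2)
    (eR c *: g)) ** h1)))).
    apply: eq_sw => a1 a2; apply: eq_sw => h1 h2.
    rewrite (sw_lin (g := fun x => x ** h1)); last by mlin.
    rewrite sw_purer -sw_scaler; apply: eq_sw => g c.
    by rewrite smash_counitE linearZl (linZ (pure_linr _)) scalerA mulrC.
  transitivity (\sw_(a1, a2 <- DR a) (eR a2 *: (a1 \ox h))); last first.
    under eq_sw => a1 a2 do rewrite -(linZ (pure_linl _)).
    by rewrite -sw_purel (bb_counitr bR).
  apply: eq_sw => a1 a2; rewrite (bb_counit_coact bR).
  under eq_sw => h1 h2 do rewrite linearZl (ops_mul1l bH) (linZ (pure_linr _)).
  by rewrite (sw_opr bH (F := fun h => eR a2 *: (a1 \ox h))) //; mlin.
- exact: smash_comulM.
- rewrite smash_comulE (bb_comul1 bR) sweedler_pure; last bil.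
  rewrite (ops_comul1 bH) sweedler_pure; last bil.
  rewrite (bb_coact_one bR) sweedler_pure; last bil.
  by rewrite (ops_mul1l bH).
- move=> s t; move: s; apply: (tensor_ext (U := k^o)); [mlin|mlin|move=> a h].
  move: t; apply: (tensor_ext (U := k^o)); [mlin|mlin|move=> b l].
  rewrite smash_mulE (sw_lin (g := (op_counit smash : _ -> k^o))); last by mlin.
  rewrite !smash_counitE.
  transitivity (\sw_(h1, h2 <- DH h) (eH h1 * (eR a * eR b * eH h2 * eH l) : k^o)).
    apply: eq_sw => h1 h2; rewrite smash_counitE (bb_counitM bR) (bb_counit_act bR)
      (ops_counitM bH).
    by ring.
  rewrite (sw_oplk bH (F := fun h => eR a * eR b * eH h * eH l : k^o)); last by mlin.
  by ring.
- by rewrite smash_counitE (bb_counit1 bR) (ops_counit1 bH) mulr1.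
Qed.
End Smash.

(** * Hopf algebras and Yetter-Drinfeld modules *)

Lemma hopf_bialgebra (k : fieldType) (H : hopfAlgType k) : is_bialgebra (hopf_ops H).
Proof.
split.
- exact: mulrA.
- exact: mul1r.
- exact: mulr1.
- exact: comulA.
- exact: counitl.
- exact: counitr.
- exact: comulM.
- exact: comul1.
- exact: counitM.
- exact: counit1.
Qed.

Lemma yd_moduleP (k : fieldType) (H : hopfAlgType k) (V : ydModType H) :
  is_yd_module (hopf_ops H) antipode (@ydact k H V) ydcoact.
Proof.
split.
- exact: ydact1.
- exact: ydactM.
- exact: ydcoactA.
- exact: ydcoact1.
- exact: yd_compat.
Qed.

Section Boson.
Variables (k : fieldType) (H : hopfAlgType k) (R : braidedBialgType H).

Definition alg_mul (a b : R) : R := a * b.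
Lemma alg_mul_bilin : bilinear_for *:%R *:%R alg_mul.
Proof. by split=> ?; rewrite /alg_mul; mlin. Qed.
HB.instance Definition _ :=
  bilinear_isBilinear.Build k R R R *:%R *:%R alg_mul alg_mul_bilin.

Definition braided_ops : bialgOps R := BialgOps alg_mul 1 comul counit.

Lemma braided_bialgebraP :
  is_braided_bialgebra (hopf_ops H) antipode braided_ops ydact ydcoact.
Proof.
split.
- exact: mulrA.
- exact: mul1r.
- exact: mulr1.
- exact: comulA.
- exact: counitl.
- exact: counitr.
- exact: yd_moduleP.
- exact: ydactMr.
- exact: ydact_one.
- exact: ydcoactM.
- exact: ydcoact_one.
- exact: comul_ydact.
- exact: counit_ydact.
- exact: comul_ydcoact.
- exact: counit_ydcoact.
- exact: braided_comulM.
- exact: braided_comul1.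
- exact: braided_counitM.
- exact: braided_counit1.
Qed.

Lemma boson_bialgebra : is_bialgebra (boson R).
Proof.
have [] := smash_bialgebra (hopf_bialgebra H) (@antipodel _ H) braided_bialgebraP.
by move=> *; split.
Qed.
End Boson.

Section Hopf.
Variables (k : fieldType) (H : hopfAlgType k).
Local Notation S := (@antipode k H).

Section Rules.
Variable U : lmodType k.

Lemma sw_comulA (F : H -> H -> H -> U) c :
  (forall y z, linear (fun x => F x y z)) -> (forall x z, linear (fun y => F x y z)) ->
  (forall x y, linear (F x y)) ->
  \sw_(x, y <- comul c) \sw_(x1, x2 <- comul x) F x1 x2 y =
  \sw_(x, y <- comul c) \sw_(y1, y2 <- comul y) F x y1 y2.
Proof. exact/sw_coA/comulA. Qed.

Lemma sw_counitl (F : H -> U) c : linear F ->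
  \sw_(x, y <- comul c) (counit x *: F y) = F c.
Proof. exact/(sw_opl (hopf_bialgebra H)). Qed.

Lemma sw_counitr (F : H -> U) c : linear F ->
  \sw_(x, y <- comul c) (counit y *: F x) = F c.
Proof. exact/(sw_opr (hopf_bialgebra H)). Qed.

Lemma sw_comulM (F : H -> H -> U) a b : bilin F ->
  \sw_(x, y <- comul (a * b)) F x y =
  \sw_(a1, a2 <- comul a) \sw_(b1, b2 <- comul b) F (a1 * b1) (a2 * b2).
Proof. exact/(sw_opM (hopf_bialgebra H)). Qed.

Lemma sw_comul1 (F : H -> H -> U) : bilin F -> \sw_(x, y <- comul (1 : H)) F x y = F 1 1.
Proof. by move=> bF; rewrite comul1 sweedler_pure. Qed.

Lemma sw_antipodel (F : H -> U) h : linear F ->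
  \sw_(h1, h2 <- comul h) F (S h1 * h2) = counit h *: F 1.
Proof. by move=> lF; rewrite -(sw_lin _ _ lF) antipodel (linZ lF). Qed.

Lemma sw_antipoder (F : H -> U) h : linear F ->
  \sw_(h1, h2 <- comul h) F (h1 * S h2) = counit h *: F 1.
Proof. by move=> lF; rewrite -(sw_lin _ _ lF) antipoder (linZ lF). Qed.
End Rules.

Lemma antipode1 : S 1 = 1.
Proof.
have := sw_antipodel (1 : H) (lin_id (V := H)).
by rewrite sw_comul1 ?counit1 ?mulr1 ?scale1r //; bil.
Qed.

Lemma counit_antipode (h : H) : counit (S h) = counit h.
Proof.
have := sw_antipodel h (lin_scalar counit).
rewrite counit1 /GRing.scale /= mulr1 => <-.
under eq_sw => h1 h2 do rewrite counitM mulrC.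
by rewrite (sw_counitr (F := fun h => counit (S h) : k^o)) //; mlin.
Qed.

Lemma antipodeM (g h : H) : S (g * h) = S h * S g.
Proof.
transitivity (\sw_(g1, g' <- comul g) \sw_(h1, h' <- comul h) \sw_(g2, g3 <- comul g')
  \sw_(h2, h3 <- comul h') (S (g1 * h1) * (g2 * h2) * (S h3 * S g3))).
  transitivity (\sw_(g1, g' <- comul g) (counit g' *: (\sw_(h1, h' <- comul h)
     (counit h' *: S (g1 * h1))))).
    rewrite (sw_counitr (F := fun g1 => \sw_(h1, h' <- comul h) (counit h' *: S (g1 * h1))));
      last by mlin.
    by rewrite (sw_counitr (F := fun h1 => S (g * h1))) //; mlin.
  apply: eq_sw => g1 g'; rewrite -sw_scaler; apply: eq_sw => h1 h'.
  transitivity (\sw_(g2, g3 <- comul g') (counit h' *: (S (g1 * h1) * (g2 * S g3)))).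
    by rewrite (sw_antipoder (F := fun x => counit h' *: (S (g1 * h1) * x))) ?mulr1 //; mlin.
  apply: eq_sw => g2 g3.
  transitivity (\sw_(h2, h3 <- comul h') (S (g1 * h1) * g2 * (h2 * S h3) * S g3)).
    rewrite (sw_antipoder (F := fun x => (S (g1 * h1) * g2 * x * S g3))); last by mlin.
    by rewrite mulr1 mulrA.
  by apply: eq_sw => h2 h3; rewrite !mulrA.
under eq_sw => g1 g' do rewrite sw_exch.
rewrite -(sw_comulA (F := fun g1 g2 g3 => \sw_(h1, h' <- comul h)
  \sw_(h2, h3 <- comul h') (S (g1 * h1) * (g2 * h2) * (S h3 * S g3)))); [|move=> ? ?; mlin..].
transitivity (\sw_(g', g3 <- comul g) (counit g' *: (\sw_(h', h3 <- comul h)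
   (counit h' *: (S h3 * S g3))))).
  apply: eq_sw => g' g3.
  under eq_sw => g1 g2.
    rewrite -(sw_comulA (F := fun h1 h2 h3 => (S (g1 * h1) * (g2 * h2) * (S h3 * S g3))));
      [|move=> ? ?; mlin..].
  over.
  rewrite sw_exch -sw_scaler; apply: eq_sw => h' h3.
  rewrite -(sw_comulM (F := fun x y => S x * y * (S h3 * S g3))); last bil.
  rewrite (sw_antipodel (F := fun x => x * (S h3 * S g3))); last by mlin.
  by rewrite counitM mul1r scalerA.
rewrite (sw_counitl (F := fun g3 => \sw_(h', h3 <- comul h) (counit h' *: (S h3 * S g3))));
  last by mlin.
by rewrite (sw_counitl (F := fun h3 => S h3 * S g)) //; mlin.
Qed.

Lemma sw_comul_antipode (U : lmodType k) (F : H -> H -> U) h : bilin F ->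
  \sw_(x, y <- comul (S h)) F x y = \sw_(h1, h2 <- comul h) F (S h2) (S h1).
Proof.
case=> F1 F2.
transitivity (\sw_(h1, h' <- comul h) \sw_(h2, h3 <- comul h') \sw_(p, q <- comul (S h1))
  \sw_(u1, u2 <- comul h2) \sw_(v1, v2 <- comul h3) F (p * u1 * S v2) (q * u2 * S v1)).
  transitivity (\sw_(h1, h' <- comul h) (counit h' *: \sw_(p, q <- comul (S h1)) F p q)).
    by rewrite (sw_counitr (F := fun h1 => \sw_(p, q <- comul (S h1)) F p q)) //; mlin.
  apply: eq_sw => h1 h'; rewrite -sw_scaler [RHS]sw_exch; apply: eq_sw => p q.
  rewrite (sw_comulA (F := fun u1 u2 h3 => \sw_(v1, v2 <- comul h3)
    F (p * u1 * S v2) (q * u2 * S v1))); [|move=> ? ?; mlin..].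
  transitivity (\sw_(u1, v2 <- comul h') F (p * (u1 * S v2)) q).
    by rewrite (sw_antipoder (F := fun x => F (p * x) q)) ?mulr1 //; mlin.
  apply: eq_sw => u1 y.
  rewrite -(sw_comulA (F := fun u2 v1 v2 => F (p * u1 * S v2) (q * u2 * S v1))); [|move=> ? ?;
    mlin..].
  transitivity (\sw_(z, v2 <- comul y) (counit z *: F (p * u1 * S v2) q)).
    by rewrite (sw_counitl (F := fun v2 => F (p * u1 * S v2) q)) ?mulrA //; mlin.
  apply: eq_sw => z v2; under eq_sw => u2 v1 do rewrite -(mulrA q).
  by rewrite (sw_antipoder (F := fun x => F (p * u1 * S v2) (q * x))) ?mulr1 //; mlin.
rewrite -(sw_comulA (F := fun h1 h2 h3 => \sw_(p, q <- comul (S h1))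
  \sw_(u1, u2 <- comul h2) \sw_(v1, v2 <- comul h3) F (p * u1 * S v2) (q * u2 * S v1)));
    [|move=> ? ?; mlin..].
transitivity (\sw_(h', h3 <- comul h) (counit h' *: \sw_(v1, v2 <- comul h3) F (S v2) (S v1)));
  last first.
  by rewrite (sw_counitl (F := fun h3 => \sw_(v1, v2 <- comul h3) F (S v2) (S v1))) //; mlin.
apply: eq_sw => h' h3.
under eq_sw => h1 h2.
  rewrite -(sw_comulM (F := fun x y => \sw_(v1, v2 <- comul h3) F (x * S v2) (y * S v1))); last
    bil.
over.
rewrite (sw_antipodel (F := fun w => \sw_(x, y <- comul w)
   \sw_(v1, v2 <- comul h3) F (x * S v2) (y * S v1))); last by mlin.
rewrite sw_comul1; last bil.
by congr (_ *: _); apply: eq_sw => v1 v2; rewrite !mul1r.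
Qed.
End Hopf.

Section YD.
Variables (k : fieldType) (H : hopfAlgType k) (V : ydModType H) (U : lmodType k).

Lemma sw_ydcoactA (F : H -> H -> V -> U) v :
  (forall y z, linear (fun x => F x y z)) -> (forall x z, linear (fun y => F x y z)) ->
  (forall x y, linear (F x y)) ->
  \sw_(h, u <- ydcoact v) \sw_(h1, h2 <- comul h) F h1 h2 u =
  \sw_(h, u <- ydcoact v) \sw_(g, w <- ydcoact u) F h g w.
Proof. exact/(sw_coactA (yd_moduleP V)). Qed.

Lemma sw_ydcoact1 (F : V -> U) v : linear F ->
  \sw_(h, u <- ydcoact v) (counit (h : H) *: F u) = F v.
Proof. exact/(sw_coact1 (yd_moduleP V)). Qed.

Lemma sw_ydcoact_act (F : H -> V -> U) h v : bilin F ->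
  \sw_(g, u <- ydcoact (ydact h v)) F g u =
  \sw_(h1, hr <- comul h) \sw_(h2, h3 <- comul hr) \sw_(g, u <- ydcoact v)
     F (h1 * g * antipode h3) (ydact h2 u).
Proof. exact/(sw_yd (yd_moduleP V)). Qed.

Lemma sw_ydcoact_act_mul (F : H -> V -> U) h v : bilin F ->
  \sw_(h1, h2 <- comul h) \sw_(g, u <- ydcoact (ydact h1 v)) F (g * h2) u =
  \sw_(h1, h2 <- comul h) \sw_(g, u <- ydcoact v) F (h1 * g) (ydact h2 u).
Proof.
exact/(sw_yd_mul (hopf_bialgebra H) (@antipodel _ H) (yd_moduleP V)).
Qed.
End YD.

(** * The degree one part of a pre-Nichols algebra *)

Section DegreeOne.
Variables (k : fieldType) (H : hopfAlgType k) (V : ydModType H) (R : preNichols V).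
Local Notation gr := (@pn_gr k H V R).
Local Notation iota := (@pn_in k H V R).
Let pnR := @pn_spec k H V R.

Lemma gr_0 n : 0 \in gr n.
Proof. by case: (gr_submod pnR n). Qed.

Lemma gr_Z n c r : r \in gr n -> c *: r \in gr n.
Proof.
move=> rn; have [_ lin] := gr_submod pnR n.
by rewrite -[_ *: _]addr0; apply: lin => //; apply: gr_0.
Qed.

Lemma gr_D n r s : r \in gr n -> s \in gr n -> r + s \in gr n.
Proof.
by move=> rn sn; have [_ lin] := gr_submod pnR n; rewrite -[r]scale1r; apply: lin.
Qed.

Definition deg_ge2 (r : R) : Prop :=
  exists n (f : nat -> R), (forall i, f i \in gr i.+2) /\ r = \sum_(i < n) f i.

Lemma deg_ge2_hom n r : (1 < n)%N -> r \in gr n -> deg_ge2 r.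
Proof.
case: n => [|[|n]] // _ rn; exists n.+1, (fun i => if i == n then r else 0); split.
  by move=> i; case: eqP => [->|] //; rewrite gr_0.
rewrite big_ord_recr /= eqxx big1 ?add0r // => i _.
by rewrite ltn_eqF.
Qed.

Lemma deg_ge2_0 : deg_ge2 0.
Proof. exact: (@deg_ge2_hom 2%N) (gr_0 _). Qed.

Lemma deg_ge2_D r s : deg_ge2 r -> deg_ge2 s -> deg_ge2 (r + s).
Proof.
have pad n (f : nat -> R) m : (n <= m)%N ->
    \sum_(i < n) f i = \sum_(i < m) (if (i < n)%N then f i else 0).
  by move=> le_nm; rewrite (big_ord_widen m f le_nm) big_mkcond.
move=> [n [f [fP ->]]] [m [g [gP ->]]].
exists (maxn n m), (fun i => (if (i < n)%N then f i else 0) + (if (i < m)%N then g i else 0)).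
split=> [i|].
  by apply: gr_D; case: ifP => // _; apply: gr_0.
by rewrite (pad n f (maxn n m)) ?leq_maxl // (pad m g (maxn n m)) ?leq_maxr // big_split.
Qed.

Lemma deg_ge2_Z c r : deg_ge2 r -> deg_ge2 (c *: r).
Proof.
move=> [n [f [fP ->]]]; exists n, (fun i => c *: f i); split=> [i|].
  exact: gr_Z.
by rewrite scaler_sumr.
Qed.

Lemma deg_ge2_sum (I : Type) (s : seq I) (F : I -> R) :
  (forall i, deg_ge2 (F i)) -> deg_ge2 (\sum_(i <- s) F i).
Proof. by move=> FP; apply: big_ind => //; [apply: deg_ge2_0|apply: deg_ge2_D]. Qed.

Lemma deg_ge2_mull r s : deg_ge2 r -> deg_ge2 (r * s).
Proof.
move=> [n [f [fP ->]]]; have [m [g [gP ->]]] := gr_total pnR s.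
rewrite big_distrlr; do 2! apply: deg_ge2_sum => ?.
by apply: deg_ge2_hom (gr_mul pnR (fP _) (gP _)).
Qed.

Lemma deg_ge2_mulr r s : deg_ge2 r -> deg_ge2 (s * r).
Proof.
move=> [n [f [fP ->]]]; have [m [g [gP ->]]] := gr_total pnR s.
rewrite big_distrlr; do 2! apply: deg_ge2_sum => ?.
by apply: deg_ge2_hom (gr_mul pnR (gP _) (fP _)); rewrite !addnS.
Qed.

Lemma deg_ge2_iota v w : deg_ge2 (iota v * iota w).
Proof.
apply: (@deg_ge2_hom 2%N) => //.
by apply: (@gr_mul _ _ _ _ _ _ pnR 1%N 1%N); apply/(gr_one pnR); eexists.
Qed.

Lemma deg_ge2_act h r : deg_ge2 r -> deg_ge2 (ydact h r).
Proof.
move=> [n [f [fP ->]]]; rewrite linear_sumr; apply: deg_ge2_sum => i.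
exact: deg_ge2_hom (gr_ydact pnR _ (fP i)).
Qed.

Lemma counit_alg c : counit (c%:A : R) = c.
Proof. by rewrite linearZ /= braided_counit1 mulr1. Qed.

Lemma counit_iota v : counit (iota v) = 0.
Proof. by apply: (@gr_counit _ _ _ _ _ _ pnR 1%N) => //; apply/(gr_one pnR); exists v. Qed.

Lemma counit_deg_ge2 r : deg_ge2 r -> counit r = 0.
Proof.
move=> [n [f [fP ->]]]; rewrite linear_sum big1 // => i _.
exact: (gr_counit pnR _ (fP i)).
Qed.

Lemma iota_deg_ge2 v : deg_ge2 (iota v) -> v = 0.
Proof.
move=> [n [f [fP fE]]].
have := gr_direct pnR (n := n.+2)
  (f := fun i => if i is j.+1 then (if j is l.+1 then f l else - iota v) else 0).
have H1 : forall i, (if i is j.+1 then (if j is l.+1 then f l else - iota v) else 0) \in gr i.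
  case=> [|[|i]]; [exact: gr_0| |exact: fP].
  by rewrite -scaleN1r; apply/gr_Z/(gr_one pnR); exists v.
rewrite !big_ord_recl /= add0r -fE addNr => /(_ H1 erefl 1%N isT) /= /eqP.
by rewrite oppr_eq0 => /eqP/esym; rewrite -(linear0 iota) => /(iota_inj pnR).
Qed.

Definition degree_one_part (r : R) (v : V) : Prop :=
  exists2 t, deg_ge2 t & r = (counit r)%:A + iota v + t.

Lemma degree_one_partI r c v t : deg_ge2 t -> r = c%:A + iota v + t -> degree_one_part r v.
Proof.
move=> tP rE; exists t => //; rewrite {1}rE; congr (_ *: _ + _ + _).
by rewrite rE !linearD /= counit_iota (counit_deg_ge2 tP) counit_alg !addr0.
Qed.

Lemma degree_one_part_ex r : exists v, degree_one_part r v.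
Proof.
suff [c [v [t [tP rE]]]] : exists c v t, deg_ge2 t /\ r = c%:A + iota v + t.
  by exists v; apply: degree_one_partI tP rE.
have [n [f [fP ->]]] := gr_total pnR r.
elim: n => [|n [c [v [t [tP E]]]]].
  exists 0, 0, 0; split; first exact: deg_ge2_0.
  by rewrite big_ord0 scale0r linear0 !addr0.
rewrite big_ord_recr E /=; case: n {E} => [|[|n]].
- have /(gr_zero pnR)[d ->] := fP 0%N.
  exists (c + d), v, t; split => //.
  by rewrite scalerDl addrAC (addrAC c%:A).
- have /(gr_one pnR)[u ->] := fP 1%N.
  exists c, (v + u), t; split => //.
  by rewrite (linD (lin_linear iota)) addrA [LHS]addrAC.
- exists c, v, (t + f n.+2); rewrite addrA; split => //.
  apply: deg_ge2_D => //; exact: deg_ge2_hom (fP _).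
Qed.

Lemma degree_one_part_uniq r v v' : degree_one_part r v -> degree_one_part r v' -> v = v'.
Proof.
move=> [t tP rE] [t' tP' rE'].
apply/eqP; rewrite -subr_eq0; apply/eqP/iota_deg_ge2.
have E : iota v + t = iota v' + t'.
  by apply: (addrI (counit r)%:A); rewrite !addrA -rE.
suff -> : iota (v - v') = t' + -1 *: t by apply: deg_ge2_D => //; apply: deg_ge2_Z.
rewrite scaleN1r linearB /=; apply/eqP; rewrite subr_eq -[X in X == _](addrK t) E.
by rewrite -addrA addrC.
Qed.

Lemma degree_one_projection : exists p : {linear R -> V},
  [/\ forall v, p (iota v) = v,
      forall r s, p (r * s) = counit s *: p r + counit r *: p s
    & forall h r, p (ydact h r) = ydact h (p r)].
Proof.
have [p pP] := choice degree_one_part_ex.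
have pU r v : degree_one_part r v -> p r = v by apply: degree_one_part_uniq.
have lp : linear p.
  move=> c x y; apply: pU; have [t tP xE] := pP x; have [u uP yE] := pP y.
  apply: (@degree_one_partI _ (c * counit x + counit y) _ (c *: t + u)).
    by apply: deg_ge2_D => //; apply: deg_ge2_Z.
  rewrite {1}xE {1}yE linearP scalerDl -scalerA !scalerDr.
  by rewrite addrACA; congr (_ + _); rewrite addrACA.
have [q qE] := ex_linear lp.
exists q; split=> [v|r s|h r]; rewrite !qE; apply: pU.
- apply: (@degree_one_partI _ 0 _ 0); first exact: deg_ge2_0.
  by rewrite scale0r add0r addr0.
- have [t tP] := pP r; have [u uP] := pP s.
  set c := counit r; set d := counit s => sE rE.
  apply: (@degree_one_partI _ (c * d) _ (c *: u + (iota (p r) * iota (p s) + iota (p r) * u) +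
    t * s)).
    apply: deg_ge2_D; last exact: deg_ge2_mull.
    apply: deg_ge2_D; first exact: deg_ge2_Z.
    by apply: deg_ge2_D; [exact: deg_ge2_iota|exact: deg_ge2_mulr].
  rewrite {1}rE !mulrDl -scalerAl mul1r {1 2}sE !mulrDr -scalerAr mulr1 !scalerDr scalerA.
  rewrite linearD !linearZ /= !addrA; congr (_ + _); rewrite -!addrA; congr (_ + _).
  by rewrite [RHS]addrCA; congr (_ + _); rewrite addrCA.
- have [t tP rE] := pP r.
  apply: (@degree_one_partI _ (counit r * counit h) _ (ydact h t)).
    exact: deg_ge2_act.
  rewrite {1}rE !(linD (lin_bilr ydact h (@lin_id _ _))) (linZ (lin_bilr ydact h (@lin_id _ _))).
  by rewrite ydact_one scalerA (iota_ydact pnR).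
Qed.
End DegreeOne.

(** * Generators of the bosonization *)

Section BosonRules.
Variables (k : fieldType) (H : hopfAlgType k) (R : braidedBialgType H).

Lemma boson_mulE (a b : R) (h l : H) : op_mul (boson R) (a \ox h) (b \ox l) =
  \sw_(h1, h2 <- comul h) ((a * ydact h1 b) \ox (h2 * l)).
Proof. exact: (@smash_mulE k H R (hopf_ops H) (braided_ops R) ydact ydcoact). Qed.

Lemma boson_counitE (a : R) (h : H) : op_counit (boson R) (a \ox h) = counit a * counit h.
Proof. exact: (@smash_counitE k H R (hopf_ops H) (braided_ops R) ydact ydcoact). Qed.

Lemma sw_boson_comul (U : lmodType k) (F : R \otimes H -> R \otimes H -> U) a h : bilin F ->
  sweedler (op_comul (boson R) (a \ox h)) F =
  \sw_(a1, a2 <- comul a) \sw_(h1, h2 <- comul h) \sw_(g, c <- ydcoact a2)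
    F (a1 \ox (g * h1 : H)) (c \ox h2).
Proof. exact: (@sw_smash_comul k H R (hopf_ops H) (braided_ops R) ydact ydcoact). Qed.
End BosonRules.

Section Generators.
Variables (k : fieldType) (H : hopfAlgType k) (V : ydModType H) (R : preNichols V).
Local Notation iota := (@pn_in k H V R).
Let pnR := @pn_spec k H V R.

Lemma comul_iota v : comul (iota v) = iota v \ox 1 + 1 \ox iota v.
Proof.
have [s E sP] : in_span (fun a b : R => exists i j,
    [/\ (i + j = 1)%N, a \in pn_gr (p := R) i & b \in pn_gr (p := R) j]) (comul (iota v)).
  by apply: (gr_comul pnR); apply/(gr_one pnR); exists v.
have [u [w uwE]] : exists u w, comul (iota v) = iota u \ox 1 + 1 \ox iota w.
  rewrite E; elim: s {E} sP => [|p s IH] sP.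
    by exists 0, 0; rewrite big_nil linear0 (lin0 (pure_linl _)) (lin0 (pure_linr _)) addr0.
  have [q qs|u [w IHE]] := IH; first by apply: sP; rewrite inE qs orbT.
  rewrite big_cons IHE; have [|i [j [ij pi pj]]] := sP p; first by rewrite inE eqxx.
  move: i j ij pi pj => [|[|i]] [|[|j]] // _.
    move=> /(gr_zero pnR)[c ->] /(gr_one pnR)[w' ->].
    exists u, (c *: w' + w); rewrite (linZ (pure_linl _)) -(linZ (pure_linr _)).
    by rewrite linearP /= (linD (pure_linr _)) addrCA.
  move=> /(gr_one pnR)[u' ->] /(gr_zero pnR)[c ->].
  exists (c *: u' + u), w; rewrite (linZ (pure_linr _)) -(linZ (pure_linl _)).
  by rewrite linearP /= (linD (pure_linl _)) addrA.
have wE : iota w = iota v.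
  rewrite -[RHS]counitl uwE sw_add; last bil.
  rewrite sweedler_pure; last bil.
  rewrite sweedler_pure; last bil.
  by rewrite counit_iota scale0r add0r braided_counit1 scale1r.
have uE : iota u = iota v.
  rewrite -[RHS]counitr uwE sw_add; last bil.
  rewrite sweedler_pure; last bil.
  rewrite sweedler_pure; last bil.
  by rewrite counit_iota scale0r addr0 braided_counit1 scale1r.
by rewrite uwE uE wE.
Qed.

Lemma sw_comul_in_hopf (U : lmodType k) (F : R \otimes H -> R \otimes H -> U) a : bilin F ->
  sweedler (op_comul (boson R) (in_hopf R a)) F =
  \sw_(a1, a2 <- comul a) F (in_hopf R a1) (in_hopf R a2).
Proof.
move=> bF; have [F1 F2] := bF; rewrite sw_boson_comul // braided_comul1 sweedler_pure; last bil.
apply: eq_sw => a1 a2; rewrite ydcoact_one sweedler_pure; last bil.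
by rewrite mul1r.
Qed.

Lemma sw_comul_in_mod (U : lmodType k) (F : R \otimes H -> R \otimes H -> U) v : bilin F ->
  sweedler (op_comul (boson R) (in_mod R v)) F =
  F (in_mod R v) (in_hopf R 1) + \sw_(g, u <- ydcoact v) F (in_hopf R g) (in_mod R u).
Proof.
move=> bF; have [F1 F2] := bF; rewrite sw_boson_comul // comul_iota sw_add; last bil.
rewrite !sweedler_pure; [|bil..].
rewrite sw_comul1; last bil.
rewrite sw_comul1; last bil.
rewrite ydcoact_one sweedler_pure; last bil.
rewrite mulr1 (iota_ydcoact pnR) sw_sw; last bil.
congr (_ + _); apply: eq_sw => g u; rewrite sweedler_pure; last bil.
by rewrite mulr1.
Qed.

Definition boson_gen (c : H + V) : R \otimes H :=
  match c with inl a => in_hopf R a | inr v => in_mod R v end.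

Definition boson_cop (c : H + V) : seq ((H + V) * (H + V)) :=
  match c with
  | inl a => [seq (inl p.1, inl p.2) | p <- repr (comul a)]
  | inr v => (inr v, inl 1) :: [seq (inl p.1, inr p.2) | p <- repr (ydcoact v)]
  end.

Lemma big_cop_hopf (U : lmodType k) (F : H + V -> H + V -> U) a :
  \sum_(p <- boson_cop (inl a)) F p.1 p.2 = \sw_(a1, a2 <- comul a) F (inl a1) (inl a2).
Proof. by rewrite /= big_map. Qed.

Lemma big_cop_mod (U : lmodType k) (F : H + V -> H + V -> U) v :
  \sum_(p <- boson_cop (inr v)) F p.1 p.2 =
  F (inr v) (inl 1) + \sw_(g, u <- ydcoact v) F (inl g) (inr u).
Proof. by rewrite /= big_cons big_map. Qed.

Lemma boson_is_cop : is_cop (boson R) boson_gen boson_cop.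
Proof.
case=> [a|v]; rewrite -[LHS]sweedler_id; [rewrite sw_comul_in_hopf|rewrite sw_comul_in_mod].
- by rewrite (big_cop_hopf (fun c d => boson_gen c \ox boson_gen d)).
- by split=> ?; [apply: pure_linl|apply: pure_linr].
- by rewrite (big_cop_mod (fun c d => boson_gen c \ox boson_gen d)).
- by split=> ?; [apply: pure_linl|apply: pure_linr].
Qed.

Lemma boson_generates : generates (boson R) boson_gen.
Proof.
move=> P P0 P1 Pg PD PM.
have PH a : P (1 \ox a) by apply: (Pg (inl a)).
have mulR (r s : R) : op_mul (boson R) (r \ox 1) (s \ox 1) = (r * s) \ox 1.
  by rewrite boson_mulE sw_comul1 ?ydact1 ?mulr1 //; bil.
have mulZ c (r : R) : op_mul (boson R) (1 \ox (c *: 1)) (r \ox 1) = (c *: r) \ox 1.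
  rewrite (linZ (pure_linr _)) linearZl_LR boson_mulE sw_comul1; last bil.
  by rewrite ydact1 !mul1r (linZ (pure_linl _)).
have PR r : P (r \ox 1).
  suff /asboolP : r \in [pred r : R | `[< P (r \ox 1) >]] by [].
  apply: (gr_gen pnR) => [|s /(gr_one pnR)[v ->]]; last first.
    by apply/asboolP; apply: (Pg (inr v)).
  split=> [|c r' s /asboolP Pr /asboolP Ps|r' s /asboolP Pr /asboolP Ps].
  - exact/asboolP.
  - apply/asboolP; rewrite (linD (pure_linl _)) -mulZ.
    by apply: PD => //; apply: PM.
  - by apply/asboolP; rewrite -mulR; apply: PM.
move=> t; rewrite -(sweedler_id t); apply: big_ind => // p _.
suff -> : p.1 \ox p.2 = op_mul (boson R) (p.1 \ox 1) (1 \ox p.2) by apply: PM.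
rewrite boson_mulE sw_comul1; last bil.
by rewrite ydact1 mulr1 mul1r.
Qed.
End Generators.

(** * The pairing tau and the form lambda *)

Section Tau.
Variables (k : fieldType) (J K : hopfAlgType k) (tau : {scalar J \otimes K}).
Hypothesis tau_skew : skew_pairing (hopf_ops J) (hopf_ops K) tau.
Local Notation S := antipode.

Lemma tauMl (a b : J) (x : K) : tau ((a * b) \ox x) =
  \sw_(x1, x2 <- comul x) (tau (a \ox x1) * tau (b \ox x2) : k^o).
Proof. exact: (skew_mull tau_skew). Qed.

Lemma tauMr (a : J) (x y : K) : tau (a \ox (x * y)) =
  \sw_(a1, a2 <- comul a) (tau (a1 \ox y) * tau (a2 \ox x) : k^o).
Proof. exact: (skew_mulr tau_skew). Qed.

Lemma tau1l (x : K) : tau (1 \ox x) = counit x.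
Proof. exact: (skew_onel tau_skew). Qed.

Lemma tau1r (a : J) : tau (a \ox 1) = counit a.
Proof. exact: (skew_oner tau_skew). Qed.

Lemma tau_antipodeMl (a b : J) (x : K) : tau (S (a * b) \ox x) =
  \sw_(x1, x2 <- comul x) (tau (S b \ox x1) * tau (S a \ox x2) : k^o).
Proof. by rewrite antipodeM tauMl. Qed.

Lemma tau_antipodeMr (a : J) (x y : K) : tau (S a \ox (x * y)) =
  \sw_(a1, a2 <- comul a) (tau (S a1 \ox x) * tau (S a2 \ox y) : k^o).
Proof.
rewrite tauMr (sw_comul_antipode (F := fun p q => tau (p \ox y) * tau (q \ox x) : k^o)); last bil.
by sweq a1 a2; rewrite mulrC.
Qed.

Lemma tau_antipode_inv (a : J) (x : K) :
  \sw_(a1, a2 <- comul a) \sw_(x1, x2 <- comul x)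
    (tau (a1 \ox x1) * tau (S a2 \ox x2) : k^o) = counit a * counit x.
Proof.
under eq_sw => a1 a2 do rewrite -tauMl.
rewrite (sw_antipoder (F := fun b => tau (b \ox x) : k^o)); last by mlin.
by rewrite tau1l.
Qed.

Lemma tau_antipode_invl (a : J) (x : K) :
  \sw_(a1, a2 <- comul a) \sw_(x1, x2 <- comul x)
    (tau (S a1 \ox x1) * tau (a2 \ox x2) : k^o) = counit a * counit x.
Proof.
under eq_sw => a1 a2 do rewrite -tauMl.
rewrite (sw_antipodel (F := fun b => tau (b \ox x) : k^o)); last by mlin.
by rewrite tau1l.
Qed.

Variables (V : ydModType J) (W : ydModType K) (lambda : {scalar W \otimes V}).
Hypothesis lambda_act_l : forall (x : K) (w : W) (v : V),
    lambda (ydact x w \ox v) =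
      \sw_(vm1, v0 <- ydcoact v)
        (tau (vm1 \ox antipode x) * lambda (w \ox v0) : k^o).
Hypothesis lambda_act_r : forall (a : J) (w : W) (v : V),
    lambda (w \ox ydact a v) =
      \sw_(wm1, w0 <- ydcoact w)
        (tau (a \ox wm1) * lambda (w0 \ox v) : k^o).

(* The value at (v, w) of the inverse pairing: it is T (S v, w) for the antipode
   S v = - S (v_{-1}) v_0 of R # J. *)
Definition conv_lambda (w : W) (v : V) : k^o :=
  \sw_(g, u <- ydcoact v) \sw_(h, z <- ydcoact w)
    (tau (S g \ox h) * lambda (z \ox u) : k^o).

Lemma conv_lambda_linl v : linear (fun w => conv_lambda w v).
Proof. by rewrite /conv_lambda; mlin. Qed.

Lemma conv_lambda_linr w : linear (conv_lambda w).
Proof. by rewrite /conv_lambda; mlin. Qed.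

Lemma conv_lambdaK w v :
  \sw_(g, u <- ydcoact v) \sw_(h, z <- ydcoact w)
    (tau (g \ox h) * conv_lambda z u : k^o) = lambda (w \ox v).
Proof.
transitivity (\sw_(g, v' <- ydcoact v) \sw_(g', u <- ydcoact v')
  \sw_(h, z' <- ydcoact w) \sw_(h', z <- ydcoact z')
   (tau (g \ox h) * tau (S g' \ox h') * lambda (z \ox u) : k^o)).
  sweq g v'; rewrite /conv_lambda; under eq_sw => h z do rewrite sw_mulr.
  by rewrite sw_exch; sweq g' u; sweq h z; rewrite sw_mulr; sweq h' z'; rewrite mulrA.
rewrite -(sw_ydcoactA (F := fun g g' u => \sw_(h, z' <- ydcoact w) \sw_(h', z <- ydcoact z')
   (tau (g \ox h) * tau (S g' \ox h') * lambda (z \ox u) : k^o))); [|move=> ? ?; mlin..].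
transitivity (\sw_(g, u <- ydcoact v) (counit g * (\sw_(h, z <- ydcoact w) (counit h * lambda
  (z \ox u) : k^o)) : k^o)).
  sweq y u; rewrite sw_mulr.
  under eq_sw => g g'.
    rewrite -(sw_ydcoactA (F := fun h h' z => tau (g \ox h) * tau (S g' \ox h') * lambda (z \ox
      u) : k^o));
      [|move=> ? ?; mlin..].
  over.
  rewrite sw_exch; sweq x z; rewrite mulrA -tau_antipode_inv sw_mull; sweq g g'.
  by rewrite sw_mull.
rewrite (sw_ydcoact1 (F := fun u => \sw_(h, z <- ydcoact w) (counit h * lambda (z \ox u) :
  k^o))); last by mlin.
by rewrite (sw_ydcoact1 (F := fun z => lambda (z \ox v) : k^o)) //; mlin.
Qed.

Lemma conv_lambda_act_r (a : J) w v :
  \sw_(a1, a2 <- comul a) \sw_(h, z <- ydcoact w)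
    (tau (S a2 \ox h) * conv_lambda z (ydact a1 v) : k^o) = counit a * conv_lambda w v.
Proof.
pose Fn (x : J) u : k^o := \sw_(h, z <- ydcoact w) (tau (S x \ox h) * lambda (z \ox u) : k^o).
transitivity (\sw_(a1, a2 <- comul a) \sw_(g, u <- ydcoact (ydact a1 v)) Fn (g * a2) u).
  sweq a1 a2; rewrite /conv_lambda; under eq_sw => h z do rewrite sw_mulr.
  rewrite sw_exch; sweq g u; rewrite /Fn.
  under eq_sw => h z do rewrite sw_mulr.
  rewrite -(sw_ydcoactA (F := fun h h' z => tau (S a2 \ox h) * (tau (S g \ox h') * lambda (z
    \ox u)) : k^o));
    [|move=> ? ?; mlin..].
  by sweq h z; rewrite tau_antipodeMl sw_mull; sweq h1 h2; rewrite mulrA.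
rewrite sw_ydcoact_act_mul; last by rewrite /Fn; bil.
rewrite sw_exch /conv_lambda sw_mulr; sweq g u.
transitivity (\sw_(y, z <- ydcoact w) \sw_(h1, y' <- comul y) (counit y' * (tau (S g \ox h1) *
   (counit a * lambda (z \ox u))) : k^o)); last first.
  rewrite sw_mulr; sweq y z.
  rewrite (sw_counitr (F := fun h1 => tau (S g \ox h1) * (counit a * lambda (z \ox u)) : k^o));
    last by mlin.
  by rewrite mulrCA.
transitivity (\sw_(y, z <- ydcoact w) \sw_(h1, y' <- comul y) \sw_(a1, a2 <- comul a)
   \sw_(h2, h' <- comul y') (tau (S g \ox h1) * (tau (S a1 \ox h2) * tau (a2 \ox h')) * lambda
     (z \ox u) : k^o)).
  rewrite /Fn.
  transitivity (\sw_(a1, a2 <- comul a) \sw_(h, z' <- ydcoact w) \sw_(h', z <- ydcoact z')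
    \sw_(h1, h2 <- comul h) (tau (S g \ox h1) * (tau (S a1 \ox h2) * tau (a2 \ox h')) * lambda
      (z \ox u) : k^o)).
    sweq a1 a2; sweq h z'; rewrite lambda_act_r sw_mulr; sweq h' z.
    by rewrite tau_antipodeMl sw_mull; sweq h1 h2; rewrite !mulrA.
  under [RHS]eq_sw => y z do rewrite sw_exch.
  rewrite [RHS]sw_exch; sweq a1 a2.
  rewrite -(sw_ydcoactA (F := fun h h' z => \sw_(h1, h2 <- comul h)
    (tau (S g \ox h1) * (tau (S a1 \ox h2) * tau (a2 \ox h')) * lambda (z \ox u) : k^o)));
      [|move=> ? ?; mlin..].
  sweq y z.
  by rewrite (sw_comulA (F := fun h1 h2 h' =>
    (tau (S g \ox h1) * (tau (S a1 \ox h2) * tau (a2 \ox h')) * lambda (z \ox u) : k^o))) //;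
      move=> ? ?; mlin.
sweq y z; sweq h1 y'.
transitivity (tau (S g \ox h1) * (counit a * counit y') * lambda (z \ox u)); last by ring.
rewrite -tau_antipode_invl sw_mulr sw_mull; sweq a1 a2.
by rewrite sw_mulr sw_mull.
Qed.

Lemma conv_lambda_act_l (x : K) w v :
  conv_lambda (ydact x w) v =
  \sw_(b, v0 <- ydcoact v) (tau (S b \ox x) * conv_lambda w v0 : k^o).
Proof.
transitivity (\sw_(y, u <- ydcoact v) \sw_(g, z <- ydcoact w) (tau (S y \ox (x * g)) * lambda
  (z \ox u) : k^o)); last first.
  rewrite /conv_lambda; under [RHS]eq_sw => b v0 do rewrite sw_mulr.
  rewrite -(sw_ydcoactA (F := fun b g u => tau (S b \ox x) * (\sw_(h, z <- ydcoact w)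
    (tau (S g \ox h) * lambda (z \ox u) : k^o)) : k^o)); [|move=> ? ?; mlin..].
  sweq y u; under eq_sw => g z do rewrite tau_antipodeMr sw_mull.
  by rewrite sw_exch; sweq b g; rewrite sw_mulr; sweq h z; rewrite mulrA.
transitivity (\sw_(y, u <- ydcoact v) \sw_(b, c <- comul y) \sw_(x1, xr <- comul x) \sw_(x2, x3
  <- comul xr)
  \sw_(g, z <- ydcoact w) \sw_(b', b3 <- comul b)
  (tau (S b' \ox (x1 * g)) * (tau (S b3 \ox S x3) * tau (c \ox S x2)) * lambda (z \ox u) : k^o)).
  rewrite (sw_ydcoactA (F := fun b c u =>  \sw_(x1, xr <- comul x) \sw_(x2, x3 <- comul xr)
  \sw_(g, z <- ydcoact w) \sw_(b', b3 <- comul b)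
  (tau (S b' \ox (x1 * g)) * (tau (S b3 \ox S x3) * tau (c \ox S x2)) * lambda (z \ox u) : k^o)));
    [|move=> ? ?; mlin..].
  rewrite /conv_lambda; sweq b v0; rewrite sw_ydcoact_act; last bil.
  rewrite [RHS]sw_exch; sweq x1 xr; rewrite [RHS]sw_exch; sweq x2 x3.
  rewrite [RHS]sw_exch; sweq g z; rewrite lambda_act_l sw_mulr; sweq c u.
  by rewrite tau_antipodeMr sw_mull; sweq b' b3; rewrite !mulrA.
sweq y u; rewrite sw_exch.
transitivity (\sw_(x1, xr <- comul x) (counit xr * (\sw_(b', y' <- comul y) (counit y' * (
   \sw_(g, z <- ydcoact w) (tau (S b' \ox (x1 * g)) * lambda (z \ox u) : k^o)) : k^o)) : k^o));
     last first.
  rewrite (sw_counitr (F := fun x1 => \sw_(b', y' <- comul y) (counit y' * (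
   \sw_(g, z <- ydcoact w) (tau (S b' \ox (x1 * g)) * lambda (z \ox u) : k^o)) : k^o))); last
     by mlin.
  by rewrite (sw_counitr (F := fun b' => \sw_(g, z <- ydcoact w) (tau (S b' \ox (x * g)) *
    lambda (z \ox u) : k^o))) //; mlin.
sweq x1 xr; rewrite sw_exch2.
rewrite sw_mulr; under [RHS]eq_sw => b' y' do rewrite !sw_mulr.
rewrite [RHS]sw_exch; sweq g z.
under eq_sw => b c do rewrite sw_exch.
rewrite (sw_comulA (F := fun b' b3 c => \sw_(x2, x3 <- comul xr) (tau (S b' \ox (x1 * g)) *
  (tau (S b3 \ox S x3) * tau (c \ox S x2)) * lambda (z \ox u) : k^o))); [|move=> ? ?; mlin..].
sweq b' y'.
transitivity (tau (S b' \ox (x1 * g)) * (counit y' * counit (S xr)) * lambda (z \ox u)); last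
  first.
  by rewrite counit_antipode; ring.
rewrite -tau_antipode_invl sw_mulr sw_mull; sweq b3 c.
rewrite (sw_comul_antipode (F := fun p q => tau (S b3 \ox p) * tau (c \ox q) : k^o)); last bil.
by rewrite sw_mulr sw_mull.
Qed.
End Tau.

Lemma ex_pairings (k : fieldType) (A B : lmodType k) (D : Type) (f : D -> A -> B -> k^o) :
  (forall d, bilin (f d)) ->
  exists T : D -> {scalar A \otimes B}, forall d a b, T d (a \ox b) = f d a b.
Proof. by move=> bf; have [T TP] := choice (fun d => ex_pairing (bf d)); exists T. Qed.

Section Functionals.
Variables (k : fieldType) (J K : hopfAlgType k).
Variables (V : ydModType J) (W : ydModType K).
Variables (R : preNichols V) (S : preNichols W).
Variables (tau : {scalar J \otimes K}) (lambda : {scalar W \otimes V}).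
Hypothesis tau_skew : skew_pairing (hopf_ops J) (hopf_ops K) tau.
Hypothesis lambda_act_l : forall (x : K) (w : W) (v : V),
    lambda (ydact x w \ox v) =
      \sw_(vm1, v0 <- ydcoact v)
        (tau (vm1 \ox antipode x) * lambda (w \ox v0) : k^o).
Hypothesis lambda_act_r : forall (a : J) (w : W) (v : V),
    lambda (w \ox ydact a v) =
      \sw_(wm1, w0 <- ydcoact w)
        (tau (a \ox wm1) * lambda (w0 \ox v) : k^o).
Variables (pR : {linear R -> V}) (pS : {linear S -> W}).
Hypothesis pR_mul : forall r s, pR (r * s) = counit s *: pR r + counit r *: pR s.
Hypothesis pS_mul : forall r s, pS (r * s) = counit s *: pS r + counit r *: pS s.
Hypothesis pR_act : forall h r, pR (ydact h r) = ydact h (pR r).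
Hypothesis pS_act : forall h r, pS (ydact h r) = ydact h (pS r).

Local Notation RJ := (R \otimes J).
Local Notation SK := (S \otimes K).
Local Notation mu := (conv_lambda tau lambda).

(* Pairing r a with a generator d, resp. c with s x; these values are forced by
   the coproducts of w and v, which are u (x) 1 + u_{-1} (x) u_0. *)
Definition phi_fun (d : K + W) (r : R) (a : J) : k^o :=
  match d with
  | inl x => counit r * tau (a \ox x)
  | inr w => - (lambda (w \ox pR r) * counit a)
  end.

Definition psi_fun (c : J + V) (s : S) (x : K) : k^o :=
  match c with
  | inl a => counit s * tau (a \ox x)
  | inr v => - \sw_(g, u <- ydcoact v) (tau (g \ox x) * lambda (pS s \ox u) : k^o)
  end.

Definition phi_inv_fun (d : K + W) (r : R) (a : J) : k^o :=
  match d with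
  | inl x => counit r * tau (antipode a \ox x)
  | inr w => \sw_(h, z <- ydcoact w) (tau (antipode a \ox h) * mu z (pR r) : k^o)
  end.

Definition psi_inv_fun (c : J + V) (s : S) (x : K) : k^o :=
  match c with
  | inl a => counit s * tau (antipode a \ox x)
  | inr v => mu (pS s) v * counit x
  end.

Lemma phi_fun_bilin d : bilin (phi_fun d).
Proof. by case: d => [x|w]; rewrite /phi_fun; bil. Qed.

Lemma psi_fun_bilin c : bilin (psi_fun c).
Proof. by case: c => [a|v]; rewrite /psi_fun; bil. Qed.

Lemma phi_inv_fun_bilin d : bilin (phi_inv_fun d).
Proof. by case: d => [x|w]; rewrite /phi_inv_fun /conv_lambda; bil. Qed.

Lemma psi_inv_fun_bilin c : bilin (psi_inv_fun c).
Proof. by case: c => [a|v]; rewrite /psi_inv_fun /conv_lambda; bil. Qed.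

Lemma lambda_mul_r w r a r' : lambda (w \ox pR (r * ydact a r')) =
  counit a * counit r' * lambda (w \ox pR r) + counit r * lambda (w \ox ydact a (pR r')).
Proof.
rewrite pR_mul pR_act counit_ydact (linD (pure_linr _)) !(linZ (pure_linr _)).
by rewrite linearD !linearZ.
Qed.

Lemma lambda_mul_l v s x s' : lambda (pS (s * ydact x s') \ox v) =
  counit x * counit s' * lambda (pS s \ox v) + counit s * lambda (ydact x (pS s') \ox v).
Proof.
rewrite pS_mul pS_act counit_ydact (linD (pure_linl _)) !(linZ (pure_linl _)).
by rewrite linearD !linearZ.
Qed.

Lemma mu_mul_r w r a r' : mu w (pR (r * ydact a r')) =
  counit a * counit r' * mu w (pR r) + counit r * mu w (ydact a (pR r')).
Proof.
have lm := conv_lambda_linr tau lambda w.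
by rewrite pR_mul pR_act counit_ydact (linD lm) !(linZ lm).
Qed.

Lemma mu_mul_l v s x s' : mu (pS (s * ydact x s')) v =
  counit x * counit s' * mu (pS s) v + counit s * mu (ydact x (pS s')) v.
Proof.
have lm := conv_lambda_linl tau lambda v.
by rewrite pS_mul pS_act counit_ydact (linD lm) !(linZ lm).
Qed.

Lemma pR1 : pR 1 = 0.
Proof.
by have := pR_mul 1 1; rewrite mulr1 braided_counit1 scale1r -[X in X = _]addr0 => /addrI.
Qed.

Lemma pS1 : pS 1 = 0.
Proof.
by have := pS_mul 1 1; rewrite mulr1 braided_counit1 scale1r -[X in X = _]addr0 => /addrI.
Qed.

Section Phi.
Variables (phi : K + W -> {scalar RJ}).
Hypothesis phiE : forall d a b, phi d (a \ox b) = phi_fun d a b.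

Lemma phiM d a b : phi d (op_mul (boson R) a b) =
  \sum_(q <- boson_cop d) phi q.1 a * phi q.2 b.
Proof.
case: d => [x|w].
  rewrite (big_cop_hopf (fun c d => phi c a * phi d b : k^o)).
  move: a; apply: (tensor_ext (U := k^o)); [mlin|mlin|move=> r a].
  move: b; apply: (tensor_ext (U := k^o)); [mlin|mlin|move=> r' a'].
  rewrite boson_mulE (sw_lin (g := (phi (inl x) : _ -> k^o))); last by mlin.
  transitivity (\sw_(a1, a2 <- comul a) (counit a1 * (counit r * counit r' * tau ((a2 * a') \ox
    x)) : k^o)).
    sweq a1 a2; rewrite phiE /= braided_counitM counit_ydact; ring.
  rewrite (sw_counitl (F := fun a2 => counit r * counit r' * tau ((a2 * a') \ox x) : k^o));
    last by mlin.
  rewrite (tauMl tau_skew) sw_mulr; sweq x1 x2; rewrite !phiE /=; ring.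
rewrite (big_cop_mod (fun c d => phi c a * phi d b : k^o)).
move: a; apply: (tensor_ext (U := k^o)); [mlin|mlin|move=> r a].
move: b; apply: (tensor_ext (U := k^o)); [mlin|mlin|move=> r' a'].
rewrite boson_mulE (sw_lin (g := (phi (inr w) : _ -> k^o))); last by mlin.
transitivity (\sw_(a1, a2 <- comul a) (counit a2 * (- (lambda (w \ox pR (r * ydact a1 r')) *
  counit a')) : k^o)).
  sweq a1 a2; rewrite phiE /= counitM; ring.
rewrite (sw_counitr (F := fun a1 => (- (lambda (w \ox pR (r * ydact a1 r')) * counit a') :
  k^o))); last by mlin.
rewrite lambda_mul_r lambda_act_r !phiE /= (tau1r tau_skew) mulrDl opprD; congr (_ + _); first
  by ring.
rewrite sw_mulr sw_mull (sw_lin (g := fun x : k^o => - x)); last by mlin.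
by sweq h z; rewrite !phiE /=; ring.
Qed.

Lemma phi1 d : phi d (op_one (boson R)) = op_counit (boson S) (boson_gen S d).
Proof.
rewrite /= phiE; case: d => [x|w].
  by rewrite /= /in_hopf boson_counitE !braided_counit1 !mul1r (tau1l tau_skew).
by rewrite /= /in_mod boson_counitE counit_iota pR1 (lin0 (pure_linr _)) linear0 !mul0r oppr0.
Qed.
End Phi.

Section Psi.
Variables (psi : J + V -> {scalar SK}).
Hypothesis psiE : forall c s x, psi c (s \ox x) = psi_fun c s x.

Lemma psiM c x y : psi c (op_mul (boson S) x y) =
  \sum_(p <- boson_cop c) psi p.1 y * psi p.2 x.
Proof.
case: c => [a|v].
  rewrite (big_cop_hopf (fun c d => psi c y * psi d x : k^o)).
  move: x; apply: (tensor_ext (U := k^o)); [mlin|mlin|move=> s x].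
  move: y; apply: (tensor_ext (U := k^o)); [mlin|mlin|move=> s' x'].
  rewrite boson_mulE (sw_lin (g := (psi (inl a) : _ -> k^o))); last by mlin.
  transitivity (\sw_(x1, x2 <- comul x) (counit x1 * (counit s * counit s' * tau (a \ox (x2 *
    x'))) : k^o)).
    sweq x1 x2; rewrite psiE /= braided_counitM counit_ydact; ring.
  rewrite (sw_counitl (F := fun x2 => counit s * counit s' * tau (a \ox (x2 * x')) : k^o));
    last by mlin.
  rewrite (tauMr tau_skew) sw_mulr; sweq a1 a2; rewrite !psiE /=; ring.
rewrite (big_cop_mod (fun c d => psi c y * psi d x : k^o)).
move: x; apply: (tensor_ext (U := k^o)); [mlin|mlin|move=> s x].
move: y; apply: (tensor_ext (U := k^o)); [mlin|mlin|move=> s' x'].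
rewrite boson_mulE (sw_lin (g := (psi (inr v) : _ -> k^o))); last by mlin.
transitivity (- (\sw_(x1, x2 <- comul x) (counit x1 * (\sw_(g, u <- ydcoact v)
    (tau (g \ox (x2 * x')) * counit s' * lambda (pS s \ox u) : k^o)) : k^o)) -
  \sw_(x1, x2 <- comul x) \sw_(g, u <- ydcoact v)
     (counit s * (tau (g \ox (x2 * x')) * lambda (ydact x1 (pS s') \ox u)) : k^o)).
  rewrite -opprD -sw_split (sw_lin (g := fun x : k^o => - x)); last by mlin.
  sweq x1 x2; rewrite psiE /= sw_mulr -sw_split; congr (- _); sweq g u.
  by rewrite lambda_mul_l; ring.
rewrite (sw_counitl (F := fun x2 => (\sw_(g, u <- ydcoact v)
    (tau (g \ox (x2 * x')) * counit s' * lambda (pS s \ox u) : k^o)))); last by mlin.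
rewrite [RHS]addrC; congr (_ + _).
  under [in LHS]eq_sw => g u do rewrite (tauMr tau_skew) !sw_mull.
  rewrite (sw_ydcoactA (F := fun g g' u => tau (g \ox x') * tau (g' \ox x) * counit s' * lambda
    (pS s \ox u) : k^o));
    [|move=> ? ?; mlin..].
  rewrite (sw_lin (g := fun x : k^o => - x)); last by mlin.
  sweq g u; rewrite !psiE /= mulrN sw_mulr; congr (- _); sweq g' z; ring.
rewrite !psiE /= (tau1l tau_skew) mulNr; congr (- _).
transitivity (\sw_(y, u <- ydcoact v) \sw_(x1, x2 <- comul x)
   (counit s * tau (y \ox (antipode x1 * x2 * x')) * lambda (pS s' \ox u) : k^o)).
  rewrite [LHS]sw_exch.
  transitivity (\sw_(g, u <- ydcoact v) \sw_(g', z <- ydcoact u) \sw_(x1, x2 <- comul x)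
    (counit s * (tau (g \ox (x2 * x')) * tau (g' \ox antipode x1)) * lambda (pS s' \ox z) : k^o)).
    sweq g u; rewrite [RHS]sw_exch; sweq x1 x2; rewrite lambda_act_l !sw_mulr; sweq g' z; ring.
  rewrite -(sw_ydcoactA (F := fun g g' z => \sw_(x1, x2 <- comul x)
    (counit s * (tau (g \ox (x2 * x')) * tau (g' \ox antipode x1)) * lambda (pS s' \ox z) :
      k^o)));
    [|move=> ? ?; mlin..].
  sweq y u; rewrite sw_exch; sweq x1 x2.
  by rewrite -(mulrA (antipode x1)) (tauMr tau_skew) sw_mulr sw_mull.
rewrite sw_mull; sweq y u.
rewrite (sw_antipodel (F := fun z => counit s * tau (y \ox (z * x')) * lambda (pS s' \ox u) :
  k^o)); last by mlin.
by rewrite mul1r /GRing.scale /=; ring.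
Qed.

Lemma psi1 c : psi c (op_one (boson S)) = op_counit (boson R) (boson_gen R c).
Proof.
rewrite /= psiE; case: c => [a|v].
  by rewrite /= /in_hopf boson_counitE !braided_counit1 !mul1r (tau1r tau_skew).
rewrite /= /in_mod boson_counitE counit_iota pS1 mul0r.
under eq_sw => g u do rewrite (lin0 (pure_linl _)) linear0 mulr0.
by rewrite sw_0 oppr0.
Qed.
End Psi.

Section PhiInv.
Variables (phi : K + W -> {scalar RJ}).
Hypothesis phiE : forall d a b, phi d (a \ox b) = phi_inv_fun d a b.

Lemma phi_invM d a b : phi d (op_mul (opp_ops (boson R)) a b) =
  \sum_(q <- boson_cop d) phi q.1 a * phi q.2 b.
Proof.
have lmr := conv_lambda_linr tau lambda.
rewrite -[op_mul _ a b]/(op_mul (boson R) b a).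
case: d => [x|w].
  rewrite (big_cop_hopf (fun c d => phi c a * phi d b : k^o)).
  move: a; apply: (tensor_ext (U := k^o)); [mlin|mlin|move=> r' a'].
  move: b; apply: (tensor_ext (U := k^o)); [mlin|mlin|move=> r a].
  rewrite boson_mulE (sw_lin (g := (phi (inl x) : _ -> k^o))); last by mlin.
  transitivity (\sw_(a1, a2 <- comul a) (counit a1 * (counit r * counit r' * tau (antipode (a2
    * a') \ox x)) : k^o)).
    sweq a1 a2; rewrite phiE /= braided_counitM counit_ydact; ring.
  rewrite (sw_counitl (F := fun a2 => counit r * counit r' * tau (antipode (a2 * a') \ox x) :
    k^o)); last by mlin.
  rewrite (tau_antipodeMl tau_skew) sw_mulr; sweq x1 x2; rewrite !phiE /=; ring.
rewrite (big_cop_mod (fun c d => phi c a * phi d b : k^o)).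
move: a; apply: (tensor_ext (U := k^o)); [mlin|mlin|move=> r' a'].
move: b; apply: (tensor_ext (U := k^o)); [mlin|mlin|move=> r a].
rewrite boson_mulE (sw_lin (g := (phi (inr w) : _ -> k^o))); last by mlin.
transitivity ((\sw_(a1, a2 <- comul a) (counit a1 * (\sw_(h, z <- ydcoact w)
    (tau (antipode (a2 * a') \ox h) * counit r' * mu z (pR r) : k^o)) : k^o)) +
  \sw_(a1, a2 <- comul a) \sw_(h, z <- ydcoact w)
     (counit r * (tau (antipode (a2 * a') \ox h) * mu z (ydact a1 (pR r'))) : k^o)).
  rewrite -sw_split.
  sweq a1 a2; rewrite phiE /= sw_mulr -sw_split; sweq h z.
  by rewrite mu_mul_r; ring.
rewrite (sw_counitl (F := fun a2 => (\sw_(h, z <- ydcoact w)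
    (tau (antipode (a2 * a') \ox h) * counit r' * mu z (pR r) : k^o)))); last by mlin.
rewrite [RHS]addrC; congr (_ + _).
  have lml := conv_lambda_linl tau lambda.
  under [in LHS]eq_sw => h z do rewrite (tau_antipodeMl tau_skew) !sw_mull.
  rewrite (sw_ydcoactA (F := fun h h' z => tau (antipode a' \ox h) * tau (antipode a \ox h') *
    counit r' * mu z (pR r) : k^o));
    [|move=> ? ?; mlin..].
  sweq h z; rewrite !phiE /= sw_mulr; sweq h' z'; ring.
rewrite !phiE /= (tau1r tau_skew) counit_antipode.
have lml := conv_lambda_linl tau lambda.
transitivity (\sw_(h, z <- ydcoact w) (counit r * tau (antipode a' \ox h) *
   (\sw_(a1, a2 <- comul a) \sw_(h', z' <- ydcoact z)
     (tau (antipode a2 \ox h') * mu z' (ydact a1 (pR r')) : k^o)) : k^o)).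
  under [RHS]eq_sw => h z do rewrite sw_mulr.
  rewrite [RHS]sw_exch; sweq a1 a2.
  transitivity (\sw_(h, z <- ydcoact w) \sw_(h', z' <- ydcoact z)
     (counit r * tau (antipode a' \ox h) * (tau (antipode a2 \ox h') * mu z' (ydact a1 (pR
       r'))) : k^o)).
    rewrite -(sw_ydcoactA (F := fun h h' z' => counit r * tau (antipode a' \ox h) *
      (tau (antipode a2 \ox h') * mu z' (ydact a1 (pR r'))) : k^o)); [|move=> ? ?; mlin..].
    sweq h z; rewrite (tau_antipodeMl tau_skew) sw_mull sw_mulr; sweq h1 h2; ring.
  by sweq h z; rewrite sw_mulr.
rewrite sw_mull; sweq h z.
by rewrite (conv_lambda_act_r tau_skew lambda_act_r); ring.
Qed.

Lemma phi_inv1 d : phi d (op_one (boson R)) = op_counit (boson S) (boson_gen S d).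
Proof.
rewrite /= phiE; case: d => [x|w].
  by rewrite /= /in_hopf boson_counitE !braided_counit1 !mul1r antipode1 (tau1l tau_skew).
rewrite /= /in_mod boson_counitE counit_iota pR1 mul0r.
under eq_sw => h z do rewrite (lin0 (conv_lambda_linr _ _ _)) mulr0.
by rewrite sw_0.
Qed.
End PhiInv.

Section PsiInv.
Variables (psi : J + V -> {scalar SK}).
Hypothesis psiE : forall c s x, psi c (s \ox x) = psi_inv_fun c s x.

Lemma psi_invM c x y : psi c (op_mul (opp_ops (boson S)) x y) =
  \sum_(p <- boson_cop c) psi p.1 y * psi p.2 x.
Proof.
have lml := conv_lambda_linl tau lambda.
rewrite -[op_mul _ x y]/(op_mul (boson S) y x).
case: c => [a|v].
  rewrite (big_cop_hopf (fun c d => psi c y * psi d x : k^o)).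
  move: x; apply: (tensor_ext (U := k^o)); [mlin|mlin|move=> s' x'].
  move: y; apply: (tensor_ext (U := k^o)); [mlin|mlin|move=> s x].
  rewrite boson_mulE (sw_lin (g := (psi (inl a) : _ -> k^o))); last by mlin.
  transitivity (\sw_(x1, x2 <- comul x) (counit x1 * (counit s * counit s' * tau (antipode a
    \ox (x2 * x'))) : k^o)).
    sweq x1 x2; rewrite psiE /= braided_counitM counit_ydact; ring.
  rewrite (sw_counitl (F := fun x2 => counit s * counit s' * tau (antipode a \ox (x2 * x')) :
    k^o)); last by mlin.
  rewrite (tau_antipodeMr tau_skew) sw_mulr; sweq a1 a2; rewrite !psiE /=; ring.
rewrite (big_cop_mod (fun c d => psi c y * psi d x : k^o)).
move: x; apply: (tensor_ext (U := k^o)); [mlin|mlin|move=> s' x'].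
move: y; apply: (tensor_ext (U := k^o)); [mlin|mlin|move=> s x].
rewrite boson_mulE (sw_lin (g := (psi (inr v) : _ -> k^o))); last by mlin.
transitivity (\sw_(x1, x2 <- comul x) (counit x2 * (mu (pS (s * ydact x1 s')) v * counit x') :
  k^o)).
  sweq x1 x2; rewrite psiE /= counitM; ring.
rewrite (sw_counitr (F := fun x1 => (mu (pS (s * ydact x1 s')) v * counit x') : k^o)); last by
  mlin.
rewrite mu_mul_l (conv_lambda_act_l tau_skew lambda_act_l) !psiE /= antipode1 (tau1l tau_skew).
rewrite mulrDl; congr (_ + _); first by ring.
rewrite sw_mulr sw_mull; sweq g u; rewrite !psiE /=; ring.
Qed.

Lemma psi_inv1 c : psi c (op_one (boson S)) = op_counit (boson R) (boson_gen R c).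
Proof.
rewrite /= psiE; case: c => [a|v].
  by rewrite /= /in_hopf boson_counitE !braided_counit1 !mul1r (tau1r tau_skew) counit_antipode.
by rewrite /= /in_mod boson_counitE counit_iota pS1 (lin0 (conv_lambda_linl _ _ _)) !mul0r.
Qed.
End PsiInv.
End Functionals.

(** * The extended skew pairing *)

Section Table.
Variables (k : fieldType) (J K : hopfAlgType k).
Variables (V : ydModType J) (W : ydModType K).
Variables (R : preNichols V) (S : preNichols W).

Record gen_values (t : J -> K -> k^o) (l : W -> V -> k^o)
    (T : {scalar (R \otimes J) \otimes (S \otimes K)}) : Prop := GenValues {
  gen_hopf_hopf : forall a x, T (in_hopf R a \ox in_hopf S x) = t a x;
  gen_hopf_mod : forall a w, T (in_hopf R a \ox in_mod S w) = 0;
  gen_mod_hopf : forall v x, T (in_mod R v \ox in_hopf S x) = 0;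
  gen_mod_mod : forall v w, T (in_mod R v \ox in_mod S w) = l w v }.

Lemma pair_conv_gen_values t l t' l' P Q :
  gen_values t l P -> gen_values t' l' Q ->
  (forall a x, \sw_(a1, a2 <- comul a) \sw_(x1, x2 <- comul x)
      (t a1 x1 * t' a2 x2 : k^o) = counit a * counit x) ->
  t' 1 1 = 1 ->
  (forall v w, l w v + \sw_(g, u <- ydcoact v) \sw_(h, z <- ydcoact w)
     (t g h * l' z u : k^o) = 0) ->
  forall c d, pair_conv (boson R) (boson S) P Q (boson_gen R c) (boson_gen S d) =
     op_counit (boson R) (boson_gen R c) * op_counit (boson S) (boson_gen S d).
Proof.
move=> [P1 P2 P3 P4] [Q1 Q2 Q3 Q4] tt' t1 ll'; rewrite /pair_conv; case=> [a|v] [x|w] /=.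
- rewrite sw_comul_in_hopf; last bil.
  rewrite !boson_counitE !braided_counit1 !mul1r -tt'; sweq a1 a2.
  rewrite sw_comul_in_hopf; last bil.
  by sweq x1 x2; rewrite P1 Q1.
- rewrite sw_comul_in_hopf; last bil.
  rewrite [X in _ * X]boson_counitE counit_iota mul0r mulr0 -[RHS](sw_0 k^o (comul a)).
  sweq a1 a2; rewrite sw_comul_in_mod; last bil.
  rewrite P2 mul0r add0r -[RHS](sw_0 k^o (ydcoact w)).
  by sweq h z; rewrite Q2 mulr0.
- rewrite sw_comul_in_mod; last bil.
  rewrite [X in X * _]boson_counitE counit_iota !mul0r -[RHS]addr0; congr (_ + _).
    rewrite sw_comul_in_hopf; last bil.
    by rewrite -[RHS](sw_0 k^o (comul x)); sweq x1 x2; rewrite P3 mul0r.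
  rewrite -[RHS](sw_0 k^o (ydcoact v)); sweq g u.
  rewrite sw_comul_in_hopf; last bil.
  by rewrite -[RHS](sw_0 k^o (comul x)); sweq x1 x2; rewrite Q3 mulr0.
- rewrite sw_comul_in_mod; last bil.
  rewrite [X in X * _]boson_counitE counit_iota !mul0r -(ll' v w).
  congr (_ + _).
    rewrite sw_comul_in_mod; last bil.
    rewrite P4 Q1 t1 mulr1 -[RHS]addr0; congr (_ + _).
    by rewrite -[RHS](sw_0 k^o (ydcoact w)); sweq h z; rewrite P3 mul0r.
  sweq g u; rewrite sw_comul_in_mod; last bil.
  rewrite P2 mul0r add0r; sweq h z; by rewrite P1 Q4.
Qed.

Lemma sw_comul_in_mod3 (U : lmodType k) (F : R \otimes J -> R \otimes J -> R \otimes J -> U) v :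
  (forall y z, linear (fun x => F x y z)) -> (forall x z, linear (fun y => F x y z)) ->
  (forall x y, linear (F x y)) ->
  \sw_(a1, ar <- op_comul (boson R) (in_mod R v)) \sw_(a2, a3 <- op_comul (boson R) ar) F a1 a2
    a3 =
  F (in_mod R v) (in_hopf R 1) (in_hopf R 1)
  + \sw_(g, u <- ydcoact v) F (in_hopf R g) (in_mod R u) (in_hopf R 1)
  + \sw_(g, u <- ydcoact v) \sw_(g', u' <- ydcoact u) F (in_hopf R g) (in_hopf R g') (in_mod R
    u').
Proof.
move=> F1 F2 F3; rewrite sw_comul_in_mod; last bil.
rewrite sw_comul_in_hopf; last bil.
rewrite sw_comul1; last by rewrite /in_hopf; bil.
rewrite -addrA -sw_split; congr (_ + _); apply: eq_sw => g u.
by rewrite sw_comul_in_mod //; split.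
Qed.

Lemma sw_comul_in_hopf3 (U : lmodType k) (F : R \otimes J -> R \otimes J -> R \otimes J -> U) a :
  (forall y z, linear (fun x => F x y z)) -> (forall x z, linear (fun y => F x y z)) ->
  (forall x y, linear (F x y)) ->
  \sw_(a1, ar <- op_comul (boson R) (in_hopf R a)) \sw_(a2, a3 <- op_comul (boson R) ar) F a1
    a2 a3 =
  \sw_(a1, ar <- comul a) \sw_(a2, a3 <- comul ar) F (in_hopf R a1) (in_hopf R a2) (in_hopf R a3).
Proof.
move=> F1 F2 F3; rewrite sw_comul_in_hopf; last bil.
by apply: eq_sw => a1 ar; rewrite sw_comul_in_hopf //; split.
Qed.
End Table.

Section Main.
Variables (k : fieldType) (J K : hopfAlgType k).
Variables (V : ydModType J) (W : ydModType K).
Variables (R : preNichols V) (S : preNichols W).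
Variables (tau : {scalar J \otimes K}) (lambda : {scalar W \otimes V}).
Hypothesis tau_skew : skew_pairing (hopf_ops J) (hopf_ops K) tau.
Hypothesis lambda_act_l : forall (x : K) (w : W) (v : V),
    lambda (ydact x w \ox v) =
      \sw_(vm1, v0 <- ydcoact v)
        (tau (vm1 \ox antipode x) * lambda (w \ox v0) : k^o).
Hypothesis lambda_act_r : forall (a : J) (w : W) (v : V),
    lambda (w \ox ydact a v) =
      \sw_(wm1, w0 <- ydcoact w)
        (tau (a \ox wm1) * lambda (w0 \ox v) : k^o).

Local Notation t := (fun (a : J) (x : K) => tau (a \ox x) : k^o).
Local Notation t' := (fun (a : J) (x : K) => tau (antipode a \ox x) : k^o).
Local Notation l := (fun (w : W) (v : V) => - lambda (w \ox v) : k^o).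
Local Notation mu := (conv_lambda tau lambda).

Lemma ex_skew_extension : exists T : {scalar (R \otimes J) \otimes (S \otimes K)},
  skew_pairing (boson R) (boson S) T /\ gen_values t l T.
Proof.
have [pR [pRi pRm pRa]] := degree_one_projection R.
have [pS [pSi pSm pSa]] := degree_one_projection S.
have [phi phiE] := ex_pairings (phi_fun_bilin tau lambda pR).
have [psi psiE] := ex_pairings (psi_fun_bilin tau lambda pS).
have compat c d : phi d (boson_gen R c) = psi c (boson_gen S d).
  case: c d => [a|v] [x|w] /=; rewrite phiE psiE /=.
  - by rewrite !braided_counit1.
  - by rewrite (pR1 pRm) (lin0 (pure_linr _)) linear0 counit_iota !mul0r oppr0.
  - rewrite counit_iota mul0r (pS1 pSm); apply/esym/eqP; rewrite oppr_eq0; apply/eqP.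
    by rewrite -[RHS](sw_0 k^o (ydcoact v)); sweq g u; rewrite (lin0 (pure_linl _)) linear0 mulr0.
  - rewrite pRi pSi counit1 mulr1; congr (- _).
    under eq_sw => g u do rewrite (tau1r tau_skew).
    by rewrite (sw_ydcoact1 (F := fun u => lambda (w \ox u) : k^o)) //; mlin.
have [T [Ts TC TD]] := extend_pairing (boson_bialgebra R) (boson_bialgebra S)
  (@boson_is_cop _ _ _ R) (@boson_is_cop _ _ _ S) (@boson_generates _ _ _ R) (@boson_generates
    _ _ _ S)
  (phiM tau_skew lambda_act_r pRm pRa phiE)
  (psiM tau_skew lambda_act_l pSm pSa psiE)
  (phi1 S tau_skew pRm phiE) (psi1 R tau_skew pSm psiE) compat.
exists T; split=> //; split=> [a x|a w|v x|v w].
- by rewrite (TC (inl a)) psiE /= braided_counit1 mul1r.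
- by rewrite (TC (inl a)) psiE /= counit_iota mul0r.
- by rewrite (TD _ (inl x)) phiE /= counit_iota mul0r.
- by rewrite (TD _ (inr w)) phiE /= pRi counit1 mulr1.
Qed.

Lemma ex_skew_extension_inv : exists T : {scalar (R \otimes J) \otimes (S \otimes K)},
  skew_pairing (opp_ops (boson R)) (opp_ops (boson S)) T /\ gen_values t' mu T.
Proof.
have [pR [pRi pRm pRa]] := degree_one_projection R.
have [pS [pSi pSm pSa]] := degree_one_projection S.
have [phi phiE] := ex_pairings (phi_inv_fun_bilin tau lambda pR).
have [psi psiE] := ex_pairings (psi_inv_fun_bilin tau lambda pS).
have compat c d : phi d (boson_gen R c) = psi c (boson_gen S d).
  case: c d => [a|v] [x|w] /=; rewrite phiE psiE /=.
  - by rewrite !braided_counit1.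
  - rewrite (pR1 pRm) counit_iota !mul0r -[RHS](sw_0 k^o (ydcoact w)).
    by sweq h z; rewrite (lin0 (conv_lambda_linr _ _ _)) mulr0.
  - by rewrite counit_iota mul0r (pS1 pSm) (lin0 (conv_lambda_linl _ _ _)) mul0r.
  - have lml := conv_lambda_linl tau lambda.
    rewrite pRi pSi counit1 mulr1 antipode1.
    under eq_sw => h z do rewrite (tau1l tau_skew).
    by rewrite (sw_ydcoact1 (F := fun z => mu z v : k^o)) //; mlin.
have [T [Ts TC TD]] := extend_pairing (opp_bialgebra (boson_bialgebra R)) (opp_bialgebra
  (boson_bialgebra S))
  (@boson_is_cop _ _ _ R) (@boson_is_cop _ _ _ S)
  (opp_generates (@boson_generates _ _ _ R)) (opp_generates (@boson_generates _ _ _ S))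
  (phi_invM tau_skew lambda_act_r pRm pRa phiE)
  (psi_invM tau_skew lambda_act_l pSm pSa psiE)
  (phi_inv1 S tau_skew pRm phiE) (psi_inv1 R tau_skew pSm psiE) compat.
exists T; split=> //; split=> [a x|a w|v x|v w].
- by rewrite (TC (inl a)) psiE /= braided_counit1 mul1r.
- by rewrite (TC (inl a)) psiE /= counit_iota mul0r.
- by rewrite (TD _ (inl x)) phiE /= counit_iota mul0r.
- by rewrite (TC (inr v)) psiE /= pSi counit1 mulr1.
Qed.

Variables T T' : {scalar (R \otimes J) \otimes (S \otimes K)}.
Hypotheses (Ts : skew_pairing (boson R) (boson S) T) (Tv : gen_values t l T).
Hypotheses (Ts' : skew_pairing (opp_ops (boson R)) (opp_ops (boson S)) T') (Tv' : gen_values t'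
  mu T').
Local Notation eA := (op_counit (boson R)).
Local Notation eB := (op_counit (boson S)).

Lemma skew_extension_conv a b : pair_conv (boson R) (boson S) T T' a b = eA a * eB b.
Proof.
apply: (pair_conv_gen (boson_bialgebra R) (boson_bialgebra S) (@boson_is_cop _ _ _ R)
  (@boson_generates _ _ _ R) (@boson_generates _ _ _ S) Ts Ts').
apply: (pair_conv_gen_values Tv Tv').
- exact: tau_antipode_inv.
- by rewrite antipode1 (tau1l tau_skew) counit1.
- by move=> v w; rewrite (conv_lambdaK tau_skew) addNr.
Qed.

Lemma skew_extension_convl a b : pair_conv (boson R) (boson S) T' T a b = eA a * eB b.
Proof.
apply: (pair_conv_gen (opp_bialgebra (boson_bialgebra R)) (opp_bialgebra (boson_bialgebra S))
  (@boson_is_cop _ _ _ R) (opp_generates (@boson_generates _ _ _ R))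
  (opp_generates (@boson_generates _ _ _ S)) Ts' (opp_opp_skew Ts)).
apply: (pair_conv_gen_values Tv' Tv).
- exact: tau_antipode_invl.
- by rewrite (tau1l tau_skew) counit1.
- move=> v w; rewrite /conv_lambda -sw_split -[RHS](sw_0 k^o (ydcoact v)); sweq g u.
  by rewrite -sw_split -[RHS](sw_0 k^o (ydcoact w)); sweq h z; rewrite mulrN subrr.
Qed.

Local Notation L := (tens_ops (boson R) (boson S)).
Local Notation sigma := (skew_cocycle (boson R) (boson S) T).
Variable sigma' : {scalar (R \otimes J) \otimes (S \otimes K) \otimes ((R \otimes J) \otimes (S
  \otimes K))}.
Hypothesis sigma'P : conv_inverse L sigma sigma'.
Local Notation dot := (deformed_mul L sigma sigma').
Local Notation iA a := (a \ox op_one (boson S)).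
Local Notation iB b := (op_one (boson R) \ox b).

Lemma extension_mulE b a : dot (iB b) (iA a) =
  \sw_(a1, ar <- op_comul (boson R) a) \sw_(a2, a3 <- op_comul (boson R) ar)
  \sw_(b1, br <- op_comul (boson S) b) \sw_(b2, b3 <- op_comul (boson S) br)
    ((T (a1 \ox b1) * T' (a3 \ox b3)) *: (a2 \ox b2)).
Proof.
exact: (deformed_mulE (boson_bialgebra R) (boson_bialgebra S)
  skew_extension_convl sigma'P).
Qed.

Lemma mul_hopf_hopf x a : dot (iB (in_hopf S x)) (iA (in_hopf R a)) =
  \sw_(a1, ar <- comul a) \sw_(a2, a3 <- comul ar)
  \sw_(x1, xr <- comul x) \sw_(x2, x3 <- comul xr)
    ((tau (a1 \ox x1) * tau (antipode a3 \ox x3)) *: (in_hopf R a2 \ox in_hopf S x2)).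
Proof.
rewrite extension_mulE sw_comul_in_hopf3; [|move=> ? ?; mlin..].
apply: eq_sw => a1 ar; apply: eq_sw => a2 a3.
rewrite sw_comul_in_hopf3; [|move=> ? ?; mlin..].
apply: eq_sw => x1 xr; apply: eq_sw => x2 x3.
by rewrite (gen_hopf_hopf Tv) (gen_hopf_hopf Tv').
Qed.

Lemma mul_hopf_mod x v : dot (iB (in_hopf S x)) (iA (in_mod R v)) =
  \sw_(vm1, v0 <- ydcoact v) \sw_(x1, x2 <- comul x)
    (tau (vm1 \ox x1) *: (in_mod R v0 \ox in_hopf S x2)).
Proof.
rewrite extension_mulE sw_comul_in_mod3; [|move=> ? ?; mlin..].
rewrite -[RHS]add0r -[RHS]addr0; congr (_ + _ + _).
- rewrite sw_comul_in_hopf3; [|move=> ? ?; mlin..].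
  rewrite /sweedler big1 // => p _; rewrite big1 // => q _.
  by rewrite (gen_mod_hopf Tv) mul0r scale0r.
- apply: eq_sw => g u; rewrite sw_comul_in_hopf3; [|move=> ? ?; mlin..].
  apply: eq_sw => x1 xr.
  under eq_sw => x2 x3.
    rewrite (gen_hopf_hopf Tv) (gen_hopf_hopf Tv') antipode1 (tau1l tau_skew) mulrC -scalerA.
  over.
  rewrite (sw_counitr (F := fun x2 => tau (g \ox x1) *: (in_mod R u \ox in_hopf S x2))) //.
  by rewrite /in_hopf; mlin.
- rewrite -[RHS](sw_0 _ (ydcoact v)); apply: eq_sw => g u.
  rewrite -[RHS](sw_0 _ (ydcoact u)); apply: eq_sw => g' u'.
  rewrite sw_comul_in_hopf3; [|move=> ? ?; mlin..].
  rewrite /sweedler big1 // => p _; rewrite big1 // => q _.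
  by rewrite (gen_mod_hopf Tv') mulr0 scale0r.
Qed.

Lemma mul_mod_hopf w a : dot (iB (in_mod S w)) (iA (in_hopf R a)) =
  \sw_(a1, a2 <- comul a) \sw_(wm1, w0 <- ydcoact w)
    (tau (a1 \ox wm1) *: (in_hopf R a2 \ox in_mod S w0)).
Proof.
rewrite extension_mulE sw_comul_in_hopf3; [|move=> ? ?; mlin..].
apply: eq_sw => a1 ar.
transitivity (\sw_(a2, a3 <- comul ar) (counit a3 *: (\sw_(h, z <- ydcoact w)
   (tau (a1 \ox h) *: (in_hopf R a2 \ox in_mod S z))))).
  apply: eq_sw => a2 a3; rewrite sw_comul_in_mod3; [|move=> ? ?; mlin..].
  rewrite (gen_hopf_mod Tv) mul0r scale0r add0r -[RHS]addr0; congr (_ + _).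
    rewrite -sw_scaler; apply: eq_sw => h z.
    by rewrite (gen_hopf_hopf Tv) (gen_hopf_hopf Tv') (tau1r tau_skew) counit_antipode mulrC
      scalerA.
  rewrite /sweedler big1 // => p _; rewrite big1 // => q _.
  by rewrite (gen_hopf_mod Tv') mulr0 scale0r.
rewrite (sw_counitr (F := fun a2 => \sw_(h, z <- ydcoact w)
   (tau (a1 \ox h) *: (in_hopf R a2 \ox in_mod S z)))) //.
by rewrite /in_hopf; mlin.
Qed.

Lemma mul_mod_mod w v : dot (iB (in_mod S w)) (iA (in_mod R v)) =
  \sw_(vm1, v0 <- ydcoact v) \sw_(wm1, w0 <- ydcoact w)
    (tau (vm1 \ox wm1) *: (in_mod R v0 \ox in_mod S w0))
  - lambda (w \ox v) *: op_one L
  + \sw_(vm1, v0 <- ydcoact v) \sw_(wm1, w0 <- ydcoact w)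
      (lambda (w0 \ox v0) *: dot (iB (in_hopf S wm1)) (iA (in_hopf R vm1))).
Proof.
rewrite extension_mulE sw_comul_in_mod3; [|move=> ? ?; mlin..].
congr (_ + _).
  rewrite addrC; congr (_ + _).
    apply: eq_sw => g u; rewrite sw_comul_in_mod3; [|move=> ? ?; mlin..].
    rewrite (gen_hopf_mod Tv) mul0r scale0r add0r -[RHS]addr0; congr (_ + _).
      apply: eq_sw => h z.
      by rewrite (gen_hopf_hopf Tv) (gen_hopf_hopf Tv') antipode1 (tau1l tau_skew) counit1 mulr1.
    rewrite /sweedler big1 // => p _; rewrite big1 // => q _.
    by rewrite (gen_hopf_mod Tv') mulr0 scale0r.
  rewrite sw_comul_in_mod3; [|move=> ? ?; mlin..].
  rewrite (gen_mod_mod Tv) (gen_hopf_hopf Tv') antipode1 (tau1l tau_skew) counit1 mulr1 scaleNr.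
  rewrite -[RHS]addr0 -[RHS]addr0; congr (_ + _ + _).
    by rewrite /sweedler big1 // => p _; rewrite (gen_mod_hopf Tv) mul0r scale0r.
  rewrite /sweedler big1 // => p _; rewrite big1 // => q _.
  by rewrite (gen_mod_hopf Tv) mul0r scale0r.
transitivity (\sw_(g, u <- ydcoact v) \sw_(g', u' <- ydcoact u) \sw_(p, q <- ydcoact u')
  \sw_(h, z <- ydcoact w) \sw_(h', z' <- ydcoact z) \sw_(r, s <- ydcoact z')
  ((tau (g \ox h) * tau (antipode p \ox r) * lambda (s \ox q)) *: (in_hopf R g' \ox in_hopf S
    h'))).
  apply: eq_sw => g u; apply: eq_sw => g' u'; rewrite sw_comul_in_mod3; [|move=> ? ?; mlin..].
  rewrite (gen_hopf_mod Tv) mul0r scale0r add0r.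
  transitivity (0 + \sw_(h, z <- ydcoact w) \sw_(h', z' <- ydcoact z)
    ((tau (g \ox h) * mu z' u') *: (in_hopf R g' \ox in_hopf S h'))).
    congr (_ + _).
      rewrite -[RHS](sw_0 _ (ydcoact w)); apply: eq_sw => h z.
      by rewrite (gen_mod_hopf Tv') mulr0 scale0r.
    by apply: eq_sw => h z; apply: eq_sw => h' z'; rewrite (gen_hopf_hopf Tv) (gen_mod_mod Tv').
  rewrite add0r -[RHS](sw_exch2 _ _ _ (fun h z h' z' p q => \sw_(r, s <- ydcoact z')
  ((tau (g \ox h) * tau (antipode p \ox r) * lambda (s \ox q)) *: (in_hopf R g' \ox in_hopf S
    h')))).
  apply: eq_sw => h z; apply: eq_sw => h' z'.
  have lX : linear (fun c : k^o => (c : k) *: (in_hopf R g' \ox in_hopf S h')) by mlin.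
  rewrite /conv_lambda sw_mulr (sw_lin _ _ lX); apply: eq_sw => p q.
  by rewrite sw_mulr (sw_lin _ _ lX); apply: eq_sw => r s; rewrite mulrA.
under eq_sw => g u.
  rewrite -(sw_ydcoactA (F := fun g' p q => \sw_(h, z <- ydcoact w) \sw_(h', z' <- ydcoact z)
    \sw_(r, s <- ydcoact z')
  ((tau (g \ox h) * tau (antipode p \ox r) * lambda (s \ox q)) *: (in_hopf R g' \ox in_hopf S
    h'))));
    [|move=> ? ?; rewrite /in_hopf; mlin..].
over.
rewrite -(sw_ydcoactA (F := fun g y q => \sw_(g', p <- comul y) \sw_(h, z <- ydcoact w)
  \sw_(h', z' <- ydcoact z) \sw_(r, s <- ydcoact z')
  ((tau (g \ox h) * tau (antipode p \ox r) * lambda (s \ox q)) *: (in_hopf R g' \ox in_hopf S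
    h'))));
    [|move=> ? ?; rewrite /in_hopf; mlin..].
apply: eq_sw => y q.
transitivity (\sw_(x, s <- ydcoact w) \sw_(g, y' <- comul y) \sw_(g', p <- comul y')
  \sw_(h, x' <- comul x) \sw_(h', r <- comul x')
  ((tau (g \ox h) * tau (antipode p \ox r) * lambda (s \ox q)) *: (in_hopf R g' \ox in_hopf S
    h'))).
  rewrite -[RHS]sw_exch2; apply: eq_sw => g y'; apply: eq_sw => g' p.
  under eq_sw => h z.
    rewrite -(sw_ydcoactA (F := fun h' r s => ((tau (g \ox h) * tau (antipode p \ox r) * lambda
      (s \ox q)) *:
      (in_hopf R g' \ox in_hopf S h')))); [|move=> ? ?; rewrite /in_hopf; mlin..].
  over.
  by rewrite -(sw_ydcoactA (F := fun h x' s => \sw_(h', r <- comul x')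
    ((tau (g \ox h) * tau (antipode p \ox r) * lambda (s \ox q)) *:
      (in_hopf R g' \ox in_hopf S h')))) //; move=> ? ?; rewrite /in_hopf; mlin.
apply: eq_sw => x s; rewrite mul_hopf_hopf -!sw_scaler.
apply: eq_sw => g y'; rewrite -sw_scaler; apply: eq_sw => g' p.
rewrite -sw_scaler; apply: eq_sw => h x'; rewrite -sw_scaler; apply: eq_sw => h' r.
by rewrite scalerA mulrC.
Qed.
End Main.

Theorem theorem4p3 (k : fieldType) (J K : hopfAlgType k)
  (J_bij : bijective (@antipode k J)) (K_bij : bijective (@antipode k K))
  (V : ydModType J) (W : ydModType K)
  (R : preNichols V) (S : preNichols W)
  (tau : {scalar J \otimes K})
  (tau_skew : skew_pairing (hopf_ops J) (hopf_ops K) tau)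
  (lambda : {scalar W \otimes V})
  (lambda_act_l : forall (x : K) (w : W) (v : V),
    lambda (ydact x w \ox v) =
      \sw_(vm1, v0 <- ydcoact v)
        (tau (vm1 \ox antipode x) * lambda (w \ox v0) : k^o))
  (lambda_act_r : forall (a : J) (w : W) (v : V),
    lambda (w \ox ydact a v) =
      \sw_(wm1, w0 <- ydcoact w)
        (tau (a \ox wm1) * lambda (w0 \ox v) : k^o)) :
  exists T : {scalar (R \otimes J) \otimes (S \otimes K)},
    [/\ skew_extension tau lambda T,
        forall T' : {scalar (R \otimes J) \otimes (S \otimes K)},
          skew_extension tau lambda T' -> T' =1 T
      & let L := tens_ops (boson R) (boson S) in
        let sigma := skew_cocycle (boson R) (boson S) T in
        two_cocycle L sigma /\
        forall sigma', conv_inverse L sigma sigma' ->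
        let dot := deformed_mul L sigma sigma' in
        let emb_l (r : R \otimes J) := r \ox op_one (boson S) in
        let emb_r (s : S \otimes K) := op_one (boson R) \ox s in
        [/\ forall (x : K) (a : J),
              dot (emb_r (in_hopf S x)) (emb_l (in_hopf R a)) =
                \sw_(a1, ar <- comul a) \sw_(a2, a3 <- comul ar)
                \sw_(x1, xr <- comul x) \sw_(x2, x3 <- comul xr)
                  ((tau (a1 \ox x1) * tau (antipode a3 \ox x3)) *:
                     (in_hopf R a2 \ox in_hopf S x2)),
            forall (x : K) (v : V),
              dot (emb_r (in_hopf S x)) (emb_l (in_mod R v)) =
                \sw_(vm1, v0 <- ydcoact v) \sw_(x1, x2 <- comul x)
                  (tau (vm1 \ox x1) *: (in_mod R v0 \ox in_hopf S x2)),
            forall (w : W) (a : J),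
              dot (emb_r (in_mod S w)) (emb_l (in_hopf R a)) =
                \sw_(a1, a2 <- comul a) \sw_(wm1, w0 <- ydcoact w)
                  (tau (a1 \ox wm1) *: (in_hopf R a2 \ox in_mod S w0))
          & forall (w : W) (v : V),
              dot (emb_r (in_mod S w)) (emb_l (in_mod R v)) =
                \sw_(vm1, v0 <- ydcoact v) \sw_(wm1, w0 <- ydcoact w)
                  (tau (vm1 \ox wm1) *: (in_mod R v0 \ox in_mod S w0))
                - lambda (w \ox v) *: op_one L
                + \sw_(vm1, v0 <- ydcoact v) \sw_(wm1, w0 <- ydcoact w)
                    (lambda (w0 \ox v0) *:
                       dot (emb_r (in_hopf S wm1)) (emb_l (in_hopf R vm1)))]].
Proof.
have [T [Ts Tv]] := ex_skew_extension R S tau_skew lambda_act_l lambda_act_r.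
have [T' [Ts' Tv']] := ex_skew_extension_inv R S tau_skew lambda_act_l lambda_act_r.
exists T; split.
- by case: Tv => *; split.
- move=> T2 [T2s T2a T2b T2c T2d].
  apply: (skew_eq_gen (@boson_is_cop _ _ _ R) (@boson_generates _ _ _ R) (@boson_generates _ _
    _ S) T2s Ts).
  case: Tv => Ta Tb Tc Td.
  by case=> [a|v] [x|w] /=; rewrite ?T2a ?T2b ?T2c ?T2d ?Ta ?Tb ?Tc ?Td.
- split.
    apply: (skew_cocycle_two_cocycle (T' := T') (boson_bialgebra R) (boson_bialgebra S) Ts).
      exact: (skew_extension_conv tau_skew Ts Tv Ts' Tv').
    exact: (skew_extension_convl tau_skew Ts Tv Ts' Tv').
  move=> sigma' sigma'P; split.
  + exact: (mul_hopf_hopf tau_skew Ts Tv Ts' Tv' sigma'P).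
  + exact: (mul_hopf_mod tau_skew Ts Tv Ts' Tv' sigma'P).
  + exact: (mul_mod_hopf tau_skew Ts Tv Ts' Tv' sigma'P).
  + exact: (mul_mod_mod tau_skew Ts Tv Ts' Tv' sigma'P).
Qed.
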